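(* Let $\mathscr P$ be the sequence of randomized stationary policies resulting from the proposed algorithm (described in the context) with $V=\sqrt T$ and $\alpha=T$, and let $d_0$ be the starting state (distribution) of the proposed algorithm. For any (joint) randomized stationary policy $\Pi$ starting from $d_0$ such that $(d_0,\Pi)\in\mathcal G$, $$F_T(d_0,\mathscr P)-F_T(d_0,\Pi)\le\mathcal O\Big(m^{3/2}K^2\sum_{k=1}^K|\mathcal A^{(k)}||\mathcal S^{(k)}|\cdot\sqrt T\Big),$$ $$G_{i,T}(d_0,\mathscr P)\le\mathcal O\Big(m^{3/2}K^2\sum_{k=1}^K|\mathcal A^{(k)}||\mathcal S^{(k)}|\cdot\sqrt T\Big),\qquad i=1,2,\dots,m,$$ where the constants hidden in $\mathcal O(\cdot)$ do not depend on $T$ or on $\Pi$.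
   Context: **Model.** $K$ parallel MDPs; the $k$-th has finite state space $\mathcal S^{(k)}$, finite action space $\mathcal A^{(k)}$, transition matrices $P^{(k)}_a(s,s')$. On slot $t=0,1,2,\dots$ MDP $k$ is in state $s_t^{(k)}$ and uses action $a_t^{(k)}$. After the slot $t$ decision, penalty functions $f_t^{(k)}(a,s)$ and constraint functions $g_{i,t}^{(k)}(a,s)$, $i=1,\dots,m$, are revealed. They have the form $g_{i,t}^{(k)}(a,s)=\hat g_i^{(k)}(a,s,\omega_t)$, $f_t^{(k)}(a,s)=\hat f^{(k)}(a,s,\mu_t)$ with $|\hat g_i^{(k)}|,|\hat f^{(k)}|\le\Psi$; the random processes $\{\omega_t\},\{\mu_t\}$ are generated before any control action is taken (oblivious), $\{\omega_t\}$ is i.i.d. and independent of $\{\mu_t\}$, and $\{\mu_t\}$ is arbitrary. Bold $\mathbf f_t^{(k)},\mathbf g_{i,t}^{(k)}\in\mathbb R^{|\mathcal A^{(k)}||\mathcal S^{(k)}|}$ denote the vectors of values. For a policy $\mathscr P$ and a distribution $d_0$ of the initial joint state, $$F_T(d_0,\mathscr P)=\mathbb E\Big[\sum_{t=0}^{T-1}\sum_{k=1}^Kf_t^{(k)}(a_t^{(k)},s_t^{(k)})\Big|d_0,\mathscr P\Big],\quad G_{i,T}(d_0,\mathscr P)=\mathbb E\Big[\sum_{t=0}^{T-1}\sum_{k=1}^Kg_{i,t}^{(k)}(a_t^{(k)},s_t^{(k)})\Big|d_0,\mathscr P\Big],$$ and $\mathcal G$ is the set of pairs (initial distribution, policy)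 with $G_{i,T}\le0$ for $i=1,\dots,m$. A joint randomized stationary policy $\Pi$ chooses the joint action $\mathbf a$ given the joint state $\mathbf s$ by a fixed conditional probability $\Pi(\mathbf a|\mathbf s)$; it is separable if $\Pi(\mathbf a|\mathbf s)=\prod_k\pi^{(k)}(a^{(k)}|s^{(k)})$. A randomized stationary policy $\pi$ on MDP $k$ has transition matrix $\mathbf P_\pi^{(k)}(s,s')=\sum_a\pi(a|s)P_a^{(k)}(s,s')$; it is pure if deterministic. **Assumptions.** (1) There is $\widehat r\ge1$ such that for all $r\ge\widehat r$ and all $k$, $\mathbf P^{(k)}_{\pi_1}\cdots\mathbf P^{(k)}_{\pi_r}$ has strictly positive entries for any pure policies $\pi_1,\dots,\pi_r$ of MDP $k$. (2) Given $s_t^{(k)},a_t^{(k)}$, the next state $s_{t+1}^{(k)}$ is independent of all other past information up to time $t$ (states, actions of all MDPs, and the whole processes $\{\omega_t\},\{\mu_t\}$) and of $s_{t+1}^{(j)}$, $j\ne k$. (3) (Slater) There are $\eta>0$ and a separable randomized stationary policy $\widetilde\pi$ with stationary distribution $d_{\widetilde\pi}$ such that $\mathbb E[\sum_kg_{i,t}^{(k)}(a_t^{(k)},s_t^{(k)})|d_{\widetilde\pi},\widetilde\pi]\le-\eta$ for all $i$. **State-action polyhedron.** $\Theta^{(k)}$ is the set of probability vectors $\theta$ on $\mathcal A^{(k)}\times\mathcal S^{(k)}$ with $\sum_s\sum_a\theta(a,s)P_a^{(k)}(s,s')=\sum_a\theta(a,s')$ for all $s'$. A vector $\theta\in\Theta^{(k)}$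 gives the policy $\pi(a|s)=\theta(a,s)/\sum_{a'}\theta(a',s)$ (and $0$ if the denominator is $0$). **Proposed algorithm** (parameters $V,\alpha>0$). $\theta_0^{(k)}\in\Theta^{(k)}$ is the stationary state-action vector of any separable randomized stationary policy $\pi_0$, which is used on slot $0$. $Q_i(0)=Q_i(1)=0$. On each slot $t\ge1$: MDP $k$ sets $\theta_t^{(k)}=\arg\min_{\theta\in\Theta^{(k)}}\langle V\mathbf f_{t-1}^{(k)}+\sum_{i=1}^mQ_i(t)\mathbf g_{i,t-1}^{(k)},\theta\rangle+\alpha\|\theta-\theta_{t-1}^{(k)}\|_2^2$, draws $a_t^{(k)}$ from $\pi_t^{(k)}(\cdot|s_t^{(k)})$, where $\pi_t^{(k)}$ is the policy given by $\theta_t^{(k)}$; then $Q_i(t+1)=\max\{Q_i(t)+\sum_{k=1}^K\langle\mathbf g_{i,t-1}^{(k)},\theta_t^{(k)}\rangle,0\}$. *)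

(* Defs.v *)
From mathcomp Require Import all_boot all_order all_algebra.
From mathcomp Require Import all_classical all_reals all_analysis.
Set Implicit Arguments.
Unset Strict Implicit.
Unset Printing Implicit Defensive.
Import Order.TTheory GRing.Theory Num.Theory.
Import numFieldNormedType.Exports.
Local Open Scope classical_set_scope.
Local Open Scope ring_scope.

Definition is_dist (R : realType) (X : finType) (p : X -> R) : Prop :=
  (forall x, 0 <= p x) /\ \sum_x p x = 1.

(* A single MDP with states S, actions A and transition probabilities
   P a s s'.  Everything here applies both to each component MDP and to the
   joint MDP, whose states and actions are the K-tuples of those of the
   components. *)
Section SingleMDP.
Context {R : realType} {S A : finType}.
Implicit Types (P : A -> S -> S -> R) (pi : S -> A -> R).

Definition is_transition P : Prop := forall a s, is_dist (P a s).

(* pi s a is the conditional probability pi(a|s). *)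
Definition is_policy pi : Prop := forall s, is_dist (pi s).

Definition policy_kernel P pi (s s' : S) : R := \sum_a pi s a * P a s s'.

Definition pure (sg : {ffun S -> A}) (s : S) (a : A) : R := (a == sg s)%:R.

Definition kernel_comp (p q : S -> S -> R) (s s' : S) : R :=
  \sum_u p s u * q u s'.

(* P_{sg_1} ... P_{sg_r} for a list of pure policies sg_1, ..., sg_r. *)
Definition pure_product P (sgs : seq {ffun S -> A}) : S -> S -> R :=
  foldr (fun sg q => kernel_comp (policy_kernel P (pure sg)) q)
        (fun s s' => (s == s')%:R) sgs.

Definition is_stationary P pi (d : S -> R) : Prop :=
  is_dist d /\ forall s', \sum_s d s * policy_kernel P pi s s' = d s'.

(* Worst-case r-step contraction (Dobrushin) coefficient: the largest total
   variation distance between two rows of a product of r pure-policy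
   transition matrices.  For the joint MDP, where pure policies may correlate
   the components, it is not controlled uniformly in K by the coefficients of
   the components. *)
Definition mixing_coef P (r : nat) : R :=
  \big[Num.max/0]_(sgs : r.-tuple {ffun S -> A})
    \big[Num.max/0]_(s : S) \big[Num.max/0]_(s' : S)
      (2^-1 * \sum_u `|pure_product P sgs s u - pure_product P sgs s' u|).

Definition in_polyhedron P (theta : A -> S -> R) : Prop :=
  [/\ forall a s, 0 <= theta a s,
      \sum_a \sum_s theta a s = 1 &
      forall s', \sum_s \sum_a theta a s * P a s s' = \sum_a theta a s'].

Definition inner (u v : A -> S -> R) : R := \sum_a \sum_s u a s * v a s.

Definition sqdist (u v : A -> S -> R) : R :=
  \sum_a \sum_s (u a s - v a s) ^+ 2.

(* Since x / 0 = 0, this is 0 when the denominator vanishes. *)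
Definition induced_policy (theta : A -> S -> R) (s : S) (a : A) : R :=
  theta a s / \sum_(a' : A) theta a' s.

Definition is_argmin (D : (A -> S -> R) -> Prop) (obj : (A -> S -> R) -> R)
    (theta : A -> S -> R) : Prop :=
  D theta /\ forall theta', D theta' -> obj theta <= obj theta'.

End SingleMDP.

Notation joint X := {dffun forall k, X k}.

Section ParallelMDPs.
Context {R : realType} {K : nat} {S A : 'I_K -> finType}.
Variable P : forall k, A k -> S k -> S k -> R.

(* Given the current states and actions, the component MDPs move independently
   of each other. *)
Definition joint_transition (a : joint A) (s s' : joint S) : R :=
  \prod_k P (a k) (s k) (s' k).

Definition separable_policy (pi : forall k, S k -> A k -> R)
    (s : joint S) (a : joint A) : R :=
  \prod_k pi k (s k) (a k).

Definition positive_products (rhat : nat) : Prop :=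
  forall (k : 'I_K) (sgs : seq {ffun S k -> A k}), (rhat <= size sgs)%N ->
    forall s s', 0 < pure_product (@P k) sgs s s'.

(* The sample space Omega carries only the oblivious processes omega_t, mu_t.
   A decision rule may depend on them (as the proposed algorithm does); a value
   process gives the penalties or constraint values revealed at each slot. *)
Context {dO : measure_display} {Omega : measurableType dO}.
Variable Pr : probability Omega R.

Definition decision_rule := nat -> Omega -> joint S -> joint A -> R.
Definition value_process := nat -> Omega -> forall k, A k -> S k -> R.

Definition stationary_rule (Pi : joint S -> joint A -> R) : decision_rule :=
  fun _ _ => Pi.

(* Conditional probability, given the whole sample path w of the oblivious
   processes, of the states x 0, ..., x T and actions a 0, ..., a (T-1): the
   initial state does not depend on w, and the transitions depend on the past
   (including w) only through the current state and action. *)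
Definition path_prob (d0 : joint S -> R) (pol : decision_rule) (T : nat)
    (w : Omega) (x : {ffun 'I_T.+1 -> joint S}) (a : {ffun 'I_T -> joint A})
    : R :=
  d0 (x ord0) *
  \prod_(t < T) (pol t w (x (widen_ord (leqnSn T) t)) (a t) *
    joint_transition (a t) (x (widen_ord (leqnSn T) t)) (x (lift ord0 t))).

(* The expectation E[ phi | d0, pol ] of a function phi of w and of the states
   and actions of slots 0, ..., T-1. *)
Definition path_expectation (d0 : joint S -> R) (pol : decision_rule) (T : nat)
    (phi : Omega -> ('I_T -> joint S) -> ('I_T -> joint A) -> R) : R :=
  let mean w :=
    \sum_(x : {ffun 'I_T.+1 -> joint S}) \sum_(a : {ffun 'I_T -> joint A})
      path_prob d0 pol w x a * phi w (fun t => x (widen_ord (leqnSn T) t)) a in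
  fine ('E_Pr[mean])%E.

Definition slot_value (h : value_process) (t : nat) (w : Omega)
    (s : joint S) (a : joint A) : R :=
  \sum_k h t w k (a k) (s k).

(* F_T when h = f, and G_{i,T} when h = g_i. *)
Definition expected_total (h : value_process) (T : nat) (d0 : joint S -> R)
    (pol : decision_rule) : R :=
  @path_expectation d0 pol T
    (fun w s a => \sum_(t < T) slot_value h t w (s t) (a t)).

Definition slot_expectation (h : value_process) (t : nat) (d0 : joint S -> R)
    (pol : decision_rule) : R :=
  @path_expectation d0 pol t.+1
    (fun w s a => slot_value h t w (s ord_max) (a ord_max)).

Definition feasible_pairs (m : nat) (g : 'I_m -> value_process) (T : nat)
    : set ((joint S -> R) * decision_rule) :=
  [set q | forall i, expected_total (g i) T q.1 q.2 <= 0].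

Definition slater (m : nat) (g : 'I_m -> value_process) (eta : R) : Prop :=
  exists (pi : forall k, S k -> A k -> R) (d : joint S -> R),
    [/\ forall k, is_policy (pi k),
        is_stationary joint_transition (separable_policy pi) d &
        forall i t,
          slot_expectation (g i) t d (stationary_rule (separable_policy pi)) <= - eta].

(* The iterates theta_t and Q_i(t) of the algorithm on every sample path;
   pi0 is the policy used on slot 0. *)
Definition algorithm_iterates (m : nat) (f : value_process)
    (g : 'I_m -> value_process) (V alpha : R)
    (pi0 : forall k, S k -> A k -> R)
    (theta : value_process) (Q : 'I_m -> nat -> Omega -> R) : Prop :=
  (forall k, is_policy (pi0 k) /\
     exists2 d : S k -> R, is_stationary (@P k) (pi0 k) d &
       forall w a s, theta 0%N w k a s = d s * pi0 k s a) /\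
  forall w,
  [/\ forall i, Q i 0%N w = 0,
      forall i, Q i 1%N w = 0,
      forall t k,
        is_argmin (in_polyhedron (@P k))
          (fun th =>
             inner (fun a s => V * f t w k a s +
                               \sum_(i < m) Q i t.+1 w * g i t w k a s) th
             + alpha * sqdist th (theta t w k))
          (theta t.+1 w k) &
      forall i t,
        Q i t.+2 w =
        Num.max (Q i t.+1 w + \sum_k inner (g i t w k) (theta t.+1 w k)) 0].

Definition algorithm_rule (pi0 : forall k, S k -> A k -> R)
    (theta : value_process) : decision_rule :=
  fun t w => if t is 0%N then separable_policy pi0
             else separable_policy (fun k => induced_policy (theta t w k)).

End ParallelMDPs.

Section Processes.
Context {R : realType} {dO : measure_display} {Omega : measurableType dO}.
Variable Pr : probability Omega R.

Definition measurable_process d (E : measurableType d)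
    (X : nat -> Omega -> E) : Prop :=
  forall t, measurable_fun setT (X t).

Definition process_sigma d (E : measurableType d) (X : nat -> Omega -> E)
    : set (set Omega) :=
  <<s \bigcup_t preimage_set_system setT (X t) measurable >>.

Definition iid d (E : measurableType d) (X : nat -> Omega -> E) : Prop :=
  (forall t (B : set E), measurable B ->
     Pr (X t @^-1` B) = Pr (X 0%N @^-1` B)) /\
  (forall (ts : seq nat) (B : nat -> set E), uniq ts ->
     (forall t, measurable (B t)) ->
     Pr (\bigcap_(t in [set` ts]) (X t @^-1` B t)) =
     (\prod_(t <- ts) Pr (X t @^-1` B t))%E).

Definition independent_processes d d' (E : measurableType d)
    (E' : measurableType d') (X : nat -> Omega -> E) (Y : nat -> Omega -> E')
    : Prop :=
  forall B C : set Omega, process_sigma X B -> process_sigma Y C ->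
    Pr (B `&` C) = (Pr B * Pr C)%E.

End Processes.

(* Main.v *)
(* Fix a path of the oblivious processes.  Strong convexity of the update gives,
   for every comparator t in the product of the polyhedra, a one-slot inequality
   for L_n = |Q(n+1)|^2 / 2 + alpha |t - theta_n|^2.  Since Q(n+1) and theta_n
   depend only on omega_0, ..., omega_(n-1) and mu, the products Q_i(n+1) g_(i,n)
   factorize in expectation.
   With the Slater policy as comparator, summation bounds the average of
   E |Q(n)|_1, hence the total movement of theta, and the negative drift of
   sqrt (2 L_n) bounds an exponential moment, hence E Q_i(T+1).
   On each path the state laws of the component MDPs chase the stationary laws
   of theta_n; contraction over r slots makes the total lag proportional to the
   total movement.  A joint policy Pi started from d0 is within O(1) in total of
   its stationary regime, whose coordinate marginals lie in the polyhedra, so it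
   may be replaced by a comparator violating the constraints by O(1/T). *)
From HB Require Import structures.
Require Import Defs.
From mathcomp Require Import all_boot all_order all_algebra.
From mathcomp Require Import all_classical all_reals all_analysis.
From mathcomp Require Import measurable_realfun ring lra.
Set Implicit Arguments.
Unset Strict Implicit.
Unset Printing Implicit Defensive.
Import Order.TTheory GRing.Theory Num.Theory.
Import numFieldNormedType.Exports.
Local Open Scope classical_set_scope.
Local Open Scope ring_scope.

(** * Finite Markov decision processes and mixing *)

Section Chains.
Context {R : realType} {S A : finType}.
Implicit Types (P : A -> S -> S -> R) (pi : S -> A -> R) (e : S -> R).

(** The constant may depend only on [Psi], [eta], [rhat] and the joint mixing coefficient, so all
    powers of m, K and N = sum |A||S| have to be tracked. Positivity is assumed for pure products of
    one component, whereas Pi may correlate the components: the joint coefficient is shown to be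
    below 1 and to dominate the component ones, so that one number rho = rhat / (1 - gam) serves the
    algorithm and Pi alike. The proximal term has weight alpha = T. Inside the Lyapunov function it
    telescopes, and it separates sqrt (2 L_n) from the Euclidean norm of Q by at most 2 sqrt (T K),
    which is within the target order. Above a threshold, sqrt (2 L_n) grows per slot by at most B =
    O(sqrt m K); the exponential moment yields B^3, that is m^(3/2) K^3, whose third K is absorbed
    by N. The movement of theta costs N times the average of V + |Q|_1, of order m K^2 sqrt T. A
    comparator violating the constraints by O(1/T) costs O(1/T) times the sum of E |Q|_1, which is
    O(T^(3/2)), divided by V = sqrt T: bounded in T. *)

Definition l1 (X : finType) (e : X -> R) : R := \sum_x `|e x|.

Lemma l1_ge0 (X : finType) (e : X -> R) : 0 <= l1 e.
Proof. exact: sumr_ge0. Qed.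

Lemma l1_dist (X : finType) (e : X -> R) : is_dist e -> l1 e = 1.
Proof. by move=> [e0 <-]; apply: eq_bigr => x _; rewrite ger0_norm. Qed.

Lemma l1D (X : finType) (e e' : X -> R) : l1 (fun x => e x + e' x) <= l1 e + l1 e'.
Proof. by rewrite -big_split; apply: ler_sum => x _; exact: ler_normD. Qed.

Lemma l1B (X : finType) (e e' : X -> R) : l1 (fun x => e x - e' x) <= l1 e + l1 e'.
Proof. by rewrite -big_split; apply: ler_sum => x _; exact: ler_normB. Qed.

Lemma policy_kernel_dist P pi : is_transition P -> is_policy pi ->
  forall s, is_dist (policy_kernel P pi s).
Proof.
move=> hP hpi s; split=> [s'|].
  by apply: sumr_ge0 => a _; rewrite mulr_ge0 ?(hpi s).1 ?(hP a s).1.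
rewrite exchange_big /= -(hpi s).2; apply: eq_bigr => a _.
by rewrite -mulr_sumr (hP a s).2 mulr1.
Qed.

Lemma pure_policy (sg : {ffun S -> A}) : is_policy (R := R) (pure sg).
Proof.
move=> s; split=> [a|]; first by rewrite /pure ler0n.
rewrite (bigD1 (sg s)) //= /pure eqxx big1 ?addr0 // => a /negbTE ->.
by [].
Qed.

Lemma policy_kernel_pure P (sg : {ffun S -> A}) s s' :
  policy_kernel P (pure sg) s s' = P (sg s) s s'.
Proof.
rewrite /policy_kernel (bigD1 (sg s)) //= /pure eqxx mul1r big1 ?addr0 //.
by move=> a /negbTE ->; rewrite mul0r.
Qed.

Lemma pure_product_dist P sgs : is_transition P ->
  forall s, is_dist (pure_product P sgs s).
Proof.
move=> hP; elim: sgs => [|sg sgs IH] s; split=> /=.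
- by move=> s'; rewrite ler0n.
- rewrite (bigD1 s) //= eqxx big1 ?addr0 // => u; rewrite eq_sym => /negbTE ->.
  by [].
- move=> s'; apply: sumr_ge0 => u _; apply: mulr_ge0; last exact: (IH u).1.
  exact: (policy_kernel_dist hP (pure_policy sg) s).1.
- rewrite exchange_big /= -(policy_kernel_dist hP (pure_policy sg) s).2.
  by apply: eq_bigr => u _; rewrite -mulr_sumr (IH u).2 mulr1.
Qed.

Definition evolve P pi e (s' : S) : R := \sum_s e s * policy_kernel P pi s s'.

Lemma sum_evolve P pi e : is_transition P -> is_policy pi ->
  \sum_s evolve P pi e s = \sum_s e s.
Proof.
move=> hP hpi; rewrite exchange_big /=; apply: eq_bigr => s _.
by rewrite -mulr_sumr (policy_kernel_dist hP hpi s).2 mulr1.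
Qed.

Lemma evolve_dist P pi e : is_transition P -> is_policy pi ->
  is_dist e -> is_dist (evolve P pi e).
Proof.
move=> hP hpi [e0 e1]; split; last by rewrite sum_evolve.
move=> s'; apply: sumr_ge0 => s _.
by rewrite mulr_ge0 // (policy_kernel_dist hP hpi s).1.
Qed.

Lemma l1_evolve P pi e : is_transition P -> is_policy pi ->
  l1 (evolve P pi e) <= l1 e.
Proof.
move=> hP hpi; have hk := policy_kernel_dist hP hpi.
apply: (@le_trans _ _ (\sum_s' \sum_s `|e s| * policy_kernel P pi s s')).
  apply: ler_sum => s' _; apply: le_trans (ler_norm_sum _ _ _) _.
  by apply: ler_sum => s _; rewrite normrM (ger0_norm ((hk s).1 s')).
rewrite exchange_big /=; apply: ler_sum => s _.
by rewrite -mulr_sumr (hk s).2 mulr1.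
Qed.

Lemma evolveD P pi e e' :
  evolve P pi (fun s => e s + e' s) =
  (fun s => evolve P pi e s + evolve P pi e' s).
Proof.
by apply/funext => s'; rewrite -big_split; apply: eq_bigr => s _; rewrite mulrDl.
Qed.

Lemma evolveB P pi e e' s' :
  evolve P pi (fun s => e s - e' s) s' = evolve P pi e s' - evolve P pi e' s'.
Proof.
by rewrite /evolve -sumrB; apply: eq_bigr => s _; rewrite mulrBl.
Qed.

Fixpoint evolve_n P (pis : nat -> S -> A -> R) n e : S -> R :=
  if n is n'.+1 then evolve P (pis n') (evolve_n P pis n' e) else e.

Lemma evolve_nD P pis n e e' :
  evolve_n P pis n (fun s => e s + e' s) =
  (fun s => evolve_n P pis n e s + evolve_n P pis n e' s).
Proof. by elim: n => //= n ->; rewrite evolveD. Qed.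

Lemma l1_evolve_n P pis n e : is_transition P -> (forall j, is_policy (pis j)) ->
  l1 (evolve_n P pis n e) <= l1 e.
Proof.
move=> hP hpi; elim: n => //= n IH.
by apply: le_trans (l1_evolve _ hP (hpi n)) IH.
Qed.

Lemma evolve_nSl P pis n e :
  evolve_n P pis n.+1 e = evolve_n P (fun j => pis j.+1) n (evolve P (pis 0%N) e).
Proof. by elim: n => //= n <-. Qed.

(** Drawing an action independently at every state before the step gives a random pure policy; only
    the draw at [s] affects row [s], and the other factors sum to 1. *)
Lemma policy_kernel_mixture P pi : is_policy pi -> forall s s',
  policy_kernel P pi s s' =
  \sum_(sg : {ffun S -> A}) (\prod_t pi t (sg t)) * policy_kernel P (pure sg) s s'.
Proof.
move=> hpi s s'.
transitivity (\sum_(sg : {ffun S -> A})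
   \prod_t (pi t (sg t) * (if t == s then P (sg t) s s' else 1))).
  rewrite -(bigA_distr_bigA (fun t a => pi t a * (if t == s then P a s s' else 1))).
  rewrite (bigD1 s) //= eqxx [X in _ * X]big1 ?mulr1 // => t /negbTE ->.
  by apply: etrans (hpi t).2; apply: eq_bigr => a _; rewrite mulr1.
apply: eq_bigr => sg _; rewrite big_split /= policy_kernel_pure; congr (_ * _).
by rewrite -big_mkcond big_pred1_eq.
Qed.

Lemma mixture_weight_sum pi : is_policy pi ->
  \sum_(sg : {ffun S -> A}) \prod_t pi t (sg t) = 1.
Proof.
move=> hpi; rewrite -(bigA_distr_bigA pi) big1 // => t _.
exact: (hpi t).2.
Qed.

Definition convex_closed (C : (S -> R) -> Prop) := forall (I : finType) (w : I -> R)
  (F : I -> S -> R), (forall i, 0 <= w i) -> \sum_i w i = 1 ->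
  (forall i, C (F i)) -> C (fun u => \sum_i w i * F i u).

(** Randomized steps are mixtures of pure steps, hence so are their products. This carries
    properties of products of pure kernels over to time-varying randomized policies, both for
    contraction and for positivity. *)
Lemma evolve_n_convex P pis r e (C : (S -> R) -> Prop) :
  (forall j, is_policy (pis j)) -> convex_closed C ->
  (forall sgs, size sgs = r -> C (fun u => \sum_s e s * pure_product P sgs s u)) ->
  C (evolve_n P pis r e).
Proof.
move=> hpi hC hpure.
(* The last steps are replaced first: [n] randomized steps remain, followed by the pure ones in
   [sgs]. *)
suff H : forall n sgs, (size sgs + n)%N = r ->
    C (fun u => \sum_s evolve_n P pis n e s * pure_product P sgs s u).
  have := H r [::] (add0n r); congr C; apply/funext => u /=.
  rewrite (bigD1 u) //= eqxx mulr1 big1 ?addr0 // => s /negbTE ->.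
  by rewrite mulr0.
elim=> [|n IH] sgs hs; first by apply: hpure; rewrite -hs addn0.
have -> : (fun u => \sum_s evolve_n P pis n.+1 e s * pure_product P sgs s u) =
  (fun u => \sum_(sg : {ffun S -> A}) (\prod_t pis n t (sg t)) *
     \sum_s evolve_n P pis n e s * pure_product P (sg :: sgs) s u).
  apply/funext => u; rewrite /=.
  under [RHS]eq_bigr => sg _ do rewrite mulr_sumr.
  rewrite [RHS]exchange_big /=.
  under [LHS]eq_bigr => s _ do rewrite mulr_suml.
  rewrite [LHS]exchange_big /=; apply: eq_bigr => s _.
  under [LHS]eq_bigr => z _.
    rewrite (policy_kernel_mixture _ (hpi n)) mulr_sumr mulr_suml.
    over.
  rewrite exchange_big /=; apply: eq_bigr => sg _.
  rewrite /kernel_comp !mulr_sumr; apply: eq_bigr => z _; ring.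
apply: hC => [sg||sg].
- by apply: prodr_ge0 => t _; exact: (hpi n t).1.
- exact: mixture_weight_sum.
- by apply: IH; rewrite /= addSnnS.
Qed.

(** Dobrushin's argument: the positive and negative parts [p], [q] of [e] have the same mass [m],
    and pairing them writes [m] times the image of [e] as a combination of row differences, each of
    l1 norm at most [2 * gam]. *)
Lemma l1_contraction (M : S -> S -> R) gam e :
  (forall s s', 2^-1 * \sum_u `|M s u - M s' u| <= gam) ->
  \sum_s e s = 0 -> l1 (fun u => \sum_s e s * M s u) <= gam * l1 e.
Proof.
move=> hM he0.
pose p s := Num.max (e s) 0; pose q s := Num.max (- e s) 0.
have epq s : e s = p s - q s by rewrite /p /q /Num.max; do 2 case: ifP; lra.
have npq s : `|e s| = p s + q s.
  case: (lerP 0 (e s)) => h; [rewrite ger0_norm //|rewrite ltr0_norm //];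
    by rewrite /p /q /Num.max; do 2 case: ifP; lra.
have p0 s : 0 <= p s by rewrite /p le_max lexx orbT.
have q0 s : 0 <= q s by rewrite /q le_max lexx orbT.
pose m := \sum_s p s.
have mq : \sum_s q s = m.
  have : m - \sum_s q s = 0.
    by rewrite -sumrB -[RHS]he0; apply: eq_bigr => s _; rewrite -epq.
  by move/subr0_eq.
have hl : l1 e = m + m.
  by rewrite -{2}mq -big_split; apply: eq_bigr => s _; rewrite npq.
have m0 : 0 <= m by exact: sumr_ge0.
have key u : m * (\sum_s e s * M s u) =
    \sum_s \sum_s' p s * q s' * (M s u - M s' u).
  transitivity ((\sum_s p s * M s u) * (\sum_s q s) - (\sum_s p s) * (\sum_s q s * M s u)).
    rewrite mq -/m [X in X - _]mulrC -mulrBr -sumrB; congr (_ * _).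
    by apply: eq_bigr => s _; rewrite epq mulrBl.
  rewrite !big_distrlr -sumrB; apply: eq_bigr => s _.
  by rewrite -sumrB; apply: eq_bigr => s' _ /=; ring.
(* The identity [key] carries the factor [m]; when it vanishes, so does [e]. *)
have [m_eq0|m_neq0] := eqVneq m 0.
  have le0 : l1 e <= 0 by rewrite hl m_eq0 addr0.
  have e0 s : e s = 0.
    apply/eqP; rewrite -normr_le0; apply: le_trans le0.
    by rewrite /l1 (bigD1 s) //= lerDl sumr_ge0.
  rewrite /l1 !big1 ?mulr0 // => u _; first by rewrite e0 normr0.
  by rewrite big1 ?normr0 // => s _; rewrite e0 mul0r.
have m_gt0 : 0 < m by rewrite lt_def m_neq0.
rewrite -(ler_pM2l m_gt0) /l1 mulr_sumr.
apply: (@le_trans _ _ (\sum_s \sum_s' p s * q s' * \sum_u `|M s u - M s' u|)).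
  under [X in _ <= X]eq_bigr => s _.
    under eq_bigr => s' _ do rewrite mulr_sumr.
    rewrite exchange_big /=; over.
  rewrite exchange_big /=; apply: ler_sum => u _.
  rewrite -{1}(gtr0_norm m_gt0) -normrM key.
  apply: le_trans (ler_norm_sum _ _ _) _; apply: ler_sum => s _.
  apply: le_trans (ler_norm_sum _ _ _) _; apply: ler_sum => s' _.
  by rewrite normrM ger0_norm ?mulr_ge0.
apply: (@le_trans _ _ (\sum_s \sum_s' p s * q s' * (2 * gam))).
  apply: ler_sum => s _; apply: ler_sum => s' _.
  apply: ler_wpM2l; first by rewrite mulr_ge0.
  by rewrite -ler_pdivrMl ?ltr0n.
under eq_bigr => s _ do rewrite -mulr_suml.
rewrite -mulr_suml -big_distrlr /= mq -/m -/(l1 e) hl le_eqVlt; apply/orP; left.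
by apply/eqP; ring.
Qed.

Lemma row_distance_le_mixing_coef P (sgs : seq {ffun S -> A}) s s' :
  2^-1 * \sum_u `|pure_product P sgs s u - pure_product P sgs s' u| <=
  mixing_coef P (size sgs).
Proof.
rewrite /mixing_coef.
apply: le_trans (le_bigmax _ _ (in_tuple sgs)).
apply: le_trans (le_bigmax _ _ s).
pose dist s' := 2^-1 * \sum_u `|pure_product P sgs s u - pure_product P sgs s' u|.
exact: (le_bigmax _ dist s').
Qed.

Lemma evolve_n_contraction P pis r e : is_transition P ->
  (forall j, is_policy (pis j)) -> \sum_s e s = 0 ->
  l1 (evolve_n P pis r e) <= mixing_coef P r * l1 e.
Proof.
move=> hP hpi he.
apply: (@evolve_n_convex P pis r e (fun v => l1 v <= mixing_coef P r * l1 e)) => //.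
- move=> I w F w0 w1 hF.
  apply: (@le_trans _ _ (\sum_i w i * l1 (F i))).
    under [X in _ <= X]eq_bigr => i _ do rewrite mulr_sumr.
    rewrite exchange_big /=; apply: ler_sum => u _.
    apply: le_trans (ler_norm_sum _ _ _) _; apply: ler_sum => i _.
    by rewrite normrM ger0_norm.
  rewrite -[X in _ <= X]mul1r -w1 mulr_suml; apply: ler_sum => i _.
  exact: ler_wpM2l.
- move=> sgs <-; apply: l1_contraction => // s s'.
  exact: row_distance_le_mixing_coef.
Qed.

(* The potential N t := sum_(i < r) |evolve_n i (e t)| drops by at least
   (1 - mixing_coef) |e t| in each step, up to r |delta t|. *)
Lemma mixing_sum P pis r (e delta : nat -> S -> R) T : is_transition P ->
  (forall j, is_policy (pis j)) -> (forall t, \sum_s e t s = 0) ->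
  (forall t s, e t.+1 s = evolve P (pis t) (e t) s + delta t s) ->
  (1 - mixing_coef P r) * \sum_(t < T) l1 (e t) <=
  r%:R * (l1 (e 0%N) + \sum_(t < T) l1 (delta t)).
Proof.
move=> hP hpi he hrec.
pose N t := \sum_(i < r) l1 (evolve_n P (fun j => pis (t + j)%N) i (e t)).
have N_ge0 t : 0 <= N t by apply: sumr_ge0 => i _; exact: l1_ge0.
have N_le t : N t.+1 <= N t - (1 - mixing_coef P r) * l1 (e t) + r%:R * l1 (delta t).
  pose x i := l1 (evolve_n P (fun j => pis (t + j)%N) i (e t)).
  have h1 : N t.+1 <= \sum_(i < r) x i.+1 + r%:R * l1 (delta t).
    rewrite mulr_natl -[X in _ *+ X]card_ord -sumr_const -big_split /=.
    apply: ler_sum => i _.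
    have -> : e t.+1 = (fun s => evolve P (pis t) (e t) s + delta t s).
      by apply/funext => s; exact: hrec.
    rewrite evolve_nD; apply: le_trans (l1D _ _) _; apply: lerD.
      rewrite /x evolve_nSl addn0.
      by under [X in _ <= l1 (evolve_n _ X _ _)]eq_fun => j do rewrite -addSnnS.
    exact: l1_evolve_n.
  apply: le_trans h1 _; rewrite lerD2r.
  (* Shifting the index exchanges [x 0] for [x r], the one term to which the r-step contraction
     applies. *)
  have h2 : \sum_(i < r) x i.+1 + x 0%N = N t + x r.
    by rewrite /N -[RHS](big_ord_recr _ x) big_ord_recl addrC.
  have h3 : x r <= mixing_coef P r * l1 (e t) by exact: evolve_n_contraction.
  have h4 : x 0%N = l1 (e t) by [].
  lra.
have N0 : N 0%N <= r%:R * l1 (e 0%N).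
  rewrite mulr_natl -[X in _ *+ X]card_ord -sumr_const.
  by apply: ler_sum => i _; exact: l1_evolve_n.
have H : N T + (1 - mixing_coef P r) * \sum_(t < T) l1 (e t) <=
         N 0%N + r%:R * \sum_(t < T) l1 (delta t).
  elim: T => [|T IH]; first by rewrite !big_ord0 !mulr0.
  rewrite !big_ord_recr /= !mulrDr.
  have := N_le T; lra.
have := N_ge0 T; lra.
Qed.

Lemma evolve_n_stationary P pi d n : is_stationary P pi d ->
  evolve_n P (fun=> pi) n d = d.
Proof.
by move=> [_ hd]; elim: n => //= n ->; apply/funext => s; exact: hd.
Qed.

(** The law [d] is fixed by r steps of [pi], so it is a mixture of rows of pure products, whose
    entries are all positive. *)
Lemma stationary_gt0 P pi d r : is_policy pi -> is_stationary P pi d ->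
  (forall sgs : seq {ffun S -> A}, size sgs = r ->
     forall s s', 0 < pure_product P sgs s s') ->
  forall s, 0 < d s.
Proof.
move=> hpi hd hpos.
have mix_gt0 (I : finType) (w F : I -> R) : (forall i, 0 <= w i) -> \sum_i w i = 1 ->
    (forall i, 0 < F i) -> 0 < \sum_i w i * F i.
  move=> w0 w1 F0; have := @oner_neq0 R; rewrite -w1 psumr_neq0 //.
  case/hasP=> i _ wi; rewrite (bigD1 i) //= ltr_pwDl ?mulr_gt0 //.
  by apply: sumr_ge0 => j _; rewrite mulr_ge0 // ltW.
rewrite -(evolve_n_stationary r hd).
apply: (@evolve_n_convex P _ r d (fun v => forall s, 0 < v s)) => //.
- by move=> I w F w0 w1 hF s; apply: mix_gt0.
- by move=> sgs hs u; apply: mix_gt0 => [s||s]; [exact: hd.1.1|exact: hd.1.2|exact: hpos].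
Qed.

End Chains.

(** * Occupation measures and the joint process *)

Section Occupation.
Context {R : realType} {S A : finType}.
Implicit Types (P : A -> S -> S -> R) (pi : S -> A -> R) (theta : A -> S -> R).

Definition state_marginal theta (s : S) : R := \sum_a theta a s.

(** The policy need only disintegrate [theta]: this covers the induced policies, the policy used on
    slot 0, and the completed policy of the next positivity argument. *)
Lemma polyhedron_stationary P pi theta : in_polyhedron P theta ->
  (forall a s, theta a s = state_marginal theta s * pi s a) ->
  is_stationary P pi (state_marginal theta).
Proof.
move=> [th0 th1 thP] hpi; split; first split.
- by move=> s; apply: sumr_ge0.
- by rewrite exchange_big.
- move=> s'; rewrite -[RHS]thP; apply: eq_bigr => s _.
  by rewrite mulr_sumr; apply: eq_bigr => a _; rewrite mulrA -hpi.
Qed.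

Lemma stationary_polyhedron P pi d : is_policy pi -> is_stationary P pi d ->
  in_polyhedron P (fun a s => d s * pi s a).
Proof.
move=> hpi [[d0 d1] dP].
have hm s : \sum_a d s * pi s a = d s by rewrite -mulr_sumr (hpi s).2 mulr1.
split=> [a s||s'].
- by rewrite mulr_ge0 // (hpi s).1.
- by rewrite exchange_big /= -[RHS]d1; apply: eq_bigr => s _; rewrite hm.
- rewrite hm -[RHS]dP; apply: eq_bigr => s _.
  by rewrite mulr_sumr; apply: eq_bigr => a _; rewrite mulrA.
Qed.

(* On states of zero mass the induced policy is not a policy; an arbitrary
   action there leaves stationarity intact. *)
Lemma state_marginal_gt0 P theta r : in_polyhedron P theta ->
  (forall sgs : seq {ffun S -> A}, size sgs = r ->
     forall s s', 0 < pure_product P sgs s s') ->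
  forall s, 0 < state_marginal theta s.
Proof.
move=> hth hpos; have [th0 th1 thP] := hth.
have [a0 _] : exists a : A, true.
  case: (pickP (fun _ : A => true)) => [a _|noA]; first by exists a.
  by move: th1; rewrite big_pred0 // => /esym/eqP; rewrite oner_eq0.
pose pi s a := if state_marginal theta s == 0 then (a == a0)%:R
               else induced_policy theta s a.
have hpi : is_policy pi.
  move=> s; rewrite /pi; case: eqP => [_|/eqP dn0].
    split=> [a|]; first by rewrite ler0n.
    by rewrite (bigD1 a0) //= eqxx big1 ?addr0 // => a /negbTE ->.
  split=> [a|]; first by rewrite divr_ge0 ?sumr_ge0.
  by rewrite -mulr_suml divff.
apply: (stationary_gt0 hpi _ hpos); apply: polyhedron_stationary => // a s.
rewrite /pi; case: eqP => [d0|/eqP dn0]; last by rewrite mulrC divfK.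
rewrite d0 mul0r; apply/eqP; rewrite eq_le th0 andbT -d0 /state_marginal.
by rewrite (bigD1 a) //= lerDl sumr_ge0.
Qed.

Lemma induced_policy_policy theta : (forall a s, 0 <= theta a s) ->
  (forall s, 0 < state_marginal theta s) -> is_policy (induced_policy theta).
Proof.
move=> th0 hd s; split=> [a|]; first by rewrite divr_ge0 ?sumr_ge0.
by rewrite -mulr_suml divff // gt_eqF // hd.
Qed.

Lemma induced_policyE theta : (forall s, 0 < state_marginal theta s) ->
  forall a s, theta a s = state_marginal theta s * induced_policy theta s a.
Proof. by move=> hd a s; rewrite mulrC divfK // gt_eqF // hd. Qed.

(* An eigenvector v of eigenvalue 1 has |v| <= |v| M entrywise, and summing
   the entries turns this into an equality. *)
Lemma stationary_exists P pi (s0 : S) : is_transition P -> is_policy pi ->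
  exists d, is_stationary P pi d.
Proof.
move=> hP hpi; have hk := policy_kernel_dist hP hpi.
pose n := #|S|; pose ev : 'I_n -> S := enum_val.
pose M : 'M[R]_n := \matrix_(i, j) policy_kernel P pi (ev i) (ev j).
have sumE (F : S -> R) : \sum_s F s = \sum_(i < n) F (ev i).
  by rewrite (reindex ev) //; exact/onW_bij/enum_val_bij.
(* The rows of [M] sum to 1, so [M - 1] kills the constant vector; being singular, it also has a
   left null vector, the eigenvector [v]. *)
have : \det (M - 1%:M)^T == 0.
  apply/det0P; exists (const_mx 1).
    apply/eqP => /rowP/(_ (enum_rank s0)); rewrite !mxE => /eqP.
    by rewrite oner_eq0.
  apply/rowP => i; rewrite !mxE.
  under eq_bigr => j _ do rewrite !mxE mul1r.
  rewrite sumrB -(sumE (policy_kernel P pi (ev i))) (hk (ev i)).2.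
  by rewrite (bigD1 i) //= eqxx big1 ?addr0 ?subrr // => j; rewrite eq_sym => /negbTE ->.
rewrite det_tr => /det0P[v vn0]; rewrite mulmxBr mulmx1 => /eqP.
rewrite subr_eq0 => /eqP hv.
pose w s := `|v 0 (enum_rank s)|.
have w0 s : 0 <= w s by exact: normr_ge0.
have wle s' : w s' <= evolve P pi w s'.
  rewrite {1}/w -hv mxE; apply: le_trans (ler_norm_sum _ _ _) _.
  rewrite /evolve sumE; apply: ler_sum => i _.
  rewrite !mxE /ev enum_rankK normrM /w enum_valK.
  by rewrite (ger0_norm ((hk _).1 _)).
have weq s' : evolve P pi w s' = w s'.
  have : \sum_s (evolve P pi w s - w s) == 0 by rewrite sumrB sum_evolve // subrr.
  rewrite psumr_eq0 => [|s _]; last by rewrite subr_ge0.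
  by move/allP/(_ s' (mem_index_enum _))/eqP/subr0_eq.
have wsum : 0 < \sum_s w s.
  rewrite lt_def sumr_ge0 // andbT; apply: contra vn0 => hw.
  apply/eqP/rowP => i; rewrite mxE.
  move: hw; rewrite psumr_eq0 // => /allP/(_ (ev i) (mem_index_enum _)).
  by rewrite /w /ev enum_valK normr_eq0 => /eqP.
exists (fun s => w s / \sum_s w s); split; first split.
- by move=> s; rewrite divr_ge0 // ltW.
- by rewrite -mulr_suml divff // gt_eqF.
- move=> s'; rewrite -[in RHS]weq /evolve mulr_suml; apply: eq_bigr => s _.
  by rewrite mulrAC.
Qed.

End Occupation.

(** * The product chain and its coordinate marginals *)

Section Joint.
Context {R : realType} {K : nat}.

Lemma sum_delta (X : finType) (c : X) (F : X -> R) :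
  \sum_j (j == c)%:R * F j = F c.
Proof.
rewrite (bigD1 c) //= eqxx mul1r big1 ?addr0 // => j /negbTE ->.
by rewrite mul0r.
Qed.

(** Distributivity for dependent functions. Through [fprod] the sum runs over functions into a
    tagged union, where the non-dependent law applies. *)
Lemma prod_sum_joint (X : 'I_K -> finType) (F : forall k, X k -> R) :
  \sum_(x : joint X) \prod_k F k (x k) = \prod_k \sum_(j : X k) F k j.
Proof.
rewrite (reindex (@dffun_of_fprod _ X)) /=; last exact/onW_bij/dffun_of_fprod_bij.
pose G k := [ffun j : X k => F k j].
transitivity (\sum_(f : fprod X) \prod_(k in 'I_K) G k (f k)).
  by apply: eq_bigr => f _; apply: eq_bigr => k _; rewrite !ffunE.
rewrite big_fprod.
under [RHS]eq_bigr => k _ do rewrite (@big_tag _ 0 +%R _ X F k).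
rewrite bigA_distr_big_dep; apply: eq_bigr => f _; apply: eq_bigr => k _.
by congr (untag _ _ _); apply/funext => z; rewrite ffunE.
Qed.

Lemma sum_joint_dist (X : 'I_K -> finType) (F : forall k, X k -> R) :
  (forall k, \sum_j F k j = 1) -> \sum_(x : joint X) \prod_k F k (x k) = 1.
Proof. by move=> hF; rewrite prod_sum_joint big1. Qed.

Lemma sum_joint_coord (X : 'I_K -> finType) (F : forall k, X k -> R)
    (k : 'I_K) (phi : X k -> R) : (forall l, \sum_j F l j = 1) ->
  \sum_(x : joint X) phi (x k) * \prod_l F l (x l) = \sum_j phi j * F k j.
Proof.
move=> hF.
(* Padding [phi] by 1 on the other coordinates turns the summand into a product over all
   coordinates. *)
pose psi : forall l, X l -> R := eqtype.dfwith (fun l (_ : X l) => 1) phi.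
have psik : psi k = phi by rewrite /psi dfwith_in.
have psil l : l != k -> psi l = fun=> 1 by move=> lk; rewrite /psi dfwith_out // eq_sym.
transitivity (\sum_(x : joint X) \prod_l (psi l (x l) * F l (x l))).
  apply: eq_bigr => x _; rewrite big_split /=; congr (_ * _).
  by rewrite (bigD1 k) //= psik big1 ?mulr1 // => l /psil ->.
rewrite (prod_sum_joint (fun l j => psi l j * F l j)) (bigD1 k) //= psik [X in _ * X]big1 ?mulr1 //.
move=> l /psil ->.
by apply: etrans (hF l); apply: eq_bigr => j _; rewrite mul1r.
Qed.

Context {S A : 'I_K -> finType}.
Variable P : forall k, A k -> S k -> S k -> R.
Hypothesis hP : forall k, is_transition (@P k).
Implicit Types (pi : forall k, S k -> A k -> R) (Pi : joint S -> joint A -> R).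

Lemma joint_transition_transition : is_transition (joint_transition P).
Proof.
move=> a s; split=> [s'|]; first by apply: prodr_ge0 => k _; exact: (hP _ _).1.
exact: (@sum_joint_dist S (fun k => P (a k) (s k)) (fun k => (hP _ _).2)).
Qed.

Lemma separable_policy_policy pi : (forall k, is_policy (pi k)) ->
  is_policy (separable_policy pi).
Proof.
move=> hpi s; split=> [a|]; first by apply: prodr_ge0 => k _; exact: (hpi _ _).1.
exact: (@sum_joint_dist A (fun k => pi k (s k)) (fun k => (hpi k _).2)).
Qed.

Lemma sum_partition (X Y : finType) (p : X -> Y) (F : X -> Y -> R) :
  \sum_x F x (p x) = \sum_y \sum_(x | p x == y) F x y.
Proof.
rewrite (partition_big p xpredT) //=; apply: eq_bigr => y _.
by apply: eq_bigr => x /eqP ->.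
Qed.

Definition coord_marginal (X : 'I_K -> finType) (v : joint X -> R) k (s : X k) : R :=
  \sum_(x : joint X | x k == s) v x.

Lemma sum_coord_marginal (X : 'I_K -> finType) (v : joint X -> R) k (phi : X k -> R) :
  \sum_s coord_marginal v s * phi s = \sum_x v x * phi (x k).
Proof.
rewrite (sum_partition (fun x : joint X => x k) (fun x s => v x * phi s)).
by apply: eq_bigr => s _; rewrite mulr_suml.
Qed.

Lemma l1_coord_marginalB (X : 'I_K -> finType) (v v' : joint X -> R) k :
  \sum_s `|@coord_marginal X v k s - coord_marginal v' s| <= \sum_x `|v x - v' x|.
Proof.
rewrite (sum_partition (fun x : joint X => x k) (fun x _ => `|v x - v' x|)).
by apply: ler_sum => s _; rewrite -sumrB; exact: ler_norm_sum.
Qed.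

Lemma coord_marginal_transition a s k s' :
  coord_marginal (joint_transition P a s) s' = P (a k) (s k) s'.
Proof.
rewrite -(sum_delta s' (P (a k) (s k))).
rewrite -(@sum_joint_coord S (fun l => P (a l) (s l)) k (fun j => (j == s')%:R)) => [|l].
  rewrite /coord_marginal big_mkcond /=; apply: eq_bigr => x _; case: eqP => _;
  by rewrite ?mul1r ?mul0r.
exact: (hP _ _).2.
Qed.

(** Separability is the point: each coordinate marginal then follows a chain of its own, which fails
    for correlated policies. *)
Lemma coord_marginal_evolve pi (v : joint S -> R) k s' :
  (forall l, is_policy (pi l)) ->
  coord_marginal (evolve (joint_transition P) (separable_policy pi) v) s' =
  evolve (@P k) (pi k) (@coord_marginal S v k) s'.
Proof.
move=> hpi; rewrite /evolve sum_coord_marginal /coord_marginal exchange_big /=.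
apply: eq_bigr => x _; rewrite -mulr_sumr exchange_big /=; congr (_ * _).
under eq_bigr => y _ do rewrite -mulr_sumr -/(coord_marginal _ s') coord_marginal_transition mulrC.
rewrite (@sum_joint_coord A (fun l => pi l (x l)) k (fun a => P a (x k) s')) => [|l].
  by apply: eq_bigr => a _; rewrite mulrC.
exact: (hpi l _).2.
Qed.

Definition coord_occupation (D : joint S -> joint A -> R) k (a : A k) (s : S k) : R :=
  \sum_(x : joint S | x k == s) \sum_(y : joint A | y k == a) D x y.

Lemma sum_coord_occupation D k (phi : A k -> S k -> R) :
  \sum_a \sum_s phi a s * coord_occupation D a s =
  \sum_(x : joint S) \sum_(y : joint A) phi (y k) (x k) * D x y.
Proof.
rewrite exchange_big /=.
rewrite (sum_partition (fun x : joint S => x k)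
  (fun x s => \sum_(y : joint A) phi (y k) s * D x y)).
apply: eq_bigr => s _.
under eq_bigr => a _ do rewrite mulr_sumr.
rewrite exchange_big /=; apply: eq_bigr => x _.
rewrite (sum_partition (fun y : joint A => y k) (fun y a => phi a s * D x y)).
by apply: eq_bigr => a _; rewrite mulr_sumr.
Qed.

Lemma sum_joint_occupation D (h : forall k, A k -> S k -> R) :
  \sum_(x : joint S) \sum_(y : joint A) D x y * (\sum_k h k (y k) (x k)) =
  \sum_k inner (h k) (@coord_occupation D k).
Proof.
under eq_bigr => x _ do (under eq_bigr => y _ do rewrite mulr_sumr).
under eq_bigr => x _ do rewrite exchange_big /=.
rewrite exchange_big /=; apply: eq_bigr => k _.
rewrite /inner sum_coord_occupation; apply: eq_bigr => x _.
by apply: eq_bigr => y _; rewrite mulrC.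
Qed.

Lemma coord_occupation_separable pi (v : joint S -> R) k a s :
  (forall l, is_policy (pi l)) ->
  coord_occupation (fun x y => v x * separable_policy pi x y) a s =
  coord_marginal v s * pi k s a.
Proof.
move=> hpi; rewrite /coord_occupation /coord_marginal mulr_suml.
apply: eq_bigr => x /eqP xs; rewrite -mulr_sumr; congr (_ * _).
rewrite -xs -(sum_delta a (pi k (x k))).
rewrite -(@sum_joint_coord A (fun l => pi l (x l)) k (fun j => (j == a)%:R)) => [|l].
  rewrite big_mkcond /=; apply: eq_bigr => y _; case: eqP => _;
  by rewrite ?mul1r ?mul0r.
exact: (hpi l _).2.
Qed.

(** Joint stationarity, tested against functions of coordinate k alone, is the balance equation of
    component k. Hence even a correlated stationary policy gives a comparator in the product of the
    polyhedra. *)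
Lemma coord_occupation_polyhedron Pi (d : joint S -> R) k : is_policy Pi ->
  is_stationary (joint_transition P) Pi d ->
  in_polyhedron (@P k) (@coord_occupation (fun x y => d x * Pi x y) k).
Proof.
move=> hPi [[d0 d1] dP].
have Pi1 x : \sum_y d x * Pi x y = d x by rewrite -mulr_sumr (hPi x).2 mulr1.
split=> [a s||s'].
- by do 2 (apply: sumr_ge0 => ? _); rewrite mulr_ge0 // (hPi _).1.
- have := sum_coord_occupation (fun x y => d x * Pi x y) (fun (_ : A k) _ => 1).
  under eq_bigr => a _ do under eq_bigr => s _ do rewrite mul1r.
  move=> ->; rewrite -[RHS]d1; apply: eq_bigr => x _; rewrite -[RHS]Pi1.
  by apply: eq_bigr => y _; rewrite mul1r.
(* Both sides of the balance equation at [s'] are joint averages: [h1] of the transition probability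
   into [s'], [h2] of the indicator of [s']. *)
- have h1 := sum_coord_occupation (fun x y => d x * Pi x y) (fun (a : A k) s => P a s s').
  have h2 := sum_coord_occupation (fun x y => d x * Pi x y) (fun (a : A k) s => (s == s')%:R).
  rewrite exchange_big /=.
  under eq_bigr => a _ do under eq_bigr => s _ do rewrite mulrC.
  rewrite h1.
  under [RHS]eq_bigr => a _ do
    rewrite -(sum_delta s' (fun s => coord_occupation (fun x y => d x * Pi x y) a s)).
  rewrite h2.
  under [RHS]eq_bigr => x _ do rewrite -mulr_sumr Pi1 -dP mulrC mulr_suml.
  rewrite [RHS]exchange_big /=; apply: eq_bigr => x _.
  under [RHS]eq_bigr => x' _ do rewrite -mulrA mulr_suml.
  rewrite -mulr_sumr [in RHS]exchange_big /= mulr_sumr; apply: eq_bigr => y _.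
  rewrite -(@coord_marginal_transition y x k s') mulrC -mulrA; congr (_ * _).
  rewrite /coord_marginal big_mkcond mulr_sumr /=; apply: eq_bigr => x' _.
  by case: eqP; rewrite ?mulr1 ?mulr0.
Qed.

Definition joint_set (X : 'I_K -> finType) (x : joint X) k (j : X k) : joint X :=
  [ffun l => eqtype.dfwith x j l].

Lemma joint_setK (X : 'I_K -> finType) (x : joint X) k (j : X k) :
  joint_set x j k = j.
Proof. by rewrite ffunE dfwith_in. Qed.

(** The other components repeat the actions of [y0]. Given the actions they move independently of
    component k, so they sum out of its marginal. *)
Definition lift_pure (y0 : joint A) k (sg : {ffun S k -> A k}) :
  {ffun joint S -> joint A} := [ffun x : joint S => joint_set y0 (sg (x k))].

Lemma coord_marginal_lift y0 k (sgs : seq {ffun S k -> A k}) x s :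
  coord_marginal (pure_product (joint_transition P) (map (lift_pure y0 (k := k)) sgs) x) s =
  pure_product (@P k) sgs (x k) s.
Proof.
elim: sgs x s => [|sg sgs IH] x s /=.
  rewrite /coord_marginal big_mkcond /= (bigD1 x) //= eqxx big1 ?addr0.
    by case: eqP.
  by move=> x' /negbTE; rewrite eq_sym => ->; case: ifP.
rewrite /coord_marginal /kernel_comp exchange_big /=.
under eq_bigr => z _.
  rewrite -mulr_sumr -/(coord_marginal _ s) IH policy_kernel_pure; over.
rewrite -(sum_coord_marginal _ (fun u => pure_product (@P k) sgs u s)).
apply: eq_bigr => u _; congr (_ * _).
by rewrite coord_marginal_transition policy_kernel_pure ffunE joint_setK.
Qed.

(** Lifted pure policies are among the joint ones, and taking a marginal does not increase l1
    distance. *)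
Lemma mixing_coef_coord (x0 : joint S) (y0 : joint A) k r :
  mixing_coef (@P k) r <= mixing_coef (joint_transition P) r.
Proof.
have ge0 : 0 <= mixing_coef (joint_transition P) r by exact: bigmax_ge_id.
rewrite {1}/mixing_coef; apply: bigmax_le => // sgs _.
apply: bigmax_le => // s _; apply: bigmax_le => // s' _.
have := row_distance_le_mixing_coef (joint_transition P)
  (map (lift_pure y0 (k := k)) sgs) (joint_set x0 s) (joint_set x0 s').
rewrite size_map size_tuple; apply: le_trans; apply: ler_wpM2l => //.
rewrite -[in leLHS](joint_setK x0 s) -[in leLHS](joint_setK x0 s').
under eq_bigr => u _ do rewrite -!(coord_marginal_lift y0).
exact: l1_coord_marginalB.
Qed.

(* The greedy minimizing pure policies of the components bound every joint
   pure policy, correlated or not, from below. *)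
Lemma pure_product_joint_ge (y0 : joint A) (y : joint S) n :
  exists2 sgs : forall k, seq {ffun S k -> A k}, forall k, size (sgs k) = n &
    forall (js : seq {ffun joint S -> joint A}) (x : joint S), size js = n ->
      \prod_k pure_product (@P k) (sgs k) (x k) (y k) <=
      pure_product (joint_transition P) js x y.
Proof.
elim: n => [|n [sgs hsz hle]].
  exists (fun=> [::]) => // js x /size0nil -> /=.
  have [->|/eqP xy] := eqVneq x y; first by rewrite big1 // => k _; rewrite eqxx.
  case: (pickP (fun k => x k != y k)) => [k /negbTE xyk|xy0].
    by rewrite (bigD1 k) //= xyk mul0r.
  by case: xy; apply/ffunP => k; apply/eqP/negbFE/xy0.
(* Backward induction: [V k u] is the probability of reaching [y k] from [u] under the policies
   already chosen, and [sg k] prepends the action minimizing it. The joint sum factorizes, so each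
   factor can be minimized separately. *)
pose V k u := pure_product (@P k) (sgs k) u (y k).
pose val k s a := \sum_u P a s u * V k u.
pose sg k : {ffun S k -> A k} := [ffun s => [arg min_(a < y0 k) val k s a]%O].
exists (fun k => sg k :: sgs k) => [k|[|J js] x //= [hjs]]; first by rewrite /= hsz.
have V0 k u : 0 <= V k u.
  exact: (pure_product_dist (sgs k) (@hP k) u).1.
apply: (@le_trans _ _ (\sum_z joint_transition P (J x) x z * \prod_k V k (z k))); last first.
  apply: ler_sum => z _; rewrite policy_kernel_pure ler_wpM2l //.
    exact: (joint_transition_transition _ _).1.
  exact: hle.
under [leRHS]eq_bigr => z _ do rewrite -big_split /=.
rewrite (prod_sum_joint (fun k u => P (J x k) (x k) u * V k u)).
apply: ler_prod => k _; apply/andP; split.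
  apply: sumr_ge0 => u _; rewrite mulr_ge0 //; last exact: V0.
  exact: (policy_kernel_dist (@hP k) (pure_policy _) _).1.
rewrite /= /kernel_comp.
under [leLHS]eq_bigr => u _ do rewrite policy_kernel_pure ffunE.
by case: Order.TotalTheory.arg_minP => // a _ /(_ (J x k) isT).
Qed.

(** Two strictly positive rows overlap: |a - b| < a + b at each entry, while the sums a + b total 2.
    The maximum runs over finitely many policies and states, so strictness survives. *)
Lemma mixing_coef_joint_lt1 (y0 : joint A) r :
  (forall k (sgs : seq {ffun S k -> A k}), size sgs = r ->
     forall s s', 0 < pure_product (@P k) sgs s s') ->
  mixing_coef (joint_transition P) r < 1.
Proof.
move=> hpos; have pos (js : r.-tuple {ffun joint S -> joint A}) x y :
    0 < pure_product (joint_transition P) js x y.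
  have [sgs hsz hle] := pure_product_joint_ge y0 y r.
  apply: lt_le_trans (hle _ _ (size_tuple js)).
  by apply: prodr_gt0 => k _; apply: hpos.
rewrite /mixing_coef; apply: bigmax_lt => // js _; apply: bigmax_lt => // s _.
apply: bigmax_lt => // s' _.
have lt_row u : `|pure_product (joint_transition P) js s u -
   pure_product (joint_transition P) js s' u| <
   pure_product (joint_transition P) js s u + pure_product (joint_transition P) js s' u.
  by have := pos js s u; have := pos js s' u; rewrite ltr_norml; lra.
rewrite ltr_pdivrMl // mulr1.
have -> : 2 = \sum_u (pure_product (joint_transition P) js s u +
    pure_product (joint_transition P) js s' u) :> R.
  have hd := pure_product_dist js joint_transition_transition.
  by rewrite big_split /= (hd s).2 (hd s').2.
rewrite (bigD1 s) //= [ltRHS](bigD1 s) //=; apply: ltr_leD => //.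
by apply: ler_sum => u _; exact: ltW.
Qed.

End Joint.

(** * Laws of states and actions along a path *)

Section Paths.
Context {R : realType}.

Definition ffun_rcons (X : Type) n (y : {ffun 'I_n -> X}) (z : X) : {ffun 'I_n.+1 -> X} :=
  [ffun i => if unlift ord_max i is Some j then y j else z].

Lemma ffun_rcons_max (X : Type) n (y : {ffun 'I_n -> X}) z : ffun_rcons y z ord_max = z.
Proof. by rewrite ffunE unlift_none. Qed.

Lemma ffun_rcons_lt (X : Type) n (y : {ffun 'I_n -> X}) z (i : 'I_n.+1) (j : 'I_n) :
  i = j :> nat -> ffun_rcons y z i = y j.
Proof.
move=> ij; have -> : i = lift ord_max j by apply/val_inj; rewrite /= /bump leqNgt ltn_ord.
by rewrite ffunE liftK.
Qed.

Lemma sum_ffun_rcons (X : finType) n (F : {ffun 'I_n.+1 -> X} -> R) :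
  \sum_x F x = \sum_(y : {ffun 'I_n -> X}) \sum_z F (ffun_rcons y z).
Proof.
rewrite pair_big /=.
rewrite (reindex (fun p : {ffun 'I_n -> X} * X => ffun_rcons p.1 p.2)) //=.
exists (fun x => ([ffun j => x (lift ord_max j)], x ord_max)).
- move=> [y z] _ /=; congr pair; last exact: ffun_rcons_max.
  by apply/ffunP => j; rewrite !ffunE liftK.
- move=> x _; apply/ffunP => i; rewrite ffunE /=.
  by case: unliftP => [j ->|->] //; rewrite ffunE.
Qed.

Lemma sum_ffun0 (X : finType) (F : {ffun 'I_0 -> X} -> R) :
  \sum_x F x = F (ffun0 (card_ord 0)).
Proof.
rewrite (bigD1 (ffun0 (card_ord 0))) //= big1 ?addr0 // => x /eqP[].
by apply/ffunP; case.
Qed.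

Context {S A : finType} (P : A -> S -> S -> R) (pis : nat -> S -> A -> R) (d0 : S -> R).
Hypotheses (hP : is_transition P) (hpis : forall t, is_policy (pis t)).

(** This is [path_prob] with the sample point frozen, stated for a single chain; the joint MDP is an
    instance. *)
Definition path_weight T (x : {ffun 'I_T.+1 -> S}) (a : {ffun 'I_T -> A}) : R :=
  d0 (x ord0) *
  \prod_(t < T) (pis t (x (widen_ord (leqnSn T) t)) (a t) *
    P (a t) (x (widen_ord (leqnSn T) t)) (x (lift ord0 t))).

Let path_weight_rcons T (x : {ffun 'I_T.+1 -> S}) (a : {ffun 'I_T -> A}) s y :
  path_weight (ffun_rcons x s) (ffun_rcons a y) =
  path_weight x a * (pis T (x ord_max) y * P y (x ord_max) s).
Proof.
rewrite /path_weight big_ord_recr /= mulrA; congr (_ * _ * _).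
- by rewrite (@ffun_rcons_lt _ _ _ _ _ ord0).
- apply: eq_bigr => t _.
  rewrite !(@ffun_rcons_lt _ _ a _ _ t) //.
  rewrite (@ffun_rcons_lt _ _ x s (widen_ord _ (widen_ord _ t)) (widen_ord (leqnSn T) t)) //.
  by rewrite (@ffun_rcons_lt _ _ x s (lift ord0 (widen_ord _ t)) (lift ord0 t)).
- rewrite ffun_rcons_max (@ffun_rcons_lt _ _ x _ _ ord_max) //.
  have -> : lift ord0 (ord_max : 'I_T.+1) = ord_max by apply/val_inj; rewrite /= /bump.
  by rewrite ffun_rcons_max.
Qed.

Let sum_path_rcons T (H : {ffun 'I_T.+2 -> S} -> {ffun 'I_T.+1 -> A} -> R) :
  \sum_x \sum_a path_weight x a * H x a =
  \sum_x \sum_a path_weight x a * \sum_y pis T (x ord_max) y *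
     \sum_s P y (x ord_max) s * H (ffun_rcons x s) (ffun_rcons a y).
Proof.
rewrite sum_ffun_rcons; apply: eq_bigr => x _.
under eq_bigr => s _ do rewrite sum_ffun_rcons.
rewrite exchange_big /=; apply: eq_bigr => a _.
rewrite exchange_big /= mulr_sumr; apply: eq_bigr => y _.
rewrite !mulr_sumr; apply: eq_bigr => s _.
by rewrite path_weight_rcons -!mulrA.
Qed.

Let sum_path_last T (psi : S -> R) :
  \sum_x \sum_(a : {ffun 'I_T -> A}) path_weight x a * psi (x ord_max) =
  \sum_s evolve_n P pis T d0 s * psi s.
Proof.
elim: T psi => [|T IH] psi.
  rewrite sum_ffun_rcons sum_ffun0; apply: eq_bigr => s _; rewrite sum_ffun0.
  have e0 : ord0 = ord_max :> 'I_1 by apply/val_inj.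
  by rewrite /path_weight big_ord0 mulr1 e0 ffun_rcons_max.
rewrite sum_path_rcons.
under eq_bigr => x _ do under eq_bigr => a _ do under eq_bigr => y _ do
  under eq_bigr => s _ do rewrite ffun_rcons_max.
rewrite (IH (fun z => \sum_y pis T z y * \sum_s P y z s * psi s)) /=.
under [RHS]eq_bigr => s _ do rewrite mulr_suml.
rewrite [RHS]exchange_big /=; apply: eq_bigr => z _.
rewrite mulr_sumr; under [LHS]eq_bigr => y _ do rewrite !mulr_sumr.
rewrite exchange_big /=; apply: eq_bigr => s _.
rewrite mulr_sumr mulr_suml; apply: eq_bigr => y _.
by rewrite !mulrA.
Qed.

(** The last slot is peeled off: its action and next state sum to 1 in the earlier terms, and in its
    own term only the law of the last state matters. *)
Lemma sum_path_slots T (phi : nat -> S -> A -> R) :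
  \sum_(x : {ffun 'I_T.+1 -> S}) \sum_(a : {ffun 'I_T -> A}) path_weight x a *
     \sum_(t < T) phi t (x (widen_ord (leqnSn T) t)) (a t) =
  \sum_(t < T) \sum_s \sum_y evolve_n P pis t d0 s * pis t s y * phi t s y.
Proof.
elim: T => [|T IH].
  by rewrite big_ord0 big1 // => x _; rewrite big1 // => a _; rewrite big_ord0 mulr0.
rewrite big_ord_recr /= -IH sum_path_rcons.
under [X in _ = _ + X]eq_bigr => s _ do
  (under eq_bigr => y _ do rewrite -mulrA; rewrite -mulr_sumr).
rewrite -sum_path_last -big_split /=; apply: eq_bigr => x _.
rewrite -big_split /=; apply: eq_bigr => a _; rewrite -mulrDr; congr (_ * _).
rewrite -[X in _ = X + _]mul1r -(hpis T (x ord_max)).2 mulr_suml -big_split /=.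
apply: eq_bigr => y _; rewrite -mulrDr; congr (_ * _).
set c := _ + _; transitivity (\sum_s P y (x ord_max) s * c); last first.
  by rewrite -mulr_suml (hP _ _).2 mul1r.
apply: eq_bigr => s _; congr (_ * _); rewrite big_ord_recr /= /c; congr (_ + _).
  apply: eq_bigr => t _; rewrite (@ffun_rcons_lt _ _ a _ _ t) //.
  by rewrite (@ffun_rcons_lt _ _ x _ _ (widen_ord (leqnSn T) t)).
by rewrite ffun_rcons_max (@ffun_rcons_lt _ _ x _ _ ord_max).
Qed.

Lemma sum_path_last_slot T (phi : S -> A -> R) :
  \sum_(x : {ffun 'I_T.+2 -> S}) \sum_(a : {ffun 'I_T.+1 -> A}) path_weight x a *
     phi (x (widen_ord (leqnSn T.+1) ord_max)) (a ord_max) =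
  \sum_s \sum_y evolve_n P pis T d0 s * pis T s y * phi s y.
Proof.
(* The indicator of slot [T] kills all other terms of the sum over slots. *)
have := @sum_path_slots T.+1 (fun t s y => (t == T)%:R * phi s y).
rewrite [X in _ = X -> _]big_ord_recr /= [X in _ = X + _]big1 ?add0r; last first.
  move=> t _; rewrite big1 // => s _; rewrite big1 // => y _.
  by rewrite (ltn_eqF (ltn_ord t)) mul0r mulr0.
under [X in _ = X -> _]eq_bigr => s _ do under eq_bigr => y _ do rewrite eqxx mul1r.
move=> <-; apply: eq_bigr => x _; apply: eq_bigr => a _; congr (_ * _).
rewrite big_ord_recr /= eqxx mul1r big1 ?add0r // => t _.
by rewrite (ltn_eqF (ltn_ord t)) mul0r.
Qed.

End Paths.

(** * Bounded random variables *)

Section BoundedMeasurable.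
Context {R : realType} {d : measure_display} {T : measurableType d}.
Implicit Types (f g : T -> R).

(** The class is closed under all operations used below and consists of integrable functions. The
    sigma-algebra is a parameter, so the closure lemmas also serve for adaptedness. *)
Definition bounded_measurable f :=
  measurable_fun setT f /\ exists M, forall w, `|f w| <= M.

Lemma bounded_measurable_cst c : bounded_measurable (fun=> c).
Proof. by split; [exact: measurable_cst|exists `|c|]. Qed.

Lemma bounded_measurableD f g : bounded_measurable f -> bounded_measurable g ->
  bounded_measurable (fun w => f w + g w).
Proof.
move=> [mf [M hM]] [mg [N hN]]; split; first exact: measurable_funD.
by exists (M + N) => w; apply: le_trans (ler_normD _ _) _; exact: lerD.
Qed.

Lemma bounded_measurableN f : bounded_measurable f -> bounded_measurable (fun w => - f w).
Proof.
move=> [mf [M hM]]; split; first exact: measurable_funN.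
by exists M => w; rewrite normrN.
Qed.

Lemma bounded_measurableB f g : bounded_measurable f -> bounded_measurable g ->
  bounded_measurable (fun w => f w - g w).
Proof. by move=> hf hg; apply: bounded_measurableD => //; exact: bounded_measurableN. Qed.

Lemma bounded_measurableM f g : bounded_measurable f -> bounded_measurable g ->
  bounded_measurable (fun w => f w * g w).
Proof.
move=> [mf [M hM]] [mg [N hN]]; split; first exact: measurable_funM.
exists (M * N) => w; rewrite normrM; apply: ler_pM => //.
Qed.

Lemma bounded_measurableX f n : bounded_measurable f ->
  bounded_measurable (fun w => f w ^+ n).
Proof.
move=> hf; elim: n => [|n IH]; first exact: bounded_measurable_cst.
by under eq_fun do rewrite exprS; exact: bounded_measurableM.
Qed.

Lemma bounded_measurable_sum (I : Type) (r : seq I) (Q : pred I) (F : I -> T -> R) :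
  (forall i, bounded_measurable (F i)) ->
  bounded_measurable (fun w => \sum_(i <- r | Q i) F i w).
Proof.
move=> hF; elim: r => [|i r IH].
  by under eq_fun do rewrite big_nil; exact: bounded_measurable_cst.
under eq_fun do rewrite big_cons.
by case: (Q i) => //; apply: bounded_measurableD.
Qed.

Lemma bounded_measurable_prod (I : Type) (r : seq I) (Q : pred I) (F : I -> T -> R) :
  (forall i, bounded_measurable (F i)) ->
  bounded_measurable (fun w => \prod_(i <- r | Q i) F i w).
Proof.
move=> hF; elim: r => [|i r IH].
  by under eq_fun do rewrite big_nil; exact: bounded_measurable_cst.
under eq_fun do rewrite big_cons.
by case: (Q i) => //; apply: bounded_measurableM.
Qed.

Lemma bounded_measurable_max f g : bounded_measurable f -> bounded_measurable g ->
  bounded_measurable (fun w => Num.max (f w) (g w)).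
Proof.
move=> [mf [M hM]] [mg [N hN]]; split; first exact: measurable_maxr.
exists (M + N) => w; apply: le_trans (lerD (hM w) (hN w)).
by rewrite /Num.max; case: ifP => _; rewrite ?lerDl ?lerDr.
Qed.

Lemma bounded_measurable_expR f : bounded_measurable f ->
  bounded_measurable (fun w => expR (f w)).
Proof.
move=> [mf [M hM]]; split; first exact: measurableT_comp.
exists (expR M) => w; rewrite ger0_norm ?expR_ge0 // ler_expR.
exact: le_trans (ler_norm _) (hM w).
Qed.

Lemma bounded_measurable_sqrt f : bounded_measurable f ->
  bounded_measurable (fun w => Num.sqrt (f w)).
Proof.
move=> [mf [M hM]]; split.
  by apply: measurableT_comp mf; apply: continuous_measurable_fun; exact: sqrt_continuous.
exists (Num.sqrt M) => w; rewrite ger0_norm ?sqrtr_ge0 //.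
by rewrite ler_wsqrtr // (le_trans (ler_norm _)).
Qed.

Lemma measurable_inv_gt0 f : (forall w, 0 < f w) -> measurable_fun setT f ->
  measurable_fun setT (fun w => (f w)^-1).
Proof.
move=> f0 mf.
have -> : (fun w => (f w)^-1) = (fun w => f w `^ (-1)).
  by apply/funext => w; rewrite powR_inv1 // ltW.
exact: (measurableT_comp (measurable_powR (-1))).
Qed.

Lemma bounded_measurable_inv f c : 0 < c -> (forall w, c <= f w) ->
  bounded_measurable f -> bounded_measurable (fun w => (f w)^-1).
Proof.
move=> c0 hc [mf _]; have f0 w := lt_le_trans c0 (hc w).
split; first exact: measurable_inv_gt0.
by exists c^-1 => w; rewrite ger0_norm ?invr_ge0 ?(ltW (f0 w)) // lef_pV2 ?posrE.
Qed.

Lemma bounded_measurable_threshold f (c : R) : bounded_measurable f ->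
  bounded_measurable (fun w => (c <= f w)%R%:R).
Proof.
move=> [mf _]; split; last first.
  by exists 1 => w; case: (c <= f w)%R; rewrite ?normr1 ?normr0.
have -> : (fun w => (c <= f w)%R%:R : R) = \1_(f @^-1` `[c, +oo[).
  apply/funext => w; rewrite indicE; congr (nat_of_bool _)%:R.
  by apply/idP/idP; rewrite inE /= in_itv /= andbT.
by apply: measurable_indic; rewrite -[X in measurable X]setTI; apply: mf.
Qed.

End BoundedMeasurable.

(** Serves for the argmin, for which no formula is available: a function controlled by finitely many
    measurable coordinates is measurable, because rational balls in those coordinates exhaust its
    superlevel sets. *)
Lemma measurable_lipschitz (R : realType) (d : measure_display)
    (T : measurableType d) (I : finType) (y : I -> T -> R) (f : T -> R) (L : R) :
  (forall i, measurable_fun setT (y i)) ->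
  (forall w w', `|f w - f w'| <= L * \sum_i `|y i w - y i w'|) ->
  measurable_fun setT f.
Proof.
move=> my hf.
have [L1 L1_gt0 hf1] : exists2 L1, 0 < L1 &
    forall w w', `|f w - f w'| <= L1 * \sum_i `|y i w - y i w'|.
  exists (`|L| + 1) => [|w w']; first by rewrite ltr_wpDl.
  apply: le_trans (hf w w') _; apply: ler_wpM2r; first exact: sumr_ge0.
  by apply: le_trans (ler_norm _) _; rewrite lerDl.
pose near (p : {ffun I -> rat} * nat) : set T :=
  [set w | \sum_i `|y i w - ratr (p.1 i)| < p.2.+1%:R^-1].
have mnear p : measurable (near p).
  have mg : measurable_fun setT (fun w => \sum_i `|y i w - ratr (p.1 i)|).
    apply: measurable_sum => i; apply: measurableT_comp => //.
    by apply: measurable_funB => //; exact: measurable_cst.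
  have -> : near p = (fun w => \sum_i `|y i w - ratr (p.1 i)|) @^-1` `]-oo, p.2.+1%:R^-1[.
    by apply/seteqP; split => w; rewrite /near /= in_itv.
  by rewrite -[X in measurable X]setTI; apply: mg.
apply: (measurability _ (RGenOInfty.measurableE R)) => /=.
move=> _ [_ [c ->] <-]; rewrite setTI.
(* Only the balls whose preimage lies inside the superlevel set are kept; there are countably
   many. *)
have -> : f @^-1` `]c, +oo[ = \bigcup_p
    (if pselect (near p `<=` f @^-1` `]c, +oo[) then near p else set0).
  apply/seteqP; split => [w|w [p _]]; last by case: pselect => // h /h.
  rewrite /= in_itv /= andbT => cw.
  have [n hn] : exists n, n.+1%:R^-1 < (f w - c) / (2 * L1).
    have pos : 0 < (f w - c) / (2 * L1) by rewrite divr_gt0 ?subr_gt0 ?mulr_gt0.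
    have [n _ hn] := near_infty_natSinv_lt (PosNum pos).
    by exists n; apply: (hn n) => /=.
  (* The radius is shared among the coordinates; the successor of [#|I|] also covers an empty
     [I]. *)
  pose e : R := n.+1%:R^-1 / #|I|.+1%:R.
  have e0 : 0 < e by rewrite divr_gt0 ?invr_gt0.
  have hq i : exists q : rat, `|y i w - ratr q| < e.
    have /rat_in_itvoo[q] : y i w - e < y i w + e by lra.
    by rewrite in_itv /= => hq; exists q; rewrite distrC ltr_distl.
  have [q hqi] := choice hq.
  have wnear : near ([ffun i => q i], n) w.
    rewrite /near /=; apply: (@le_lt_trans _ _ (\sum_(i : I) e)).
      by apply: ler_sum => i _; rewrite ffunE ltW.
    rewrite sumr_const -[X in X < _]mulr_natl /e mulrCA gtr_pMr ?invr_gt0 //.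
    by rewrite ltr_pdivrMr ?ltr0n // mul1r ltr_nat.
  exists ([ffun i => q i], n) => //; case: pselect => // -[] w' wnear'.
  rewrite /= in_itv /= andbT.
  have := hf1 w w'; rewrite ler_norml => /andP[_ hd].
  have : \sum_i `|y i w - y i w'| <= 2 * n.+1%:R^-1.
    rewrite mulr_natl mulr2n; apply: le_trans (lerD (ltW wnear) (ltW wnear')) => /=.
    rewrite -big_split /=; apply: ler_sum => i _.
    by rewrite [X in _ <= _ + X]distrC; apply: le_trans (ler_normD _ _); rewrite subrKA.
  rewrite -(ler_pM2l L1_gt0) => h1.
  have : L1 * (2 * n.+1%:R^-1) < f w - c.
    move: hn; rewrite ltr_pdivlMr ?mulr_gt0 //.
    by have -> : L1 * (2 * n.+1%:R^-1) = n.+1%:R^-1 * (2 * L1) by ring.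
  by move=> /(le_lt_trans (le_trans hd h1)); rewrite ltrD2l ltrN2.
apply: countable_bigcupT_measurable => [|p]; first exact: countableP.
by case: pselect => _ /=; [exact: mnear|exact: measurable0].
Qed.

(** * Expectation of bounded variables *)

Section Expectation.
Context {R : realType} {d : measure_display} {T : measurableType d}.
Variable Pr : probability T R.
Implicit Types (f g : T -> R).

Definition Ex f : R := fine ('E_Pr[f])%E.

Lemma Ex_Rintegral f : Ex f = Rintegral Pr setT f.
Proof. by rewrite /Ex unlock. Qed.

Lemma bounded_measurable_integrable f : bounded_measurable f ->
  Pr.-integrable setT (EFin \o f).
Proof.
move=> [mf [M hM]]; have Pr_fin : (Pr setT < +oo)%E by rewrite probability_setT ltry.
apply: measurable_bounded_integrable => //.
exists M; split; first exact: num_real.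
by move=> x Mx w _ /=; apply: le_trans (hM w) (ltW Mx).
Qed.

Lemma Ex_cst c : Ex (fun=> c) = c.
Proof. by rewrite /Ex (expectation_cst Pr c). Qed.

Lemma ExD f g : bounded_measurable f -> bounded_measurable g ->
  Ex (fun w => f w + g w) = Ex f + Ex g.
Proof.
by move=> hf hg; rewrite !Ex_Rintegral RintegralD //;
  exact: bounded_measurable_integrable.
Qed.

Lemma ExB f g : bounded_measurable f -> bounded_measurable g ->
  Ex (fun w => f w - g w) = Ex f - Ex g.
Proof.
by move=> hf hg; rewrite !Ex_Rintegral RintegralB //;
  exact: bounded_measurable_integrable.
Qed.

Lemma ExZ c f : bounded_measurable f -> Ex (fun w => c * f w) = c * Ex f.
Proof.
by move=> hf; rewrite !Ex_Rintegral RintegralZl //;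
  exact: bounded_measurable_integrable.
Qed.

Lemma Ex_le f g : bounded_measurable f -> bounded_measurable g ->
  (forall w, f w <= g w) -> Ex f <= Ex g.
Proof.
by move=> hf hg fg; rewrite !Ex_Rintegral le_Rintegral //;
  exact: bounded_measurable_integrable.
Qed.

Lemma Ex_ge0 f : (forall w, 0 <= f w) -> 0 <= Ex f.
Proof. by move=> f0; rewrite Ex_Rintegral Rintegral_ge0. Qed.

Lemma Ex_sum (I : Type) (r : seq I) (F : I -> T -> R) :
  (forall i, bounded_measurable (F i)) ->
  Ex (fun w => \sum_(i <- r) F i w) = \sum_(i <- r) Ex (F i).
Proof.
move=> hF; elim: r => [|i r IH].
  by rewrite big_nil -[RHS](Ex_cst 0); congr Ex; apply/funext => w; rewrite big_nil.
rewrite big_cons -IH -ExD //; last exact: bounded_measurable_sum.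
by congr Ex; apply/funext => w; rewrite big_cons.
Qed.

Lemma Ex_distribution d' (E : measurableType d') (X : T -> E) (X' : T -> E) (h : E -> R) :
  measurable_fun setT X -> measurable_fun setT X' -> bounded_measurable h ->
  (forall B, measurable B -> Pr (X @^-1` B) = Pr (X' @^-1` B)) ->
  Ex (h \o X) = Ex (h \o X').
Proof.
move=> mX mX' hh hXX'.
have key (Y : T -> E) (mY : measurable_fun setT Y) :
    (\int[Pr]_w (h (Y w))%:E = \int[pushforward Pr Y]_z (h z)%:E)%E.
  rewrite integral_pushforward //; first by apply/measurable_EFinP; exact: hh.1.
  apply: bounded_measurable_integrable; split; first exact: measurableT_comp hh.1 mY.
  by have [M hM] := hh.2; exists M => w; exact: hM.
rewrite !Ex_Rintegral /Rintegral /= !key //; congr fine.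
apply: eq_measure_integral => //= B mB _; exact: hXX'.
Qed.

(** Independence makes the law of the pair a product measure, and Fubini factors the integral. *)
Lemma ExM_indep f g : bounded_measurable f -> bounded_measurable g ->
  (forall A B, measurable A -> measurable B ->
     Pr (f @^-1` A `&` g @^-1` B) = (Pr (f @^-1` A) * Pr (g @^-1` B))%E) ->
  Ex (fun w => f w * g w) = Ex f * Ex g.
Proof.
move=> hf hg hind.
pose X : {RV Pr >-> R} := HB.pack f (isMeasurableFun.Build _ _ _ _ f hf.1).
pose Y : {RV Pr >-> R} := HB.pack g (isMeasurableFun.Build _ _ _ _ g hg.1).
have mfg : measurable_fun setT (fun w => (f w, g w)).
  by apply: measurable_fun_pair; [exact: hf.1|exact: hg.1].
pose Z : {RV Pr >-> (R * R)%type} :=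
  HB.pack (fun w => (f w, g w)) (isMeasurableFun.Build _ _ _ _ (fun w => (f w, g w)) mfg).
pose h : R * R -> \bar R := fun z => (z.1 * z.2)%:E.
have mh : measurable_fun setT h.
  by apply/measurable_EFinP; apply: measurable_funM;
    [exact: measurable_fst|exact: measurable_snd].
have hint : Pr.-integrable setT (h \o Z).
  by apply: bounded_measurable_integrable; exact: bounded_measurableM.
have hprod B : measurable B -> (distribution Pr X \x distribution Pr Y)%E B = distribution Pr Z B.
  by apply: product_measure_unique => A C mA mC; exact: hind.
have hfi := bounded_measurable_integrable hf.
have hgi := bounded_measurable_integrable hg.
have hX : (\int[distribution Pr X]_x x%:E = (Ex f)%:E)%E.
  rewrite (@integral_distribution _ _ _ _ _ Pr X (fun x => x%:E)) //; last exact/measurable_EFinP.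
  by rewrite Ex_Rintegral /Rintegral fineK // integrable_fin_num.
have hY : (\int[distribution Pr Y]_x x%:E = (Ex g)%:E)%E.
  rewrite (@integral_distribution _ _ _ _ _ Pr Y (fun x => x%:E)) //; last exact/measurable_EFinP.
  by rewrite Ex_Rintegral /Rintegral fineK // integrable_fin_num.
have hYi : (distribution Pr Y).-integrable setT (fun x : R => x%:E).
  by apply: integrable_pushforward => //; exact/measurable_EFinP.
have hXi : (distribution Pr X).-integrable setT (fun x : R => x%:E).
  by apply: integrable_pushforward => //; exact/measurable_EFinP.
have hprodi : (distribution Pr X \x distribution Pr Y)%E.-integrable setT h.
  have : (distribution Pr Z).-integrable setT h by exact: integrable_pushforward.
  move=> /integrableP[_ hfin]; apply/integrableP; split=> //.
  by rewrite (eq_measure_integral _ (fun B mB _ => hprod B mB)).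
rewrite [LHS]Ex_Rintegral /Rintegral.
have -> : (\int[Pr]_w (f w * g w)%:E = \int[distribution Pr Z]_z h z)%E.
  by rewrite (@integral_distribution _ _ _ _ _ Pr Z h).
rewrite -(eq_measure_integral _ (fun B mB _ => hprod B mB)).
rewrite -integral12_prod_meas1 //=.
transitivity (fine (\int[distribution Pr X]_x (x%:E * (Ex g)%:E))%E).
  congr fine; apply: eq_integral => x _; rewrite /fubini_F /h /=.
  by under eq_integral => y _ do rewrite EFinM; rewrite integralZl // hY.
by rewrite integralZr //= hX.
Qed.

End Expectation.

(** * Independence of the current slot from the past *)

Section History.
Context {R : realType} {dO dW dM : measure_display}.
Context {Omega : measurableType dO} {W : measurableType dW} {M : measurableType dM}.
Variable Pr : probability Omega R.
Variables (omega : nat -> Omega -> W) (mu : nat -> Omega -> M).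
Hypotheses (momega : measurable_process omega) (mmu : measurable_process mu).
Hypotheses (omega_iid : iid Pr omega) (omega_mu : independent_processes Pr omega mu).

(** Indexed by a list, the form in which [iid] states independence. *)
Let omega_cylinder n (C : nat -> set W) : set Omega :=
  \bigcap_(t in [set` iota 0 n]) (omega t @^-1` C t).

Let omega_cylinderP n C w :
  omega_cylinder n C w <-> forall t, (t < n)%N -> C t (omega t w).
Proof.
split=> h t; first by move=> tn; apply: h; rewrite /mkset mem_iota.
by rewrite /mkset mem_iota => /andP[_ tn]; exact: h.
Qed.

(* A pi-system generating the information in omega_0, ..., omega_(n-1) and in
   the whole process mu. *)
Definition history n : set (set Omega) :=
  [set B | exists C D, [/\ forall t, measurable (C t), process_sigma mu D &
                           B = omega_cylinder n C `&` D]].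

Lemma process_sigma_preimage d (E : measurableType d) (X : nat -> Omega -> E) t B :
  measurable B -> process_sigma X (X t @^-1` B).
Proof.
move=> mB; apply: sub_sigma_algebra; exists t => //.
by exists B => //; rewrite setTI.
Qed.

Lemma process_sigma_measurable d (E : measurableType d) (X : nat -> Omega -> E) :
  measurable_process X -> process_sigma X `<=` measurable.
Proof.
move=> mX; apply: smallest_sub; first exact: sigma_algebra_measurable.
by move=> _ [t _ [B mB <-]]; exact: mX.
Qed.

Lemma omega_cylinder_sigma n C : (forall t, measurable (C t)) ->
  process_sigma omega (omega_cylinder n C).
Proof.
move=> mC; rewrite /omega_cylinder.
have -> : [set` iota 0 n] = `I_n.
  by apply/seteqP; split => t /=; rewrite mem_iota add0n.
rewrite bigcap_mkord.
pose G : set (set Omega) := \bigcup_t preimage_set_system setT (omega t) measurable.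
apply: (@bigsetI_measurable _ (g_sigma_algebraType G)) => t _.
exact: process_sigma_preimage.
Qed.

Lemma omega_cylinderT n : omega_cylinder n (fun=> setT) = setT.
Proof. by apply/seteqP; split. Qed.

Lemma omega_cylinder1 n s B : (s < n)%N ->
  omega_cylinder n (fun t => if t == s then B else setT) = omega s @^-1` B.
Proof.
move=> sn; apply/seteqP; split => w.
  by move=> /omega_cylinderP/(_ s sn); rewrite eqxx.
by move=> wB; apply/omega_cylinderP => t _; case: eqP => [->|].
Qed.

Let sigma_mu_setT : process_sigma mu setT.
Proof.
pose G : set (set Omega) := \bigcup_t preimage_set_system setT (mu t) measurable.
exact: (@measurableT _ (g_sigma_algebraType G)).
Qed.

Lemma history_measurable n : history n `<=` measurable.
Proof.
move=> _ [C [D [mC mD ->]]]; apply: measurableI.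
  exact: (process_sigma_measurable momega (omega_cylinder_sigma n mC)).
exact: (process_sigma_measurable mmu mD).
Qed.

Lemma history_omega n s B : (s < n)%N -> measurable B ->
  <<s history n >> (omega s @^-1` B).
Proof.
move=> sn mB; apply: sub_sigma_algebra.
exists (fun t => if t == s then B else setT), setT; split => //.
- by move=> t; case: eqP.
- by rewrite setIT omega_cylinder1.
Qed.

Lemma history_mu n s B : measurable B -> <<s history n >> (mu s @^-1` B).
Proof.
move=> mB; apply: sub_sigma_algebra; exists (fun=> setT), (mu s @^-1` B); split => //.
- exact: process_sigma_preimage.
- by rewrite omega_cylinderT setTI.
Qed.

Lemma history_le n n' : (n <= n')%N -> history n `<=` history n'.
Proof.
move=> nn' _ [C [D [mC mD ->]]].
exists (fun t => if (t < n)%N then C t else setT), D; split => //.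
  by move=> t; case: ifP.
congr (_ `&` _); apply/seteqP; split => w /omega_cylinderP hw; apply/omega_cylinderP => t tn.
  by case: ifP => // tn'; exact: hw.
by have := hw t (leq_trans tn nn'); rewrite tn.
Qed.

(** With the event on [omega n] fixed, both sides are finite measures in [B]; they agree on the
    pi-system [history n], hence on the sigma-algebra it generates. *)
Lemma history_indep n B C : <<s history n >> B -> measurable C ->
  Pr (B `&` omega n @^-1` C) = (Pr B * Pr (omega n @^-1` C))%E.
Proof.
move=> hB mC.
have mE : measurable (omega n @^-1` C) by rewrite -[X in measurable X]setTI; apply: momega.
have e0 : 0 <= fine (Pr (omega n @^-1` C)) by rewrite fine_ge0.
have efin : (fine (Pr (omega n @^-1` C)))%:E = Pr (omega n @^-1` C).
  by rewrite fineK // fin_num_measure.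
have mscE A : mscale (NngNum e0) Pr A = (Pr (omega n @^-1` C) * Pr A)%E.
  by rewrite -[X in _ = (X * _)%E]efin.
suff H : mrestr Pr mE B = mscale (NngNum e0) Pr B.
  exact: (etrans H (etrans (mscE B) (muleC _ _))).
apply: (@g_sigma_algebra_measure_unique _ _ _ (history n) _ (fun=> setT)) => //.
- exact: history_measurable.
- move=> _; exists (fun=> setT), setT; split => //.
  by rewrite omega_cylinderT setTI.
- by rewrite bigcup_const //; exists 0%N.
- move=> _ _ [C1 [D1 [mC1 mD1 ->]]] [C2 [D2 [mC2 mD2 ->]]].
  exists (fun t => C1 t `&` C2 t), (D1 `&` D2); split.
  + by move=> t; exact: measurableI.
  + pose G : set (set Omega) := \bigcup_t preimage_set_system setT (mu t) measurable.
    exact: (@measurableI _ (g_sigma_algebraType G)).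
  + by rewrite setIACA -bigcapI.
- move=> _ [C1 [D1 [mC1 mD1 ->]]]; apply: (etrans _ (esym (mscE _))); rewrite /= /mrestr.
  (* Adding the event on slot [n] extends the cylinder by one coordinate. Independence from [mu]
     splits off [D1], and the product rule of [iid] then splits off slot [n]. *)
  pose C2 t := if t == n then C else C1 t.
  have mC2 t : measurable (C2 t) by rewrite /C2; case: eqP.
  have cyl1 : omega_cylinder n C1 = omega_cylinder n C2.
    apply/seteqP; split => w /omega_cylinderP hw; apply/omega_cylinderP => t tn;
    by have := hw t tn; rewrite /C2 (ltn_eqF tn).
  have cylS : omega_cylinder n C1 `&` omega n @^-1` C = omega_cylinder n.+1 C2.
    rewrite cyl1; apply/seteqP; split => w.
      move=> [/omega_cylinderP h1 h2]; apply/omega_cylinderP => t.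
      by rewrite ltnS leq_eqVlt => /orP[/eqP ->|]; [rewrite /C2 eqxx|exact: h1].
    move=> /omega_cylinderP h; split; last by have := h n (ltnSn n); rewrite /C2 eqxx.
    by apply/omega_cylinderP => t tn; apply: h; exact: ltnW.
  rewrite setIAC cylS omega_mu //; last exact: omega_cylinder_sigma.
  rewrite omega_mu //; last exact: omega_cylinder_sigma.
  rewrite muleA cyl1; congr (_ * _)%E.
  rewrite /omega_cylinder !omega_iid.2 ?iota_uniq //.
  rewrite -addn1 iotaD big_cat /= big_seq1 add0n /C2 eqxx muleC; congr (_ * _)%E.
- move=> _; have : (Pr (setT `&` omega n @^-1` C) < +oo)%E.
    by rewrite setTI ltey_eq fin_num_measure.
  exact.
Qed.

(** All of [mu], its future included, may count as known: [mu] is independent of [omega], which is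
    the only process averaged over. *)
Definition adapted n (f : Omega -> R) :=
  @bounded_measurable R _ (g_sigma_algebraType (history n)) f.

Lemma adapted_bounded_measurable n f : adapted n f -> bounded_measurable (f : Omega -> R).
Proof.
move=> [mf bf]; split=> // _ B mB; rewrite setTI.
have := mf measurableT B mB; rewrite setTI.
move: (f @^-1` B); apply: smallest_sub; first exact: sigma_algebra_measurable.
exact: history_measurable.
Qed.

Lemma adapted_le n n' f : (n <= n')%N -> adapted n f -> adapted n' f.
Proof.
move=> nn' [mf bf]; split=> // _ B mB; rewrite setTI.
have := mf measurableT B mB; rewrite setTI.
by apply: sub_smallest2r; [exact: smallest_sigma_algebra|exact: history_le].
Qed.

Lemma adapted_omega n s (h : W -> R) : (s < n)%N -> bounded_measurable h ->
  adapted n (fun w => h (omega s w)).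
Proof.
move=> sn [mh [c hc]]; split; last by exists c => w; exact: hc.
move=> _ B mB; rewrite setTI.
apply: (@history_omega n s (h @^-1` B)) => //.
by rewrite -[X in measurable X]setTI; exact: mh.
Qed.

Lemma adapted_mu n s (h : M -> R) : bounded_measurable h ->
  adapted n (fun w => h (mu s w)).
Proof.
move=> [mh [c hc]]; split; last by exists c => w; exact: hc.
move=> _ B mB; rewrite setTI.
apply: (@history_mu n s (h @^-1` B)) => //.
by rewrite -[X in measurable X]setTI; exact: mh.
Qed.

(** Takes the place of conditional expectation: [omega n] is independent of the history and has the
    law of [omega 0]. *)
Lemma Ex_adapted_mul n (U : Omega -> R) (h : W -> R) :
  adapted n U -> bounded_measurable h ->
  Ex Pr (fun w => U w * h (omega n w)) = Ex Pr U * Ex Pr (h \o omega 0%N).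
Proof.
move=> hU hh.
have -> : Ex Pr (h \o omega 0%N) = Ex Pr (h \o omega n).
  apply: Ex_distribution => // B mB; exact/esym/(omega_iid.1 n).
have hhn : bounded_measurable (h \o omega n).
  exact: adapted_bounded_measurable (adapted_omega (ltnSn n) hh).
apply: (ExM_indep (adapted_bounded_measurable hU) hhn) => A B mA mB.
have := hU.1 measurableT A mA; rewrite setTI => hA.
rewrite -[(h \o omega n) @^-1` B]/(omega n @^-1` (h @^-1` B)).
apply: history_indep => //.
by rewrite -[X in measurable X]setTI; exact: hh.1.
Qed.

End History.

(** * The proximal update *)

Section Argmin.
Context {R : realType} {S A : finType}.
Implicit Types (P : A -> S -> S -> R) (h t th : A -> S -> R).

Definition l1dist th t : R := \sum_a \sum_s `|th a s - t a s|.

Lemma sqdist_ge0 th t : 0 <= sqdist th t.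
Proof. by do 2 (apply: sumr_ge0 => ? _); exact: sqr_ge0. Qed.

Lemma innerB h th t : inner h (fun a s => th a s - t a s) = inner h th - inner h t.
Proof.
rewrite /inner -sumrB; apply: eq_bigr => a _; rewrite -sumrB.
by apply: eq_bigr => s _; rewrite mulrBr.
Qed.

Lemma polyhedron_convex P t th (e : R) : in_polyhedron P t -> in_polyhedron P th ->
  0 <= e -> e <= 1 -> in_polyhedron P (fun a s => th a s + e * (t a s - th a s)).
Proof.
move=> [t0 t1 tP] [h0 h1 hP] e0 e1.
have eq_mix a s : th a s + e * (t a s - th a s) = (1 - e) * th a s + e * t a s by ring.
split=> [a s||s'].
- by rewrite eq_mix addr_ge0 // mulr_ge0 // subr_ge0.
- under eq_bigr => a _ do
    (under eq_bigr => s _ do rewrite eq_mix; rewrite big_split /= -!mulr_sumr).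
  by rewrite big_split /= -!mulr_sumr h1 t1; ring.
- under [RHS]eq_bigr => a _ do rewrite eq_mix.
  rewrite big_split /= -!mulr_sumr -hP -tP !mulr_sumr -big_split /=.
  apply: eq_bigr => s _; rewrite !mulr_sumr -big_split /=.
  by apply: eq_bigr => a _; rewrite eq_mix; ring.
Qed.

Lemma inner_norm_le P h t (Psi : R) : in_polyhedron P t ->
  (forall a s, `|h a s| <= Psi) -> `|inner h t| <= Psi.
Proof.
move=> [t0 t1 _] hh.
rewrite -[leRHS]mulr1 -t1 mulr_sumr; apply: le_trans (ler_norm_sum _ _ _) _.
apply: ler_sum => a _; rewrite mulr_sumr; apply: le_trans (ler_norm_sum _ _ _) _.
by apply: ler_sum => s _; rewrite normrM (ger0_norm (t0 a s)) ler_wpM2r.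
Qed.

Lemma inner_l1dist_le h t th (Psi : R) : (forall a s, `|h a s| <= Psi) ->
  `|inner h t - inner h th| <= Psi * l1dist t th.
Proof.
move=> hh; rewrite -innerB /l1dist mulr_sumr; apply: le_trans (ler_norm_sum _ _ _) _.
apply: ler_sum => a _; rewrite mulr_sumr; apply: le_trans (ler_norm_sum _ _ _) _.
by apply: ler_sum => s _; rewrite normrM ler_wpM2r.
Qed.

Lemma sqdist_le2 P t th : in_polyhedron P t -> in_polyhedron P th -> sqdist t th <= 2.
Proof.
move=> [t0 t1 _] [h0 h1 _].
have le1 (v : A -> S -> R) a s : (forall a s, 0 <= v a s) -> \sum_a \sum_s v a s = 1 -> v a s <= 1.
  move=> v0 v1; rewrite -v1 (bigD1 a) //= (bigD1 s) //= -addrA lerDl addr_ge0 //.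
    exact: sumr_ge0.
  by do 2 (apply: sumr_ge0 => ? _).
have -> : 2 = \sum_a \sum_s t a s + \sum_a \sum_s th a s by rewrite t1 h1.
rewrite -big_split; apply: ler_sum => a _; rewrite -big_split; apply: ler_sum => s _ /=.
have a1 := t0 a s; have a2 := h0 a s; have a3 := le1 t a s t0 t1; have a4 := le1 th a s h0 h1.
have -> : (t a s - th a s) ^+ 2 = t a s * t a s + th a s * th a s - 2 * (t a s * th a s) by ring.
have b1 : t a s * t a s <= t a s by rewrite ler_piMr.
have b2 : th a s * th a s <= th a s by rewrite ler_piMr.
have b3 : 0 <= t a s * th a s by rewrite mulr_ge0.
lra.
Qed.

(** First-order optimality: [th] is compared with [th + e (t - th)], which is feasible by convexity,
    for small positive e. *)
Lemma argmin_variational P h th0 th (al : R) :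
  is_argmin (in_polyhedron P) (fun v => inner h v + al * sqdist v th0) th -> 0 < al ->
  forall t, in_polyhedron P t ->
  0 <= inner h t - inner h th +
       2 * al * inner (fun a s => th a s - th0 a s) (fun a s => t a s - th a s).
Proof.
move=> [hth hmin] al0 t ht; set c := inner (fun a s => th a s - th0 a s) _.
set L := _ + _.
have key e : 0 < e -> e <= 1 -> 0 <= L + e * (al * sqdist t th).
  move=> e0 e1; have := hmin _ (polyhedron_convex ht hth (ltW e0) e1).
  have -> : inner h (fun a s => th a s + e * (t a s - th a s)) =
      inner h th + e * (inner h t - inner h th).
    rewrite -innerB /inner mulr_sumr -big_split; apply: eq_bigr => a _.
    by rewrite mulr_sumr -big_split; apply: eq_bigr => s _ /=; ring.
  have -> : sqdist (fun a s => th a s + e * (t a s - th a s)) th0 =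
      sqdist th th0 + (2 * e) * c + e ^+ 2 * sqdist t th.
    rewrite /sqdist /c /inner !mulr_sumr -!big_split; apply: eq_bigr => a _ /=.
    by rewrite !mulr_sumr -!big_split; apply: eq_bigr => s _ /=; ring.
  rewrite -subr_ge0 => H.
  rewrite -(pmulr_rge0 _ e0); apply: le_trans H _; rewrite /L le_eqVlt.
  by apply/orP; left; apply/eqP; ring.
case: (lerP 0 L) => // L0.
have d0 := sqdist_ge0 t th; pose D := al * sqdist t th.
have D0 : 0 <= D by rewrite mulr_ge0 // ltW.
(* With this choice e D is at most -L/2, which contradicts 0 <= L + e D when L is negative. *)
pose e := Num.min 1 (- L / (2 * (D + 1))).
have e0 : 0 < e.
  by rewrite lt_min ltr01 /= divr_gt0 ?oppr_gt0 // mulr_gt0 // ltr_wpDl.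
have e1 : e <= 1 by rewrite ge_min lexx.
have := key e e0 e1; rewrite -/D => H.
have e2 : e * (2 * (D + 1)) <= - L.
  rewrite -ler_pdivlMr ?mulr_gt0 ?ltr_wpDl //.
  by rewrite ge_min lexx orbT.
have : 0 <= e * D by rewrite mulr_ge0 // ltW.
nra.
Qed.

(** Expanding |t - th0|^2 around [th] turns the cross term of the variational inequality into
    squared distances; the leftover al |th - th0|^2 is nonnegative and is dropped. *)
Lemma argmin_three_point P h th0 th (al : R) :
  is_argmin (in_polyhedron P) (fun v => inner h v + al * sqdist v th0) th -> 0 < al ->
  forall t, in_polyhedron P t ->
  inner h th + al * sqdist t th <= inner h t + al * sqdist t th0.
Proof.
move=> hmin al0 t ht; have := argmin_variational hmin al0 ht.
set c := inner (fun a s => th a s - th0 a s) _ => H.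
have -> : sqdist t th0 = sqdist th th0 + 2 * c + sqdist t th.
  rewrite /sqdist /c /inner !mulr_sumr -!big_split; apply: eq_bigr => a _ /=.
  by rewrite !mulr_sumr -!big_split; apply: eq_bigr => s _ /=; ring.
have : 0 <= al * sqdist th th0 by rewrite mulr_ge0 ?sqdist_ge0 // ltW.
lra.
Qed.

(** With [th0] as competitor, 2 al |th - th0|_2^2 is at most H |th - th0|_1; comparing the two norms
    in dimension |A||S| gives the bound. *)
Lemma argmin_move P h th0 th (al H : R) :
  is_argmin (in_polyhedron P) (fun v => inner h v + al * sqdist v th0) th -> 0 < al ->
  0 < H -> (forall a s, `|h a s| <= H) -> in_polyhedron P th0 ->
  l1dist th th0 <= (#|A| * #|S|)%:R * (H / (2 * al)).
Proof.
move=> hmin al0 H0 hH hth0; have := argmin_variational hmin al0 hth0.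
have -> : inner (fun a s => th a s - th0 a s) (fun a s => th0 a s - th a s) =
   - sqdist th th0.
  rewrite /inner /sqdist -sumrN; apply: eq_bigr => a _; rewrite -sumrN.
  by apply: eq_bigr => s _; ring.
have := inner_l1dist_le th0 th hH => /(le_trans (ler_norm _)).
have -> : l1dist th0 th = l1dist th th0.
  by apply: eq_bigr => a _; apply: eq_bigr => s _; rewrite distrC.
move=> h1 h2.
pose b := H / (2 * al); have b0 : 0 < b by rewrite divr_gt0 // mulr_gt0.
have Hb : H = 2 * al * b by rewrite /b mulrC divfK // gt_eqF // mulr_gt0.
have h3 : sqdist th th0 <= b * l1dist th th0.
  rewrite -(ler_pM2l (_ : 0 < 2 * al)) ?mulr_gt0 // mulrA -Hb.
  by rewrite -subr_ge0; apply: le_trans h2 _; lra.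
(* (u - b)^2 >= 0 in the form u^2 - b u >= b (u - b), summed over coordinates *)
have h4 : b * (l1dist th th0 - (#|A| * #|S|)%:R * b) <= sqdist th th0 - b * l1dist th th0.
  have -> : (#|A| * #|S|)%:R * b = \sum_(a : A) \sum_(s : S) b.
    by rewrite !sumr_const -mulrnA mulr_natl mulnC.
  rewrite /l1dist /sqdist !mulr_sumr -!sumrB mulr_sumr; apply: ler_sum => a _.
  rewrite !mulr_sumr -!sumrB mulr_sumr; apply: ler_sum => s _.
  rewrite -[(th a s - th0 a s) ^+ 2]real_normK ?num_real //.
  have := sqr_ge0 (`|th a s - th0 a s| - b); nra.
rewrite -subr_le0 -(pmulr_rle0 _ b0).
by apply: le_trans h4 _; rewrite subr_le0.
Qed.

(** The update is the Euclidean projection of th0 - h / (2 al), and projections are nonexpansive: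
    the two variational inequalities are added. The one-coordinate l1 form is the one
    [measurable_lipschitz] takes. *)
Lemma argmin_lipschitz P h h' th0 th0' th th' (al : R) a0 s0 :
  is_argmin (in_polyhedron P) (fun v => inner h v + al * sqdist v th0) th ->
  is_argmin (in_polyhedron P) (fun v => inner h' v + al * sqdist v th0') th' ->
  0 < al ->
  `|th a0 s0 - th' a0 s0| <=
  \sum_a \sum_s `|(th0 a s - h a s / (2 * al)) - (th0' a s - h' a s / (2 * al))|.
Proof.
move=> hmin hmin' al0.
have v1 := argmin_variational hmin al0 hmin'.1.
have v2 := argmin_variational hmin' al0 hmin.1.
set D := \sum_a _.
pose dy a s := (th0 a s - h a s / (2 * al)) - (th0' a s - h' a s / (2 * al)).
have al2 : 0 < 2 * al by rewrite mulr_gt0.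
pose N := Num.sqrt (sqdist th th').
have N0 : 0 <= N by exact: sqrtr_ge0.
have NN : N ^+ 2 = sqdist th th' by rewrite sqr_sqrtr // sqdist_ge0.
have leN a s : `|th a s - th' a s| <= N.
  rewrite -sqrtr_sqr ler_wsqrtr // /sqdist (bigD1 a) //= (bigD1 s) //=.
  rewrite -addrA lerDl addr_ge0 //; first by apply: sumr_ge0 => ? _; exact: sqr_ge0.
  by do 2 (apply: sumr_ge0 => ? _); exact: sqr_ge0.
have le1 : sqdist th th' <= inner dy (fun a s => th a s - th' a s).
  rewrite -(ler_pM2l al2) -subr_ge0; apply: le_trans (addr_ge0 v1 v2) _.
  rewrite le_eqVlt; apply/orP; left; apply/eqP.
  rewrite -!innerB /inner /sqdist !mulr_sumr -!big_split -sumrB; apply: eq_bigr => a _ /=.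
  rewrite !mulr_sumr -!big_split -sumrB; apply: eq_bigr => s _ /=.
  by rewrite /dy; field; rewrite gt_eqF.
have le2 : inner dy (fun a s => th a s - th' a s) <= D * N.
  rewrite /D mulr_suml; apply: ler_sum => a _; rewrite mulr_suml; apply: ler_sum => s _.
  by apply: le_trans (ler_norm _) _; rewrite normrM ler_wpM2l.
apply: le_trans (leN a0 s0) _.
move: N0; rewrite le_eqVlt => /orP[/eqP <-|N0].
  by do 2 (apply: sumr_ge0 => ? _).
by rewrite -(ler_pM2r N0) -expr2 NN; exact: le_trans le2.
Qed.

End Argmin.

(** * One slot of the algorithm on a fixed sample path *)

Section Step.
Context {R : realType} {K m : nat} {S A : 'I_K -> finType}.
Variable P : forall k, A k -> S k -> S k -> R.
Variables (f : forall k, A k -> S k -> R) (g : 'I_m -> forall k, A k -> S k -> R).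
Variables (V al Psi : R) (q q' : 'I_m -> R).
Variables (th th' : forall k, A k -> S k -> R).
Hypotheses (V_gt0 : 0 < V) (al_gt0 : 0 < al) (Psi_gt0 : 0 < Psi).
Hypotheses (fPsi : forall k a s, `|f (k := k) a s| <= Psi).
Hypotheses (gPsi : forall i k a s, `|g i (k := k) a s| <= Psi).
Hypothesis (q_ge0 : forall i, 0 <= q i).
Hypothesis (th_poly : forall k, in_polyhedron (@P k) (@th k)).
Hypothesis th'_min : forall k, is_argmin (in_polyhedron (@P k))
  (fun v => inner (fun a s => V * f a s + \sum_(i < m) q i * g i a s) v
            + al * sqdist v (@th k)) (@th' k).
Hypothesis q'E : forall i, q' i = Num.max (q i + \sum_k inner (@g i k) (@th' k)) 0.

Lemma weighted_inner k v :
  inner (fun a s => V * f a s + \sum_(i < m) q i * g i a s) v =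
  V * inner (@f k) v + \sum_i q i * inner (@g i k) v.
Proof.
rewrite /inner.
under [X in _ = _ + X]eq_bigr => i _ do rewrite mulr_sumr.
rewrite [X in _ = _ + X]exchange_big mulr_sumr -big_split; apply: eq_bigr => a _ /=.
under [X in _ = _ + X]eq_bigr => i _ do rewrite mulr_sumr.
rewrite [X in _ = _ + X]exchange_big mulr_sumr -big_split; apply: eq_bigr => s _ /=.
rewrite mulrDl mulrA; congr (_ + _); rewrite mulr_suml; apply: eq_bigr => i _.
by rewrite mulrA.
Qed.

Lemma sum_inner_norm_le (h : forall k, A k -> S k -> R) (t : forall k, A k -> S k -> R) :
  (forall k, in_polyhedron (@P k) (@t k)) ->
  (forall k a s, `|h k a s| <= Psi) ->
  `|\sum_k inner (@h k) (@t k)| <= K%:R * Psi.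
Proof.
move=> ht hh; apply: le_trans (ler_norm_sum _ _ _) _.
rewrite -[K in leRHS]card_ord mulr_natl -sumr_const; apply: ler_sum => k _.
exact: inner_norm_le (ht k) (hh k).
Qed.

(** Squaring the queue update produces the products of [q i] with the constraint values at [th'].
    These are also the queue part of the minimized objective, so they cancel and only the values at
    the comparator remain. *)
Lemma drift_step (t : forall k, A k -> S k -> R) :
  (forall k, in_polyhedron (@P k) (@t k)) ->
  2^-1 * \sum_i q' i ^+ 2 + al * \sum_k sqdist (@t k) (@th' k) <=
  2^-1 * \sum_i q i ^+ 2 + al * \sum_k sqdist (@t k) (@th k) +
  V * (\sum_k inner (@f k) (@t k) - \sum_k inner (@f k) (@th' k)) +
  \sum_i q i * (\sum_k inner (@g i k) (@t k)) +
  2^-1 * (m%:R * (K%:R * Psi) ^+ 2).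
Proof.
move=> ht.
have th'_poly k : in_polyhedron (@P k) (@th' k) := (th'_min k).1.
have h1 k : V * inner (@f k) (@th' k) + \sum_i q i * inner (@g i k) (@th' k) +
    al * sqdist (@t k) (@th' k) <=
    V * inner (@f k) (@t k) + \sum_i q i * inner (@g i k) (@t k) +
    al * sqdist (@t k) (@th k).
  by rewrite -!weighted_inner; exact: argmin_three_point (th'_min k) al_gt0 _ (ht k).
have h2 : \sum_k (V * inner (@f k) (@th' k) + \sum_i q i * inner (@g i k) (@th' k) +
    al * sqdist (@t k) (@th' k)) <= \sum_k (V * inner (@f k) (@t k) +
    \sum_i q i * inner (@g i k) (@t k) + al * sqdist (@t k) (@th k)).
  by apply: ler_sum => k _.
move: h2; rewrite !big_split /= -!mulr_sumr.
rewrite [X in _ + X + _ <= _]exchange_big [X in _ <= _ + X + _]exchange_big /=.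
under [X in _ + X + _ <= _]eq_bigr => i _ do rewrite -mulr_sumr.
under [X in _ <= _ + X + _]eq_bigr => i _ do rewrite -mulr_sumr.
have h3 : \sum_i q' i ^+ 2 <= \sum_i q i ^+ 2 +
    2 * \sum_i q i * (\sum_k inner (@g i k) (@th' k)) + m%:R * (K%:R * Psi) ^+ 2.
  rewrite -[X in X%:R * _ ^+ 2]card_ord [X in _ <= _ + X]mulr_natl -sumr_const.
  rewrite mulr_sumr -!big_split; apply: ler_sum => i _ /=.
  set x := \sum_k _.
  have hx : `|x| <= K%:R * Psi by exact: sum_inner_norm_le.
  have hx2 : x ^+ 2 <= (K%:R * Psi) ^+ 2.
    by rewrite -[x ^+ 2]real_normK ?num_real // lerXn2r // nnegrE mulr_ge0 // ltW.
  (* Truncation at 0 does not increase the square. *)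
  have hq : q' i ^+ 2 <= (q i + x) ^+ 2.
    rewrite q'E -/x /Num.max; case: ifP => _ //.
    by rewrite expr0n /= sqr_ge0.
  by apply: le_trans hq _; lra.
lra.
Qed.

Lemma movement_step k :
  l1dist (@th' k) (@th k) <= (#|A k| * #|S k|)%:R * (Psi * (V + \sum_i q i) / (2 * al)).
Proof.
apply: argmin_move (th'_min k) _ _ _ (th_poly k) => //.
  by rewrite mulr_gt0 // ltr_pwDl // sumr_ge0.
move=> a s; rewrite mulrDr; apply: le_trans (ler_normD _ _) _; apply: lerD.
  by rewrite normrM gtr0_norm // mulrC ler_wpM2r // ltW.
apply: le_trans (ler_norm_sum _ _ _) _; rewrite mulr_sumr; apply: ler_sum => i _.
by rewrite normrM ger0_norm // mulrC ler_wpM2r.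
Qed.

End Step.

(** * Distance to stationarity *)

Section Gaps.
Context {R : realType} {K : nat} {S A : 'I_K -> finType}.
Variable P : forall k, A k -> S k -> S k -> R.
Hypothesis hP : forall k, is_transition (@P k).
Variables (d0 : joint S -> R) (r : nat) (Psi : R).
Hypotheses (d0_dist : is_dist d0) (Psi_ge0 : 0 <= Psi).

Let gam := mixing_coef (joint_transition P) r.
Hypothesis gam_lt1 : gam < 1.

Lemma coord_marginal_dist (v : joint S -> R) k : is_dist v -> is_dist (@coord_marginal R K S v k).
Proof.
move=> [v0 v1]; split=> [s|]; first by apply: sumr_ge0 => x _.
rewrite -v1; have := sum_coord_marginal v (fun _ : S k => 1).
by under eq_bigr do rewrite mulr1; under [in RHS]eq_bigr do rewrite mulr1.
Qed.

Lemma evolve_n_dist (X Y : finType) (p : Y -> X -> X -> R) pis n (v : X -> R) :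
  is_transition p -> (forall j, is_policy (pis j)) -> is_dist v ->
  is_dist (evolve_n p pis n v).
Proof. by move=> hp hpis hv; elim: n => //= n IH; exact: evolve_dist. Qed.

(** This is [mixing_sum] without perturbation: only the initial mismatch, at most 2 in l1, is paid.
    The joint coefficient enters because Pi may correlate the components. *)
Lemma stationary_gap (Pi : joint S -> joint A -> R) (d : joint S -> R)
    (h : nat -> forall k, A k -> S k -> R) T :
  is_policy Pi -> is_stationary (joint_transition P) Pi d ->
  (forall n k a s, `|h n k a s| <= Psi) ->
  `|\sum_(n < T) \sum_k inner (h n k) (@coord_occupation R K S A
       (fun x y => evolve_n (joint_transition P) (fun=> Pi) n d0 x * Pi x y) k) -
    \sum_(n < T) \sum_k inner (h n k) (@coord_occupation R K S A
       (fun x y => d x * Pi x y) k)| <= Psi * (K%:R * (2 * (r%:R / (1 - gam)))).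
Proof.
move=> hPi hd hh; have hJ := joint_transition_transition hP.
pose u n := evolve_n (joint_transition P) (fun=> Pi) n d0.
pose e n x := u n x - d x.
have hu n : is_dist (u n) by exact: evolve_n_dist.
have he : (1 - gam) * \sum_(n < T) l1 (e n) <=
    r%:R * (l1 (e 0%N) + \sum_(n < T) l1 (fun _ : joint S => 0 : R)).
  apply: (@mixing_sum R _ _ (joint_transition P) (fun=> Pi) r e (fun _ _ => 0) T) => // [n|n x].
    by rewrite sumrB (hu n).2 hd.1.2 subrr.
  by rewrite addr0 /e evolveB; congr (_ - _); exact/esym/hd.2.
have z0 : l1 (fun _ : joint S => 0 : R) = 0 by apply: big1 => x _; rewrite normr0.
have z1 : \sum_(n < T) l1 (fun _ : joint S => 0 : R) = 0 by apply: big1.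
rewrite z1 addr0 in he.
have e0 : l1 (e 0%N) <= 2.
  by apply: le_trans (l1B _ _) _; rewrite !l1_dist //; exact: hd.1.
have hsum : \sum_(n < T) l1 (e n) <= 2 * (r%:R / (1 - gam)).
  rewrite mulrA ler_pdivlMr ?subr_gt0 // mulrC; apply: le_trans he _.
  by rewrite [leRHS]mulrC ler_wpM2l.
rewrite -sumrB; apply: le_trans (ler_norm_sum _ _ _) _.
apply: (@le_trans _ _ (\sum_(n < T) Psi * K%:R * l1 (e n))); last first.
  by rewrite -mulr_sumr -mulrA ler_wpM2l // ler_wpM2l.
apply: ler_sum => n _; rewrite -!sum_joint_occupation -sumrB.
rewrite mulr_sumr; apply: le_trans (ler_norm_sum _ _ _) _; apply: ler_sum => x _.
rewrite -sumrB.
have -> : \sum_y (u n x * Pi x y * (\sum_k h n k (y k) (x k)) -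
    d x * Pi x y * (\sum_k h n k (y k) (x k))) =
    \sum_y e n x * (Pi x y * (\sum_k h n k (y k) (x k))).
  by apply: eq_bigr => y _; rewrite /e; ring.
rewrite -mulr_sumr normrM mulrC ler_wpM2r //.
apply: le_trans (ler_norm_sum _ _ _) _.
rewrite -[leRHS]mulr1 -[X in _ <= _ * X](hPi x).2 mulr_sumr; apply: ler_sum => y _.
rewrite normrM (ger0_norm ((hPi x).1 y)) mulrC ler_wpM2r ?(hPi x).1 //.
apply: le_trans (ler_norm_sum _ _ _) _.
rewrite mulr_natr -[K in leRHS]card_ord -sumr_const; apply: ler_sum => k _; exact: hh.
Qed.

(** For each component the lag behind the stationary law of theta_n obeys [mixing_sum], perturbed by
    the change of the stationary marginal. Working per component makes the bound additive in k; the
    term [2 * K%:R] is the initial mismatch. *)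
Lemma occupation_gap (y0 : joint A) (x0 : joint S)
    (pi : nat -> forall k, S k -> A k -> R) (th h : nat -> forall k, A k -> S k -> R) T :
  (forall n k, is_policy (pi n k)) -> (forall n k, in_polyhedron (@P k) (th n k)) ->
  (forall n k a s, th n k a s = state_marginal (th n k) s * pi n k s a) ->
  (forall n k a s, `|h n k a s| <= Psi) ->
  `|\sum_(n < T) \sum_k inner (h n k) (@coord_occupation R K S A
      (fun x y => evolve_n (joint_transition P) (fun n => separable_policy (pi n)) n d0 x *
                  separable_policy (pi n) x y) k) -
    \sum_(n < T) \sum_k inner (h n k) (th n k)| <=
  Psi * (r%:R / (1 - gam) *
         (2 * K%:R + \sum_(n < T) \sum_k l1dist (th n.+1 k) (th n k))).
Proof.
move=> hpi hth thE hh; have hJ := joint_transition_transition hP.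
have hsep n : is_policy (separable_policy (pi n)) by exact: separable_policy_policy.
pose u n := evolve_n (joint_transition P) (fun n => separable_policy (pi n)) n d0.
pose e k n s := @coord_marginal R K S (u n) k s - state_marginal (th n k) s.
pose delta k n s := state_marginal (th n k) s - state_marginal (th n.+1 k) s.
have hst n k : is_stationary (@P k) (pi n k) (state_marginal (th n k)).
  exact: polyhedron_stationary.
have hcm n k : is_dist (@coord_marginal R K S (u n) k).
  by apply: coord_marginal_dist; exact: evolve_n_dist.
have hmix k : \sum_(n < T) l1 (e k n) <=
    r%:R / (1 - gam) * (2 + \sum_(n < T) l1dist (th n.+1 k) (th n k)).
  have gk : mixing_coef (@P k) r <= gam by exact: mixing_coef_coord x0 y0 k r.
  have he : (1 - mixing_coef (@P k) r) * \sum_(n < T) l1 (e k n) <=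
      r%:R * (l1 (e k 0%N) + \sum_(n < T) l1 (delta k n)).
    apply: (@mixing_sum R _ _ (@P k) (fun n => pi n k) r (e k) (delta k) T) => // [n|n s].
      by rewrite sumrB (hcm n k).2 (hst n k).1.2 subrr.
    have hev : evolve (@P k) (pi n k) (state_marginal (th n k)) s = state_marginal (th n k) s.
      exact: (hst n k).2.
    by rewrite /e /delta evolveB hev -coord_marginal_evolve // addrA subrK.
  rewrite mulrAC ler_pdivlMr ?subr_gt0 // mulrC.
  apply: (@le_trans _ _ ((1 - mixing_coef (@P k) r) * \sum_(n < T) l1 (e k n))).
    rewrite ler_wpM2r ?sumr_ge0 // => [n _|]; first exact: l1_ge0.
    by rewrite lerD2l lerN2.
  apply: le_trans he _; rewrite ler_wpM2l //; apply: lerD.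
    by apply: le_trans (l1B _ _) _; rewrite !l1_dist //; exact: (hst _ _).1.
  apply: ler_sum => n _; rewrite /l1dist exchange_big; apply: ler_sum => s _.
  rewrite /delta /state_marginal -sumrB; apply: le_trans (ler_norm_sum _ _ _) _.
  by apply: ler_sum => a _; rewrite distrC.
rewrite -sumrB; apply: le_trans (ler_norm_sum _ _ _) _.
apply: (@le_trans _ _ (\sum_(n < T) \sum_k Psi * l1 (e k n))).
  apply: ler_sum => n _; rewrite -sumrB; apply: le_trans (ler_norm_sum _ _ _) _.
  apply: ler_sum => k _; apply: le_trans (inner_l1dist_le _ _ (hh n k)) _.
  rewrite ler_wpM2l // /l1dist exchange_big; apply: ler_sum => s _ /=.
  (* Both occupations have the conditional law [pi n k] given the state, so their distance is that
     of the state marginals. *)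
  under eq_bigr => a _.
    rewrite coord_occupation_separable // thE -mulrBl normrM (ger0_norm ((hpi n k s).1 a)).
    over.
  by rewrite -mulr_sumr (hpi n k s).2 mulr1.
rewrite exchange_big /=; under eq_bigr => k _ do rewrite -mulr_sumr.
rewrite -mulr_sumr ler_wpM2l // [X in _ * (_ + X)]exchange_big /=.
have -> : 2 * K%:R = \sum_(k < K) 2 :> R by rewrite sumr_const card_ord mulr_natr.
by rewrite -big_split mulr_sumr; apply: ler_sum => k _; exact: hmix.
Qed.

End Gaps.

(** * Expected totals as averages over the sample point *)

Section Rules.
Context {R : realType} {K : nat} {S A : 'I_K -> finType}.
Variable P : forall k, A k -> S k -> S k -> R.
Hypothesis hP : forall k, is_transition (@P k).
Context {dO : measure_display} {Omega : measurableType dO}.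
Variable Pr : probability Omega R.
Variables (d0 : joint S -> R) (pol : @decision_rule R K S A _ Omega).
Hypothesis pol_policy : forall t w, is_policy (pol t w).
Variable h : @value_process R K S A _ Omega.
Arguments h : clear implicits.

Let state_law w n := evolve_n (joint_transition P) (fun t => pol t w) n d0.

Lemma expected_totalE T : expected_total P Pr h T d0 pol =
  Ex Pr (fun w => \sum_(n < T) \sum_k inner (h n w k)
    (@coord_occupation R K S A (fun x y => state_law w n x * pol n w x y) k)).
Proof.
rewrite /expected_total /path_expectation /Ex; congr (fine 'E_Pr[_])%E.
apply/funext => w.
apply: etrans (sum_path_slots d0 (joint_transition_transition hP)
  (fun t => pol_policy t w) T (fun t s a => slot_value h t w s a)) _.
by apply: eq_bigr => n _; exact: sum_joint_occupation.
Qed.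

Lemma slot_expectationE n : slot_expectation P Pr h n d0 pol =
  Ex Pr (fun w => \sum_k inner (h n w k)
    (@coord_occupation R K S A (fun x y => state_law w n x * pol n w x y) k)).
Proof.
rewrite /slot_expectation /path_expectation /Ex; congr (fine 'E_Pr[_])%E.
apply/funext => w.
apply: etrans (sum_path_last_slot d0 (joint_transition_transition hP)
  (fun t => pol_policy t w) n (fun s a => slot_value h n w s a)) _.
exact: sum_joint_occupation.
Qed.

Hypothesis pol_measurable : forall t x y, bounded_measurable (fun w => pol t w x y).
Hypothesis h_measurable : forall t k a s, bounded_measurable (fun w => h t w k a s).

Lemma bounded_occupation_value n : bounded_measurable (fun w =>
  \sum_k inner (h n w k)
    (@coord_occupation R K S A (fun x y => state_law w n x * pol n w x y) k)).
Proof.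
have hlaw x : bounded_measurable (fun w => state_law w n x).
  rewrite /state_law; elim: n x => [|j IH] x /=; first exact: bounded_measurable_cst.
  apply: bounded_measurable_sum => z; apply: bounded_measurableM => //.
  apply: bounded_measurable_sum => y; apply: bounded_measurableM => //.
  exact: bounded_measurable_cst.
apply: bounded_measurable_sum => k; apply: bounded_measurable_sum => a.
apply: bounded_measurable_sum => s; apply: bounded_measurableM => //.
apply: bounded_measurable_sum => x; apply: bounded_measurable_sum => y.
exact: bounded_measurableM.
Qed.

End Rules.

Lemma stationary_total_ge (R : realType) (K : nat) (S A : 'I_K -> finType)
    (P : forall k, A k -> S k -> S k -> R) (dO : measure_display)
    (Omega : measurableType dO) (Pr : probability Omega R)
    (d0 d : joint S -> R) (Pi : joint S -> joint A -> R) (r : nat) (Psi : R)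
    (h : @value_process R K S A _ Omega) T :
  (forall k, is_transition (P k)) -> is_dist d0 -> 0 <= Psi ->
  mixing_coef (joint_transition P) r < 1 -> is_policy Pi ->
  is_stationary (joint_transition P) Pi d ->
  (forall n w k a s, `|h n w k a s| <= Psi) ->
  (forall n k a s, bounded_measurable (fun w => h n w k a s)) ->
  \sum_(n < T) Ex Pr (fun w => \sum_k inner (h n w k)
     (@coord_occupation R K S A (fun x y => d x * Pi x y) k)) <=
  expected_total P Pr h T d0 (stationary_rule Pi) +
  Psi * (K%:R * (2 * (r%:R / (1 - mixing_coef (joint_transition P) r)))).
Proof.
move=> hP hd0 Psi0 gam1 hPi hd hh bh.
have cst c : bounded_measurable ((fun=> c) : Omega -> R) by exact: bounded_measurable_cst.
have bt n : bounded_measurable (fun w => \sum_k inner (h n w k)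
     (@coord_occupation R K S A (fun x y => d x * Pi x y) k)).
  apply: bounded_measurable_sum => k; apply: bounded_measurable_sum => a.
  by apply: bounded_measurable_sum => s; apply: bounded_measurableM.
rewrite expected_totalE // -Ex_sum // -[X in _ + X](Ex_cst Pr) -ExD //; last first.
  by apply: bounded_measurable_sum => n; apply: bounded_occupation_value => // *; exact: cst.
apply: Ex_le => [||w]; first exact: bounded_measurable_sum.
  apply: bounded_measurableD => //.
  by apply: bounded_measurable_sum => n; apply: bounded_occupation_value => // *; exact: cst.
have := stationary_gap hP hd0 Psi0 gam1 T hPi hd (fun n => hh n w).
by rewrite distrC => /(le_trans (ler_norm _)); rewrite lerBlDl.
Qed.

(** * Queues and regret of the algorithm *)

(** From exp (-x) >= 1 - x, since (1 + x + 2 x^2)(1 - x) = 1 + x^2 (1 - 2x). *)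
Lemma expR_le_quadratic (R : realType) (x : R) : x <= 2^-1 ->
  expR x <= 1 + x + 2 * x ^+ 2.
Proof.
move=> hx; have h1 : 0 < 1 - x by lra.
have h2 : 1 - x <= expR (- x) by exact: expR_ge1Dx.
rewrite -[x in leLHS]opprK expRN; apply: (@le_trans _ _ (1 - x)^-1).
  by rewrite lef_pV2 ?posrE // (lt_le_trans h1).
rewrite -[leLHS]mul1r ler_pdivrMr //; nra.
Qed.

(** The case of Cauchy-Schwarz that expresses nonnegativity of the variance. *)
Lemma sqr_sum_le (R : realType) n (x : 'I_n -> R) :
  (\sum_i x i) ^+ 2 <= n%:R * \sum_i x i ^+ 2.
Proof.
case: n x => [|n] x; first by rewrite !big_ord0 expr0n mul0r.
set s := \sum_i x i; set q := \sum_i x i ^+ 2.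
have n0 : 0 < n.+1%:R :> R by rewrite ltr0n.
pose c := s / n.+1%:R; have hc : s = n.+1%:R * c by rewrite mulrC divfK // gt_eqF.
have : 0 <= \sum_i (x i - c) ^+ 2 by apply: sumr_ge0 => i _; exact: sqr_ge0.
have -> : \sum_i (x i - c) ^+ 2 = q - 2 * c * s + n.+1%:R * c ^+ 2.
  transitivity (\sum_i (x i ^+ 2 - 2 * c * x i + c ^+ 2)).
    by apply: eq_bigr => i _; ring.
  by rewrite big_split sumrB /= -mulr_sumr sumr_const card_ord [X in _ = _ + X]mulr_natl.
by rewrite hc => H; rewrite exprMn expr2 -mulrA ler_pM2l //; move: H; lra.
Qed.

Section AlgorithmProcess.
Context {R : realType} {K m : nat} {S A : 'I_K -> finType}.
Variable P : forall k, A k -> S k -> S k -> R.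
Context {dO dW dM : measure_display}.
Context {Omega : measurableType dO} {W : measurableType dW} {M : measurableType dM}.
Variable Pr : probability Omega R.
Variables (omega : nat -> Omega -> W) (mu : nat -> Omega -> M).
Variable ghat : 'I_m -> forall k, A k -> S k -> W -> R.
Variable fhat : forall k, A k -> S k -> M -> R.
Arguments fhat : clear implicits.
Arguments ghat : clear implicits.
Variable Psi : R.
Hypotheses (momega : measurable_process omega) (mmu : measurable_process mu).
Hypotheses (omega_iid : iid Pr omega) (omega_mu : independent_processes Pr omega mu).
Hypothesis mghat : forall i k a s, measurable_fun setT (ghat i k a s).
Hypothesis mfhat : forall k a s, measurable_fun setT (fhat k a s).
Hypothesis ghat_le : forall i k a s v, `|ghat i k a s v| <= Psi.
Hypothesis fhat_le : forall k a s v, `|fhat k a s v| <= Psi.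
Hypothesis Psi_gt0 : 0 < Psi.

Let g (i : 'I_m) : @value_process R K S A _ Omega := fun t w k a s => ghat i k a s (omega t w).
Let f : @value_process R K S A _ Omega := fun t w k a s => fhat k a s (mu t w).

Arguments g : clear implicits.
Arguments f : clear implicits.

Variables (V al : R) (pi0 : forall k, S k -> A k -> R).
Variables (theta : @value_process R K S A _ Omega) (Q : 'I_m -> nat -> Omega -> R).
Arguments theta : clear implicits.
Arguments pi0 : clear implicits.
Hypotheses (V_gt0 : 0 < V) (al_gt0 : 0 < al).
Hypothesis alg : algorithm_iterates P f g V al pi0 theta Q.

Lemma queue_ge0 i n w : 0 <= Q i n.+1 w.
Proof.
have [_ /(_ w)[_ Q1 _ QS]] := alg.
by case: n => [|n]; [rewrite Q1|rewrite QS le_max lexx orbT].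
Qed.

Lemma theta_poly n w k : in_polyhedron (@P k) (theta n w k).
Proof.
have [th0 /(_ w)[_ _ thS _]] := alg.
case: n => [|n]; last exact: (thS n k).1.
have [hpi [d hd thE]] := th0 k.
have -> : theta 0%N w k = fun a s => d s * pi0 k s a.
  by apply/funext => a; apply/funext => s; exact: thE.
exact: stationary_polyhedron.
Qed.

Lemma theta_entry_le1 n w k a s : `|theta n w k a s| <= 1.
Proof.
have [t0 t1 _] := theta_poly n w k; rewrite ger0_norm // -t1.
rewrite (bigD1 a) //= (bigD1 s) //= -addrA lerDl addr_ge0 //.
  exact: sumr_ge0.
by do 2 (apply: sumr_ge0 => ? _).
Qed.

Let ad n (h : Omega -> R) := adapted omega mu n h.

Lemma bounded_ghat i k a s : bounded_measurable (ghat i k a s).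
Proof. by split=> //; exists Psi. Qed.

Lemma bounded_fhat k a s : bounded_measurable (fhat k a s).
Proof. by split=> //; exists Psi. Qed.

Lemma adapted_g i t n k a s : (t < n)%N -> ad n (fun w => g i t w k a s).
Proof. by move=> tn; apply: adapted_omega => //; exact: bounded_ghat. Qed.

Lemma adapted_f t n k a s : ad n (fun w => f t w k a s).
Proof. by apply: adapted_mu; exact: bounded_fhat. Qed.

Lemma adapted_inner n k (u v : Omega -> A k -> S k -> R) :
  (forall a s, ad n (fun w => u w a s)) -> (forall a s, ad n (fun w => v w a s)) ->
  ad n (fun w => inner (u w) (v w)).
Proof.
move=> hu hv; apply: bounded_measurable_sum => a; apply: bounded_measurable_sum => s.
exact: bounded_measurableM (hu a s) (hv a s).
Qed.

Lemma adapted_iterates n : (forall i, ad n (Q i n.+1)) /\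
  (forall k a s, ad n (fun w => theta n w k a s)).
Proof.
elim: n => [|n [IHq IHt]].
  split=> [i|k a s].
    have -> : Q i 1%N = fun=> 0 by apply/funext => w; have [_ /(_ w)[_ ->]] := alg.
    exact: bounded_measurable_cst.
  have [/(_ k)[_ [d _ thE]] _] := alg.
  have -> : (fun w => theta 0%N w k a s) = fun=> d s * pi0 k s a.
    by apply/funext => w; exact: thE.
  exact: bounded_measurable_cst.
have mono h : ad n h -> ad n.+1 h by exact: adapted_le.
have hth k a s : ad n.+1 (fun w => theta n.+1 w k a s).
  split; last by exists 1 => w; exact: theta_entry_le1.
  pose h w a s := V * f n w k a s + \sum_(i < m) Q i n.+1 w * g i n w k a s.
  (* These are the coordinates of the point that the update projects; the argmin is Lipschitz in
     them, hence measurable. *)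
  pose y (p : A k * S k) w := theta n w k p.1 p.2 - h w p.1 p.2 / (2 * al).
  apply: (@measurable_lipschitz R _ (g_sigma_algebraType (history omega mu n.+1)) _ y _ 1).
    move=> p; suff : ad n.+1 (y p) by case.
    apply: bounded_measurableB; first exact/mono/IHt.
    apply: bounded_measurableM; last exact: bounded_measurable_cst.
    apply: bounded_measurableD.
      by apply: bounded_measurableM; [exact: bounded_measurable_cst|exact: adapted_f].
    apply: bounded_measurable_sum => i.
    by apply: bounded_measurableM; [exact/mono/IHq|exact: adapted_g].
  move=> w w'; rewrite mul1r.
  rewrite -(pair_big xpredT xpredT (fun a s => `|y (a, s) w - y (a, s) w'|)) /=.
  have [_ alg2] := alg.
  have [_ _ min1 _] := alg2 w; have [_ _ min2 _] := alg2 w'.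
  exact: argmin_lipschitz (min1 n k) (min2 n k) al_gt0.
split=> // i.
have -> : Q i n.+2 = fun w => Num.max (Q i n.+1 w + \sum_k inner (g i n w k) (theta n.+1 w k)) 0.
  by apply/funext => w; have [_ /(_ w)[_ _ _ ->]] := alg.
apply: bounded_measurable_max; last exact: bounded_measurable_cst.
apply: bounded_measurableD; first exact: mono.
apply: bounded_measurable_sum => k; apply: adapted_inner => // a s.
exact: adapted_g.
Qed.

Let adQ n i : ad n (Q i n.+1) := (adapted_iterates n).1 i.
Let adtheta n k a s : ad n (fun w => theta n w k a s) := (adapted_iterates n).2 k a s.

Let bm n h : ad n h -> bounded_measurable (h : Omega -> R).
Proof. exact: adapted_bounded_measurable. Qed.

Section Comparator.
Variable t : forall k, A k -> S k -> R.
Arguments t : clear implicits.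
Hypothesis t_poly : forall k, in_polyhedron (@P k) (t k).

Definition comparator_value (h : forall k, A k -> S k -> R) : R := \sum_k inner (h k) (t k).

Let gam i (v : W) : R := comparator_value (fun k a s => ghat i k a s v).

(** Slot 0 stands for every slot, because [omega] is identically distributed. *)
Definition comparator_constraint i : R := Ex Pr (fun w => comparator_value (g i 0%N w)).

(* The proximal term is kept in the Lyapunov function, so that the drift
   argument works slot by slot. *)
Definition lyapunov n w : R :=
  2^-1 * \sum_i Q i n.+1 w ^+ 2 + al * \sum_k sqdist (t k) (theta n w k).

Lemma lyapunov_ge0 n w : 0 <= lyapunov n w.
Proof.
rewrite addr_ge0 // mulr_ge0 ?(ltW al_gt0) //; apply: sumr_ge0 => ? _.
  exact: sqr_ge0.
exact: sqdist_ge0.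
Qed.

Lemma sum_sqdist_le n w : \sum_k sqdist (t k) (theta n w k) <= 2 * K%:R.
Proof.
rewrite mulr_natr -[K in leRHS]card_ord -sumr_const; apply: ler_sum => k _.
exact: sqdist_le2 (t_poly k) (theta_poly n w k).
Qed.

Lemma lyapunov0 w : lyapunov 0 w <= 2 * al * K%:R.
Proof.
have [_ /(_ w)[_ Q1 _ _]] := alg.
rewrite /lyapunov big1 => [|i _]; last by rewrite Q1 expr0n.
by rewrite mulr0 add0r [2 * al]mulrC -mulrA ler_pM2l // sum_sqdist_le.
Qed.

Lemma lyapunov_step n w :
  lyapunov n.+1 w <= lyapunov n w +
  V * (comparator_value (f n w) - \sum_k inner (f n w k) (theta n.+1 w k)) +
  \sum_i Q i n.+1 w * comparator_value (g i n w) + 2^-1 * (m%:R * (K%:R * Psi) ^+ 2).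
Proof.
have [_ /(_ w)[_ _ min QS]] := alg.
apply: (@drift_step R K m S A P (f n w) (fun i => g i n w) V al Psi
  (fun i => Q i n.+1 w) (fun i => Q i n.+2 w) (theta n w) (theta n.+1 w)) => //.
by move=> i k a s; exact: ghat_le.
Qed.

Lemma bounded_gam i : bounded_measurable (gam i).
Proof.
apply: bounded_measurable_sum => k; apply: bounded_measurable_sum => a.
apply: bounded_measurable_sum => s; apply: bounded_measurableM; first exact: bounded_ghat.
exact: bounded_measurable_cst.
Qed.

Lemma adapted_lyapunov n : ad n (lyapunov n).
Proof.
apply: bounded_measurableD.
  apply: bounded_measurableM; first exact: bounded_measurable_cst.
  by apply: bounded_measurable_sum => i; apply: bounded_measurableX; exact: adQ.
apply: bounded_measurableM; first exact: bounded_measurable_cst.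
apply: bounded_measurable_sum => k; apply: bounded_measurable_sum => a.
apply: bounded_measurable_sum => s.
apply: bounded_measurableX; apply: bounded_measurableB; last exact: adtheta.
exact: bounded_measurable_cst.
Qed.

Lemma bounded_constraint_value i n : bounded_measurable (fun w => comparator_value (g i n w)).
Proof.
apply: (bm (n := n.+1)); apply: bounded_measurable_sum => k.
apply: adapted_inner => a s; first exact: adapted_g.
exact: bounded_measurable_cst.
Qed.

(** The weight 1 gives the plain drift; a weight of the form exp (r Z) / Z gives the drift of the
    exponential moment. *)
Lemma Ex_weighted_drift n U : ad n U ->
  Ex Pr (fun w => U w * \sum_i Q i n.+1 w * comparator_value (g i n w)) =
  \sum_i Ex Pr (fun w => U w * Q i n.+1 w) * comparator_constraint i.
Proof.
move=> hU.
transitivity (Ex Pr (fun w => \sum_i (U w * Q i n.+1 w) * comparator_value (g i n w))).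
  by congr (Ex Pr _); apply/funext => w; rewrite mulr_sumr; apply: eq_bigr => i _; rewrite mulrA.
rewrite Ex_sum => [|i].
  apply: eq_bigr => i _.
  apply: (Ex_adapted_mul momega mmu omega_iid omega_mu (n := n)
           (U := fun w => U w * Q i n.+1 w) _ (bounded_gam i)).
  exact: bounded_measurableM hU (adQ n i).
apply: bounded_measurableM; last exact: bounded_constraint_value.
by apply: (bm (n := n)); exact: bounded_measurableM hU (adQ n i).
Qed.

Lemma Ex_sum_drift n :
  Ex Pr (fun w => \sum_i Q i n.+1 w * comparator_value (g i n w)) =
  \sum_i Ex Pr (Q i n.+1) * comparator_constraint i.
Proof.
have := @Ex_weighted_drift n (fun=> 1) (bounded_measurable_cst 1).
under [X in Ex _ X = _ -> _]eq_fun => w do rewrite mul1r.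
move=> ->; apply: eq_bigr => i _; congr (Ex Pr _ * _).
by apply/funext => w; rewrite mul1r.
Qed.

Let bmQ i n : bounded_measurable (Q i n.+1).
Proof. exact: bm (adQ n i). Qed.

Let bm_drift n : bounded_measurable (fun w => \sum_i Q i n.+1 w * comparator_value (g i n w)).
Proof.
apply: bounded_measurable_sum => i; apply: bounded_measurableM => //.
exact: bounded_constraint_value.
Qed.

Let bm_played n n' : bounded_measurable (fun w => \sum_k inner (f n w k) (theta n' w k)).
Proof.
apply: (bm (n := n')); apply: bounded_measurable_sum => k.
by apply: adapted_inner => a s; [exact: adapted_f|exact: adtheta].
Qed.

Let bm_comparator n : bounded_measurable (fun w => comparator_value (f n w)).
Proof.
apply: (bm (n := 0%N)); apply: bounded_measurable_sum => k.
by apply: adapted_inner => a s; [exact: adapted_f|exact: bounded_measurable_cst].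
Qed.

Let bm_lyapunov n : bounded_measurable (lyapunov n).
Proof. exact: bm (adapted_lyapunov n). Qed.

Lemma Ex_lyapunov_step n :
  Ex Pr (lyapunov n.+1) <= Ex Pr (lyapunov n) +
  V * (Ex Pr (fun w => comparator_value (f n w)) -
       Ex Pr (fun w => \sum_k inner (f n w k) (theta n.+1 w k))) +
  \sum_i Ex Pr (Q i n.+1) * comparator_constraint i + 2^-1 * (m%:R * (K%:R * Psi) ^+ 2).
Proof.
have hb : bounded_measurable (fun w => comparator_value (f n w) -
    \sum_k inner (f n w k) (theta n.+1 w k)) by exact: bounded_measurableB.
have hV : bounded_measurable (fun w => V * (comparator_value (f n w) -
    \sum_k inner (f n w k) (theta n.+1 w k))).
  by apply: bounded_measurableM => //; exact: bounded_measurable_cst.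
rewrite -Ex_sum_drift -ExB // -ExZ // -ExD //.
rewrite -ExD //; last exact: bounded_measurableD.
rewrite -[X in _ <= _ + X](Ex_cst Pr) -ExD; last exact: bounded_measurable_cst.
  apply: Ex_le => //; last by move=> w; exact: lyapunov_step.
  by do ?[apply: bounded_measurableD => //]; exact: bounded_measurable_cst.
by do ?[apply: bounded_measurableD => //].
Qed.

(** The violation [eps] is charged once per unit of queue and slot; it is affordable when it is
    O(1/T). *)
Lemma comparator_regret T eps : 0 <= eps -> (forall i, comparator_constraint i <= eps) ->
  V * \sum_(n < T) (Ex Pr (fun w => \sum_k inner (f n w k) (theta n.+1 w k)) -
                    Ex Pr (fun w => comparator_value (f n w))) <=
  2 * al * K%:R + eps * \sum_(n < T) \sum_i Ex Pr (Q i n.+1) +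
  T%:R * (2^-1 * (m%:R * (K%:R * Psi) ^+ 2)).
Proof.
move=> eps0 heps.
have L0 : Ex Pr (lyapunov 0) <= 2 * al * K%:R.
  rewrite -[leRHS](Ex_cst Pr); apply: Ex_le => //; first exact: bounded_measurable_cst.
  exact: lyapunov0.
have LT : 0 <= Ex Pr (lyapunov T) by apply: Ex_ge0 => w; exact: lyapunov_ge0.
suff H : Ex Pr (lyapunov T) + V * \sum_(n < T)
    (Ex Pr (fun w => \sum_k inner (f n w k) (theta n.+1 w k)) -
                    Ex Pr (fun w => comparator_value (f n w))) <=
    Ex Pr (lyapunov 0) + eps * \sum_(n < T) \sum_i Ex Pr (Q i n.+1) +
    T%:R * (2^-1 * (m%:R * (K%:R * Psi) ^+ 2)) by lra.
clear LT; elim: T => [|T IH]; first by rewrite !big_ord0 !mulr0 mul0r !addr0.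
rewrite !big_ord_recr /= !mulrDr -natr1.
have := Ex_lyapunov_step T.
have : \sum_i Ex Pr (Q i T.+1) * comparator_constraint i <= eps * \sum_i Ex Pr (Q i T.+1).
  rewrite mulr_sumr; apply: ler_sum => i _; rewrite mulrC ler_wpM2r //.
  by apply: Ex_ge0 => w; exact: queue_ge0.
lra.
Qed.

(** * Queue bounds from a comparator with slack *)

Section Slater.
Variable eta : R.
Hypothesis eta_gt0 : 0 < eta.
Hypothesis slack : forall i, comparator_constraint i <= - eta.

Let c0 : R := 2 * V * K%:R * Psi + 2^-1 * (m%:R * (K%:R * Psi) ^+ 2).

Let c0_ge0 : 0 <= c0.
Proof. by rewrite addr_ge0 // !mulr_ge0 ?sqr_ge0 // ltW. Qed.

Lemma comparator_value_norm_le (h : forall k, A k -> S k -> R) :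
  (forall k a s, `|h k a s| <= Psi) -> `|comparator_value h| <= K%:R * Psi.
Proof. by move=> hh; exact: (@sum_inner_norm_le R K S A P Psi h t). Qed.

Lemma lyapunov_step_slack n w :
  lyapunov n.+1 w <= lyapunov n w + c0 + \sum_i Q i n.+1 w * comparator_value (g i n w).
Proof.
apply: le_trans (lyapunov_step n w) _; rewrite /c0.
have h1 : comparator_value (f n w) <= K%:R * Psi.
  by apply: le_trans (ler_norm _) _; apply: comparator_value_norm_le => *; exact: fhat_le.
have h2 : - (K%:R * Psi) <= \sum_k inner (f n w k) (theta n.+1 w k).
  rewrite lerNl; apply: le_trans (ler_norm _) _; rewrite normrN.
  apply: (@sum_inner_norm_le R K S A P Psi (f n w) (theta n.+1 w)) => [k|k a s].
    exact: theta_poly.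
  exact: fhat_le.
have : V * (comparator_value (f n w) - \sum_k inner (f n w k) (theta n.+1 w k)) <=
  V * (2 * (K%:R * Psi)) by rewrite ler_pM2l //; lra.
lra.
Qed.

(** A first-moment argument, sufficient for sums over slots; a bound at the single time T+1 takes
    the exponential moment below. *)
Lemma average_queue T :
  eta * \sum_(n < T) \sum_i Ex Pr (Q i n.+1) <= T%:R * c0 + 2 * al * K%:R.
Proof.
have L0 : Ex Pr (lyapunov 0) <= 2 * al * K%:R.
  rewrite -[leRHS](Ex_cst Pr); apply: Ex_le => //; first exact: bounded_measurable_cst.
  exact: lyapunov0.
have LT : 0 <= Ex Pr (lyapunov T) by apply: Ex_ge0 => w; exact: lyapunov_ge0.
suff H : Ex Pr (lyapunov T) + eta * \sum_(n < T) \sum_i Ex Pr (Q i n.+1) <=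
    Ex Pr (lyapunov 0) + T%:R * c0 by lra.
clear LT; elim: T => [|T IH]; first by rewrite !big_ord0 mulr0 mul0r !addr0.
rewrite !big_ord_recr /= (mulrDr eta) -natr1 (mulrDl _ _ c0).
have : Ex Pr (lyapunov T.+1) <= Ex Pr (lyapunov T) + c0 +
    \sum_i Ex Pr (Q i T.+1) * comparator_constraint i.
  rewrite -Ex_sum_drift -[X in _ + X + _](Ex_cst Pr) -!ExD //;
    do ?[exact: bounded_measurable_cst | apply: bounded_measurableD => //].
  apply: Ex_le => // [|w]; last exact: lyapunov_step_slack.
  by do 2 ?[apply: bounded_measurableD => //]; exact: bounded_measurable_cst.
have : \sum_i Ex Pr (Q i T.+1) * comparator_constraint i <= - eta * \sum_i Ex Pr (Q i T.+1).
  rewrite mulr_sumr; apply: ler_sum => i _; rewrite mulrC ler_wpM2r //.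
  by apply: Ex_ge0 => w; exact: queue_ge0.
lra.
Qed.

(** The proximal part of 2L is at most D^2, so |Q|_1 >= Z - D. The threshold [lam] is such that Z >=
    lam implies c0 - eta |Q|_1 <= -(eta/2) Z. [B] bounds the increment [Y], and [r] makes the
    second-order term 2 r^2 B^2 equal to r eta / 4, half of the first-order gain r eta / 2. *)
Let D : R := Num.sqrt (4 * al * K%:R).
Let lam : R := 2 * (c0 / eta + D) + 1.
Let beta : R := Num.sqrt m%:R * (K%:R * Psi).
Let B : R := eta / 2 + beta.
Let r : R := eta / (8 * B ^+ 2).
Let Z n w : R := Num.sqrt (2 * lyapunov n w).

Let beta_ge0 : 0 <= beta.
Proof. by rewrite mulr_ge0 ?sqrtr_ge0 // mulr_ge0 // ltW. Qed.

Let B_ge : eta / 2 <= B.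
Proof. by rewrite lerDl. Qed.

Let B_gt0 : 0 < B.
Proof. by apply: lt_le_trans B_ge; rewrite divr_gt0. Qed.

Let r_gt0 : 0 < r.
Proof. by rewrite divr_gt0 // mulr_gt0 // exprn_gt0. Qed.

Let D_ge0 : 0 <= D.
Proof. exact: sqrtr_ge0. Qed.

Let c0_eta_lam : c0 + eta * D <= eta / 2 * lam.
Proof.
have -> : eta / 2 * lam = c0 + eta * D + eta / 2 by rewrite /lam; field; rewrite gt_eqF.
by rewrite lerDl divr_ge0 // ltW.
Qed.

Let lam_gt0 : 0 < lam.
Proof. by rewrite ltr_pwDr // mulr_ge0 // addr_ge0 // divr_ge0 // ltW. Qed.

Let Z_ge0 n w : 0 <= Z n w.
Proof. exact: sqrtr_ge0. Qed.

Let sqrZ n w : Z n w ^+ 2 = 2 * lyapunov n w.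
Proof. by rewrite sqr_sqrtr // mulr_ge0 // lyapunov_ge0. Qed.

Let sum_queue_ge0 n w : 0 <= \sum_i Q i n.+1 w.
Proof. by apply: sumr_ge0 => i _; exact: queue_ge0. Qed.

Let al_sqdist_ge0 n w : 0 <= al * \sum_k sqdist (t k) (theta n w k).
Proof. by rewrite mulr_ge0 ?(ltW al_gt0) // sumr_ge0 // => k _; exact: sqdist_ge0. Qed.

Let sqr_queue_le n w : \sum_i Q i n.+1 w ^+ 2 <= Z n w ^+ 2.
Proof. by rewrite sqrZ /lyapunov; have := al_sqdist_ge0 n w; lra. Qed.

Lemma queue_le_Z i n w : Q i n.+1 w <= Z n w.
Proof.
rewrite -(@ler_pXn2r _ 2) ?nnegrE ?queue_ge0 //.
apply: le_trans (sqr_queue_le n w); rewrite (bigD1 i) //= lerDl.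
by apply: sumr_ge0 => j _; exact: sqr_ge0.
Qed.

Let sum_queue_le n w : \sum_i Q i n.+1 w <= Num.sqrt m%:R * Z n w.
Proof.
rewrite -(@ler_pXn2r _ 2) ?nnegrE ?mulr_ge0 ?sqrtr_ge0 // exprMn sqr_sqrtr //.
by apply: le_trans (sqr_sum_le _) _; rewrite ler_wpM2l.
Qed.

Let Z_le n w : Z n w <= \sum_i Q i n.+1 w + D.
Proof.
rewrite -(@ler_pXn2r _ 2) ?nnegrE ?addr_ge0 // sqrZ /lyapunov.
have h1 : \sum_i Q i n.+1 w ^+ 2 <= (\sum_i Q i n.+1 w) ^+ 2.
  rewrite [leRHS]expr2 mulr_suml; apply: ler_sum => i _.
  rewrite expr2 ler_wpM2l ?queue_ge0 // (bigD1 i) //= lerDl.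
  by apply: sumr_ge0 => j _; exact: queue_ge0.
have h2 : 2 * (al * \sum_k sqdist (t k) (theta n w k)) <= D ^+ 2.
  rewrite sqr_sqrtr ?mulr_ge0 ?(ltW al_gt0) //.
  have : al * \sum_k sqdist (t k) (theta n w k) <= al * (2 * K%:R).
    by rewrite ler_pM2l // sum_sqdist_le.
  lra.
have h3 : 0 <= (\sum_i Q i n.+1 w) * D by rewrite mulr_ge0.
rewrite sqrrD; lra.
Qed.

Let X n w : R := \sum_i Q i n.+1 w * comparator_value (g i n w).

Let X_le n w : `|X n w| <= beta * Z n w.
Proof.
rewrite /X; apply: le_trans (ler_norm_sum _ _ _) _.
apply: (@le_trans _ _ (\sum_i Q i n.+1 w * (K%:R * Psi))).
  apply: ler_sum => i _; rewrite normrM ger0_norm ?queue_ge0 // ler_wpM2l ?queue_ge0 //.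
  by apply: comparator_value_norm_le => *; exact: ghat_le.
by rewrite -mulr_suml /beta mulrAC ler_wpM2r // mulr_ge0 // ltW.
Qed.

Let sqrZ_step n w : Z n.+1 w ^+ 2 <= Z n w ^+ 2 + 2 * (c0 + X n w).
Proof. by rewrite !sqrZ; have := lyapunov_step_slack n w; rewrite -/(X n w); lra. Qed.

Let Z_step_small n w : Z n w < lam -> Z n.+1 w <= lam + B.
Proof.
move=> hZ; have lamB : 0 <= lam + B by rewrite addr_ge0 // ltW.
rewrite -(@ler_pXn2r _ 2) ?nnegrE //.
apply: le_trans (sqrZ_step n w) _.
have h1 : X n w <= beta * lam.
  apply: le_trans (ler_norm _) _; apply: le_trans (X_le n w) _.
  by rewrite ler_wpM2l // ltW.
have h2 : Z n w ^+ 2 <= lam ^+ 2 by rewrite ler_pXn2r ?nnegrE ?(ltW lam_gt0) ?(ltW hZ).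
have h3 : c0 <= eta / 2 * lam.
  by apply: le_trans c0_eta_lam; rewrite lerDl mulr_ge0 // ltW.
have h4 : 0 <= B ^+ 2 by exact: sqr_ge0.
have h5 : B * lam = eta / 2 * lam + beta * lam by rewrite /B mulrDl.
rewrite sqrrD; lra.
Qed.

Let Y n w : R := (c0 + X n w) / Z n w.

Let Y_le n w : lam <= Z n w -> `|Y n w| <= B.
Proof.
move=> hZ; have Z0 := lt_le_trans lam_gt0 hZ.
rewrite /Y normrM normfV (ger0_norm (ltW Z0)) ler_pdivrMr //.
apply: le_trans (ler_normD _ _) _; rewrite /B mulrDl; apply: lerD => //.
rewrite ger0_norm //; apply: (@le_trans _ _ (eta / 2 * lam)).
  by apply: le_trans c0_eta_lam; rewrite lerDl mulr_ge0 // ltW.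
by rewrite ler_wpM2l // divr_ge0 // ltW.
Qed.

(** Linearization of the root: sqrt (z^2 + 2 z y) <= z + y, provided z + y >= 0. *)
Let Z_step_large n w : lam <= Z n w -> Z n.+1 w <= Z n w + Y n w.
Proof.
move=> hZ; have Z0 := lt_le_trans lam_gt0 hZ.
have hs : Z n.+1 w ^+ 2 <= Z n w ^+ 2 + 2 * (Z n w * Y n w).
  by rewrite [Z n w * Y n w]mulrC divfK ?gt_eqF // sqrZ_step.
(* A square is nonnegative, so z (z + 2y) >= 0; hence z + 2y >= 0, and z + y is half the sum of z
   and z + 2y. *)
have pos : 0 <= Z n w + Y n w.
  have : 0 <= Z n w * (Z n w + 2 * Y n w).
    by have := sqr_ge0 (Z n.+1 w); rewrite mulrDr -expr2; lra.
  by rewrite pmulr_rge0 //; lra.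
rewrite -(@ler_pXn2r _ 2) ?nnegrE //.
by apply: le_trans hs _; rewrite sqrrD; have := sqr_ge0 (Y n w); lra.
Qed.

(* As long as Z >= lam, one slot adds at most Y to Z, where |Y| <= B and Y has
   negative weighted mean; hence exp (r Z) contracts in expectation. *)
Let Wt n w : R := expR (r * Z n w).
Let ind n w : R := (lam <= Z n w)%R%:R.
(** The value is exp (r Z) / Z above the threshold and 0 below. The maximum leaves it unchanged and
    keeps the denominator away from 0, so that [U] is bounded. *)
Let U n w : R := ind n w * Wt n w * (Num.max (Z n w) lam)^-1.
Let b : R := expR (r * (lam + B)).

(** Keeps the exponent r Y within the range of [expR_le_quadratic]. *)
Let rB : r * B <= 4^-1.
Proof.
have -> : r * B = eta / (8 * B) by rewrite /r; field; rewrite gt_eqF.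
rewrite ler_pdivrMr ?mulr_gt0 //; have := B_ge; lra.
Qed.

Let exp_step n w : Wt n.+1 w <= b + ind n w * Wt n w * (1 + 2 * r ^+ 2 * B ^+ 2) +
  r * (c0 * U n w + U n w * X n w).
Proof.
rewrite /U /ind; case: (lerP lam (Z n w)) => hZ; last first.
  by rewrite !(mul0r, mulr0, addr0) ler_expR ler_pM2l // Z_step_small.
have Z0 := lt_le_trans lam_gt0 hZ.
rewrite !mul1r.
apply: (@le_trans _ _ (Wt n w * expR (r * Y n w))).
  by rewrite /Wt -expRD ler_expR -mulrDr ler_pM2l // Z_step_large.
have rY : `|r * Y n w| <= 4^-1.
  apply: le_trans rB; rewrite normrM (gtr0_norm r_gt0) ler_pM2l //; exact: Y_le.
have h1 : expR (r * Y n w) <= 1 + r * Y n w + 2 * r ^+ 2 * B ^+ 2.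
  apply: le_trans (expR_le_quadratic _) _.
    by apply: le_trans (ler_norm _) (le_trans rY _); lra.
  rewrite lerD2l -mulrA ler_pM2l // exprMn ler_wpM2l ?sqr_ge0 //.
  rewrite -[Y n w ^+ 2]real_normK ?num_real // ler_pXn2r ?nnegrE ?(ltW B_gt0) //.
  exact: Y_le.
have W0 : 0 < Wt n w by exact: expR_gt0.
have b0 : 0 <= b by exact: expR_ge0.
apply: (@le_trans _ _ (Wt n w * (1 + r * Y n w + 2 * r ^+ 2 * B ^+ 2))).
  by rewrite ler_pM2l.
have -> : r * (c0 * (Wt n w / Z n w) + Wt n w / Z n w * X n w) = Wt n w * (r * Y n w).
  by rewrite /Y; field; rewrite gt_eqF.
lra.
Qed.

Let ad_Z n : ad n (Z n).
Proof.
apply: bounded_measurable_sqrt; apply: bounded_measurableM; last exact: adapted_lyapunov.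
exact: bounded_measurable_cst.
Qed.

Let ad_W n : ad n (Wt n).
Proof.
apply: bounded_measurable_expR; apply: bounded_measurableM; last exact: ad_Z.
exact: bounded_measurable_cst.
Qed.

Let ad_indW n : ad n (fun w => ind n w * Wt n w).
Proof.
apply: bounded_measurableM; last exact: ad_W.
by apply: bounded_measurable_threshold; exact: ad_Z.
Qed.

Let ad_U n : ad n (U n).
Proof.
apply: bounded_measurableM; first exact: ad_indW.
apply: (@bounded_measurable_inv _ _ _ _ lam) => [//|w|]; first by rewrite le_max lexx orbT.
by apply: bounded_measurable_max; [exact: ad_Z|exact: bounded_measurable_cst].
Qed.

Let U_ge0 n w : 0 <= U n w.
Proof.
by rewrite !mulr_ge0 ?expR_ge0 ?invr_ge0 ?ler0n // le_max Z_ge0.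
Qed.

(** The weight [U] is known before slot n, so Slater's slack acts inside the weighted mean; above
    [lam], the gain eta |Q|_1 covers c0 and half of eta Z, and the factor 1 / Z in [U] cancels. *)
Let Ex_UX n : c0 * Ex Pr (U n) + Ex Pr (fun w => U n w * X n w) <=
  - (eta / 2) * Ex Pr (fun w => ind n w * Wt n w).
Proof.
have bU := bm (ad_U n).
have bUQ i : bounded_measurable (fun w => U n w * Q i n.+1 w).
  exact: bounded_measurableM bU (bmQ i n).
have bindW := bm (ad_indW n).
rewrite Ex_weighted_drift //.
apply: (@le_trans _ _ (c0 * Ex Pr (U n) - eta * \sum_i Ex Pr (fun w => U n w * Q i n.+1 w))).
  rewrite lerD2l mulr_sumr -sumrN; apply: ler_sum => i _.
  rewrite -mulNr mulrC ler_wpM2r //.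
  by apply: Ex_ge0 => w; rewrite mulr_ge0 // queue_ge0.
rewrite -Ex_sum // -!ExZ //; last exact: bounded_measurable_sum.
rewrite -ExB; first last.
- by apply: bounded_measurableM; [exact: bounded_measurable_cst|exact: bounded_measurable_sum].
- by apply: bounded_measurableM; [exact: bounded_measurable_cst|].
apply: Ex_le => [||w].
- apply: bounded_measurableB; apply: bounded_measurableM => //;
    do ?[exact: bounded_measurable_cst]; exact: bounded_measurable_sum.
- by apply: bounded_measurableM => //; exact: bounded_measurable_cst.
rewrite -mulr_sumr /U /ind; case: (lerP lam (Z n w)) => hZ; last by rewrite !mul0r !mulr0 subrr.
have Z0 := lt_le_trans lam_gt0 hZ.
rewrite !mul1r.
have -> : - (eta / 2) * Wt n w = Wt n w / Z n w * (- (eta / 2) * Z n w).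
  by field; rewrite gt_eqF.
have -> : c0 * (Wt n w / Z n w) - eta * (Wt n w / Z n w * \sum_i Q i n.+1 w) =
  Wt n w / Z n w * (c0 - eta * \sum_i Q i n.+1 w) by ring.
rewrite ler_wpM2l ?divr_ge0 ?expR_ge0 ?(ltW Z0) //.
have h1 : eta * Z n w <= eta * (\sum_i Q i n.+1 w + D) by rewrite ler_pM2l.
have h2 : eta / 2 * lam <= eta / 2 * Z n w by rewrite ler_pM2l // divr_gt0.
have := c0_eta_lam; lra.
Qed.

(** The rate is 1 + r eta / 4 - r eta / 2, the second-order loss against the drift. *)
Let Ex_exp_step n : Ex Pr (Wt n.+1) <= b + (1 - r * eta / 4) * Ex Pr (Wt n).
Proof.
have bU := bm (ad_U n).
have bindW := bm (ad_indW n).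
have bX : bounded_measurable (X n) by exact: bm_drift.
have hr : 2 * r ^+ 2 * B ^+ 2 = r * eta / 4.
  by rewrite /r; field; rewrite gt_eqF.
have cst c : bounded_measurable ((fun=> c) : Omega -> R) by exact: bounded_measurable_cst.
have bcU : bounded_measurable (fun w => c0 * U n w) by exact: bounded_measurableM.
have bUX : bounded_measurable (fun w => U n w * X n w) by exact: bounded_measurableM.
have bsum : bounded_measurable (fun w => c0 * U n w + U n w * X n w).
  exact: bounded_measurableD.
have bsumr : bounded_measurable (fun w => r * (c0 * U n w + U n w * X n w)).
  exact: bounded_measurableM.
have bind : bounded_measurable (fun w => (1 + r * eta / 4) * (ind n w * Wt n w)).
  exact: bounded_measurableM.
have bbind : bounded_measurable (fun w => b + (1 + r * eta / 4) * (ind n w * Wt n w)).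
  exact: bounded_measurableD.
have h1 : Ex Pr (Wt n.+1) <= b + (1 + r * eta / 4) * Ex Pr (fun w => ind n w * Wt n w) +
    r * (c0 * Ex Pr (U n) + Ex Pr (fun w => U n w * X n w)).
  rewrite -(ExZ Pr c0 bU) -(ExD Pr bcU bUX) -(ExZ Pr r bsum) -(ExZ Pr _ bindW).
  rewrite -[X in X + _ + _](Ex_cst Pr) -(ExD Pr (cst b) bind) -(ExD Pr bbind bsumr).
  apply: Ex_le => [||w]; first exact: bm (ad_W _).
    exact: bounded_measurableD.
  by apply: le_trans (exp_step n w) _; rewrite hr; lra.
have h2 : r * (c0 * Ex Pr (U n) + Ex Pr (fun w => U n w * X n w)) <=
    r * (- (eta / 2) * Ex Pr (fun w => ind n w * Wt n w)).
  by rewrite ler_pM2l // Ex_UX.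
(* The indicator may be discarded because the rate is nonnegative, by [rB]. *)
have h3 : (1 - r * eta / 4) * Ex Pr (fun w => ind n w * Wt n w) <=
    (1 - r * eta / 4) * Ex Pr (Wt n).
  apply: ler_wpM2l.
    have : r * (eta / 2) <= r * B by rewrite ler_pM2l.
    by have := rB; lra.
  apply: Ex_le => // [|w]; first exact: bm (ad_W n).
  by rewrite /ind; case: (lerP lam (Z n w)) => _; rewrite ?mul1r ?mul0r ?expR_ge0.
lra.
Qed.

(** The bound is the fixed point of x -> b + (1 - r eta / 4) x. It holds at the start since the
    queues vanish and Z <= D there. *)
Let Ex_exp_bound n : Ex Pr (Wt n) <= b * (4 / (r * eta)).
Proof.
have reta : 0 < r * eta by rewrite mulr_gt0.
have rho : r * eta / 4 <= 8^-1.
  have : r * (eta / 2) <= r * B by rewrite ler_pM2l.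
  by have := rB; lra.
have b0 : 0 <= b by exact: expR_ge0.
elim: n => [|n IH].
  apply: (@le_trans _ _ b).
    rewrite -[leRHS](Ex_cst Pr); apply: Ex_le => [||w]; first exact: bm (ad_W 0).
      exact: bounded_measurable_cst.
    rewrite ler_expR ler_pM2l //.
    have Q0 : \sum_i Q i 1%N w = 0.
      by rewrite big1 // => i _; have [_ /(_ w)[_ ->]] := alg.
    have := Z_le 0 w; rewrite Q0 add0r => h.
    have : 0 <= c0 / eta by rewrite divr_ge0 // ltW.
    by have := B_gt0; have := D_ge0; rewrite /lam; lra.
  rewrite ler_peMr // ler_pdivlMr //; lra.
apply: le_trans (Ex_exp_step n) _.
have : (1 - r * eta / 4) * Ex Pr (Wt n) <= (1 - r * eta / 4) * (b * (4 / (r * eta))).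
  by rewrite ler_wpM2l //; lra.
have -> : (1 - r * eta / 4) * (b * (4 / (r * eta))) = b * (4 / (r * eta)) - b.
  by field; rewrite !gt_eqF.
lra.
Qed.

(** Jensen's inequality in tangent form: 1 + x <= exp x at x = r Z - r (lam + B) - c turns the
    exponential moment into a first moment. *)
Lemma Ex_queue_le i n :
  Ex Pr (Q i n.+1) <= lam + B + 96 * B ^+ 3 / eta ^+ 2.
Proof.
have bZ := bm (ad_Z n); have bW := bm (ad_W n).
apply: (@le_trans _ _ (Ex Pr (Z n))).
  by apply: Ex_le => // w; exact: queue_le_Z.
(* Chosen so that exp c dominates 4 / (r eta) = 32 (B / eta)^2, through (1 + 6u)^2 >= 32 u^2.
   Divided by r it gives the term 96 B^3 / eta^2. *)
pose c := 12 * B / eta.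
have hc : 32 * B ^+ 2 / eta ^+ 2 <= expR c.
  have -> : c = 6 * (B / eta) + 6 * (B / eta) by rewrite /c; field; rewrite gt_eqF.
  have u0 : 0 <= B / eta by rewrite divr_ge0 // ltW.
  have -> : 32 * B ^+ 2 / eta ^+ 2 = 32 * (B / eta) ^+ 2 by field; rewrite gt_eqF.
  have h1 : 1 + 6 * (B / eta) <= expR (6 * (B / eta)) by exact: expR_ge1Dx.
  rewrite expRD -expr2; apply: (@le_trans _ _ ((1 + 6 * (B / eta)) ^+ 2)); first by nra.
  by rewrite ler_pXn2r ?nnegrE ?expR_ge0 //; lra.
pose e := expR (- (r * (lam + B) + c)).
have key : r * Ex Pr (Z n) <= (r * (lam + B) + c - 1) + e * Ex Pr (Wt n).
  rewrite -!ExZ // -[X in X + _](Ex_cst Pr) -ExD //; first last.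
  - by apply: bounded_measurableM => //; exact: bounded_measurable_cst.
  - exact: bounded_measurable_cst.
  apply: Ex_le => [||w].
  - by apply: bounded_measurableM => //; exact: bounded_measurable_cst.
  - apply: bounded_measurableD; first exact: bounded_measurable_cst.
    by apply: bounded_measurableM => //; exact: bounded_measurable_cst.
  rewrite /e /Wt -expRD.
  by have := expR_ge1Dx (- (r * (lam + B) + c) + r * Z n w); lra.
have e_le : e * Ex Pr (Wt n) <= 1.
  apply: (@le_trans _ _ (e * (b * (4 / (r * eta))))).
    by rewrite ler_wpM2l ?expR_ge0 // Ex_exp_bound.
  have -> : 4 / (r * eta) = 32 * B ^+ 2 / eta ^+ 2.
    by rewrite /r; field; rewrite !gt_eqF.
  rewrite mulrA /e /b -expRD opprD addrAC addNr add0r expRN mulrC.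
  by rewrite ler_pdivrMr ?expR_gt0 // mul1r.
have : r * Ex Pr (Z n) <= r * (lam + B + 96 * B ^+ 3 / eta ^+ 2).
  have -> : r * (lam + B + 96 * B ^+ 3 / eta ^+ 2) = r * (lam + B) + c.
    by rewrite /r /c; field; rewrite !gt_eqF.
  lra.
by rewrite ler_pM2l.
Qed.

End Slater.
End Comparator.

Lemma Ex_comparator_constraint (t : forall k, A k -> S k -> R) i n :
  Ex Pr (fun w => comparator_value t (g i n w)) = comparator_constraint t i.
Proof.
have := Ex_adapted_mul momega mmu omega_iid omega_mu (n := n) (bounded_measurable_cst 1)
  (bounded_gam t i).
rewrite Ex_cst mul1r => h; apply: (etrans _ h); congr (Ex Pr _).
by apply/funext => w; rewrite mul1r.
Qed.

(** The queue starts at 0 and truncation only raises it, so it dominates the accumulated constraint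
    values. *)
Lemma constraint_sum_le i T :
  \sum_(n < T) Ex Pr (fun w => \sum_k inner (g i n w k) (theta n.+1 w k)) <=
  Ex Pr (Q i T.+1).
Proof.
have bterm n : bounded_measurable (fun w => \sum_k inner (g i n w k) (theta n.+1 w k)).
  apply: (bm (n := n.+1)); apply: bounded_measurable_sum => k.
  by apply: adapted_inner => a s; [exact: adapted_g|exact: adtheta].
rewrite -Ex_sum //; apply: Ex_le => [||w]; first exact: bounded_measurable_sum.
  exact: bm (adQ T i).
have [_ /(_ w)[_ Q1 _ QS]] := alg.
elim: T => [|T IH]; first by rewrite big_ord0 Q1.
by rewrite big_ord_recr /= QS le_max lerD2r IH.
Qed.

(** * Totals collected by the policies actually played *)

Section Play.
Hypothesis hP : forall k, is_transition (@P k).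
Variables (d0 : joint S -> R) (r : nat) (x0 : joint S) (y0 : joint A).
Hypothesis d0_dist : is_dist d0.
Hypothesis products_gt0 : forall k (sgs : seq {ffun S k -> A k}), size sgs = r ->
  forall s s', 0 < pure_product (@P k) sgs s s'.

Let rho := r%:R / (1 - mixing_coef (joint_transition P) r).

Let play_policy w n k : S k -> A k -> R :=
  if n is 0%N then pi0 k else induced_policy (theta n w k).

Let theta_gt0 n w k s : 0 < state_marginal (theta n w k) s.
Proof. exact: state_marginal_gt0 (theta_poly n w k) (@products_gt0 k) s. Qed.

Let play_policy_policy w n k : is_policy (@play_policy w n k).
Proof.
case: n => [|n]; first exact: (alg.1 k).1.
apply: induced_policy_policy; last exact: theta_gt0.
by have [] := theta_poly n.+1 w k.
Qed.

Let theta_playE w n k a s :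
  theta n w k a s = state_marginal (theta n w k) s * @play_policy w n k s a.
Proof.
case: n => [|n]; last by rewrite -induced_policyE //; exact: theta_gt0.
have [hpi [d _ thE]] := alg.1 k.
rewrite thE /state_marginal; under eq_bigr => b _ do rewrite thE.
by rewrite -mulr_sumr (hpi s).2 mulr1.
Qed.

Let algorithm_ruleE n w : algorithm_rule pi0 theta n w = separable_policy (@play_policy w n).
Proof. by case: n. Qed.

Let bounded_rule n x y : bounded_measurable (fun w => algorithm_rule pi0 theta n w x y).
Proof.
have -> : (fun w => algorithm_rule pi0 theta n w x y) =
    fun w => \prod_k @play_policy w n k (x k) (y k).
  by apply/funext => w; rewrite algorithm_ruleE.
apply: bounded_measurable_prod => k; case: n => [|n]; first exact: bounded_measurable_cst.
have bth a s : bounded_measurable (fun w => theta n.+1 w k a s) := bm (@adtheta n.+1 k a s).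
(* Boundedness comes from being a probability: the denominators are positive, with no uniform lower
   bound at hand. *)
split; last first.
  exists 1 => w; have [p0 p1] := @play_policy_policy w n.+1 k (x k).
  rewrite ger0_norm; last exact: p0.
  by rewrite -p1 (bigD1 (y k)) //= lerDl; apply: sumr_ge0 => a _; exact: p0.
apply: measurable_funM; first exact: (bth _ _).1.
apply: measurable_inv_gt0 => [w|]; first exact: theta_gt0.
by have [] := @bounded_measurable_sum _ _ _ _ (index_enum (A k)) xpredT _ (fun a => bth a (x k)).
Qed.

(** The drift inequality evaluates slot n at theta_(n+1), while theta_n is played. The shift costs
    one more total movement, hence the factor [1 + rho]. *)
Lemma algorithm_total_le (h : @value_process R K S A _ Omega) T :
  (forall n w k a s, `|h n w k a s| <= Psi) ->
  (forall n k a s, bounded_measurable (fun w => h n w k a s)) ->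
  expected_total P Pr h T d0 (algorithm_rule pi0 theta) <=
  \sum_(n < T) Ex Pr (fun w => \sum_k inner (h n w k) (theta n.+1 w k)) +
  Psi * ((1 + rho) * ((\sum_k (#|A k| * #|S k|)%:R) *
     (\sum_(n < T) (Psi * (V + \sum_i Ex Pr (Q i n.+1)) / (2 * al)))) + rho * (2 * K%:R)).
Proof.
move=> hh bh.
have gam1 : mixing_coef (joint_transition P) r < 1.
  exact: mixing_coef_joint_lt1 y0 r products_gt0.
have rho0 : 0 <= rho by rewrite divr_ge0 // subr_ge0 ltW.
have bth n k a s : bounded_measurable (fun w => theta n w k a s) := bm (@adtheta n k a s).
have bQ i n : bounded_measurable (Q i n.+1) := bm (adQ n i).
have cst c : bounded_measurable ((fun=> c) : Omega -> R) by exact: bounded_measurable_cst.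
pose N : R := \sum_k (#|A k| * #|S k|)%:R.
pose mv n w : R := N * (Psi * (V + \sum_i Q i n.+1 w) / (2 * al)).
have bmv n : bounded_measurable (mv n).
  apply: bounded_measurableM => //; apply: bounded_measurableM => //.
  apply: bounded_measurableM => //; apply: bounded_measurableD => //.
  exact: bounded_measurable_sum.
have binner n : bounded_measurable (fun w => \sum_k inner (h n w k) (theta n.+1 w k)).
  apply: bounded_measurable_sum => k; apply: bounded_measurable_sum => a.
  by apply: bounded_measurable_sum => s; apply: bounded_measurableM.
have Exmv n : Ex Pr (mv n) = N * (Psi * (V + \sum_i Ex Pr (Q i n.+1)) / (2 * al)).
  have -> : mv n = fun w => N * Psi / (2 * al) * (V + \sum_i Q i n.+1 w).
    by apply/funext => w; rewrite /mv; ring.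
  rewrite ExZ; last by apply: bounded_measurableD => //; apply: bounded_measurable_sum.
  by rewrite ExD ?Ex_cst ?Ex_sum //; [ring|apply: bounded_measurable_sum].
have -> : N * (\sum_(n < T) (Psi * (V + \sum_i Ex Pr (Q i n.+1)) / (2 * al))) =
    \sum_(n < T) Ex Pr (mv n) by rewrite mulr_sumr; apply: eq_bigr => n _; rewrite Exmv.
rewrite -!Ex_sum // -(ExZ _ (1 + rho)); last exact: bounded_measurable_sum.
rewrite -[X in _ + _ * (_ + X)](Ex_cst Pr) -ExD //; last first.
  by apply: bounded_measurableM => //; apply: bounded_measurable_sum.
rewrite -ExZ; last first.
  apply: bounded_measurableD => //; apply: bounded_measurableM => //.
  exact: bounded_measurable_sum.
rewrite -ExD; first last.
- apply: bounded_measurableM => //; apply: bounded_measurableD => //.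
  by apply: bounded_measurableM => //; apply: bounded_measurable_sum.
- exact: bounded_measurable_sum.
rewrite expected_totalE //; last first.
  by move=> n w; rewrite algorithm_ruleE; exact: separable_policy_policy.
apply: Ex_le => [||w].
- by apply: bounded_measurable_sum => n; exact: bounded_occupation_value.
- apply: bounded_measurableD; first exact: bounded_measurable_sum.
  apply: bounded_measurableM => //; apply: bounded_measurableD => //.
  by apply: bounded_measurableM => //; apply: bounded_measurable_sum.
have := @occupation_gap R K S A P hP d0 r Psi d0_dist (ltW Psi_gt0) gam1 y0 x0
  (@play_policy w) (fun n => theta n w) (fun n => h n w) T
  (play_policy_policy w) (fun n => theta_poly n w) (theta_playE w) (fun n => hh n w).
have -> : (fun n => separable_policy (@play_policy w n)) = (fun n => algorithm_rule pi0 theta n w).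
  by apply/funext => n; rewrite algorithm_ruleE.
under [X in `|X - _| <= _ -> _]eq_bigr => n _ do rewrite -algorithm_ruleE.
move=> /(le_trans (ler_norm _)); rewrite lerBlDr => /le_trans; apply.
have hmove : \sum_(n < T) \sum_k l1dist (theta n.+1 w k) (theta n w k) <= \sum_(n < T) mv n w.
  apply: ler_sum => n _; rewrite /mv /N mulr_suml; apply: ler_sum => k _.
  have [_ /(_ w)[_ _ min _]] := alg.
  apply: (@movement_step R K m S A P (f n w) (fun i => g i n w) V al Psi
    (fun i => Q i n.+1 w) (theta n w) (theta n.+1 w)) => // *;
    do ?[exact: fhat_le|exact: ghat_le|exact: queue_ge0|exact: theta_poly].
have hshift : \sum_(n < T) \sum_k inner (h n w k) (theta n w k) <=
    \sum_(n < T) \sum_k inner (h n w k) (theta n.+1 w k) + Psi * \sum_(n < T) mv n w.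
  apply: le_trans (_ : _ <= \sum_(n < T) \sum_k inner (h n w k) (theta n.+1 w k) +
      Psi * \sum_(n < T) \sum_k l1dist (theta n.+1 w k) (theta n w k)) _; last first.
    by rewrite lerD2l ler_pM2l.
  rewrite mulr_sumr -big_split; apply: ler_sum => n _ /=.
  rewrite mulr_sumr -big_split; apply: ler_sum => k _ /=.
  have := inner_l1dist_le (theta n.+1 w k) (theta n w k) (hh n w k).
  by rewrite distrC => /(le_trans (ler_norm _)); rewrite lerBlDl.
have : Psi * (rho * (2 * K%:R + \sum_(n < T) \sum_k l1dist (theta n.+1 w k) (theta n w k))) <=
    Psi * (rho * (2 * K%:R + \sum_(n < T) mv n w)).
  by rewrite ler_pM2l // ler_wpM2l // lerD2l.
rewrite -/rho; move: (rho) => z; lra.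
Qed.

End Play.
End AlgorithmProcess.

(** * Constants *)

Section Constants.
Context {R : realType}.
Variables (Psi eta rho : R).
Hypotheses (Psi_gt0 : 0 < Psi) (eta_gt0 : 0 < eta) (rho_ge0 : 0 <= rho).

Definition drift_constant : R := 2 * Psi + Psi ^+ 2.

(** The summand 2 comes from the initial Lyapunov value 2 alpha K with alpha = T. *)
Definition average_queue_constant : R := (drift_constant + 2) / eta.

(** Mirrors lam + B + 96 B^3 / eta^2: the 5 collects 2 D and the final 1 of lam, and [eta + Psi]
    bounds B per unit of sm k. *)
Definition final_queue_constant : R :=
  2 * drift_constant / eta + 5 + (eta + Psi) + 96 * (eta + Psi) ^+ 3 / eta ^+ 2.

Definition movement_constant : R := Psi * (1 + average_queue_constant).

Definition play_constant : R := Psi * ((1 + rho) * movement_constant + 2 * rho).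

(** In order: the initial Lyapunov value, the second-order queue term and the violation of the
    comparator, all divided by V, and the distance of Pi from its stationary regime. *)
Definition regret_constant : R :=
  2 + Psi ^+ 2 + 2 * Psi * rho * average_queue_constant + 2 * Psi * rho.

Let Psi_ge0 : 0 <= Psi. Proof. exact: ltW. Qed.
Let eta_ge0 : 0 <= eta. Proof. exact: ltW. Qed.

Let c1_ge0 : 0 <= drift_constant.
Proof. by apply: addr_ge0; rewrite ?mulr_ge0 ?sqr_ge0. Qed.

Let c2_ge0 : 0 <= average_queue_constant.
Proof. by apply: divr_ge0; [apply: addr_ge0; [exact: c1_ge0|exact: ler0n]|exact: ltW]. Qed.

Lemma final_queue_constant_ge0 : 0 <= final_queue_constant.
Proof.
have h1 : 0 <= 2 * drift_constant / eta.
  by apply: divr_ge0 => //; exact: mulr_ge0.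
have h2 : 0 <= 96 * (eta + Psi) ^+ 3 / eta ^+ 2.
  by apply: divr_ge0; [apply: mulr_ge0 => //; apply: exprn_ge0; exact: addr_ge0|exact: sqr_ge0].
by have := Psi_gt0; have := eta_gt0; rewrite /final_queue_constant; lra.
Qed.

Lemma regret_constant_ge0 : 0 <= regret_constant.
Proof.
have h1 : 0 <= 2 * Psi * rho by rewrite !mulr_ge0.
have h2 : 0 <= 2 * Psi * rho * average_queue_constant by exact: mulr_ge0.
have := sqr_ge0 Psi; rewrite /regret_constant; lra.
Qed.

(* sm is sqrt m, so that m * sm = m^(3/2), and v is sqrt T. *)
Variables (k m sm N v T : R).
Hypotheses (k_ge1 : 1 <= k) (k_le_N : k <= N) (sm_ge1 : 1 <= sm) (sm2 : sm ^+ 2 = m).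
Hypotheses (v_ge1 : 1 <= v) (v2 : v ^+ 2 = T).

Let base : R := m * sm * k ^+ 2 * N * v.

Let m_ge1 : 1 <= m.
Proof. by rewrite -sm2 exprn_ege1. Qed.

Let k0 : 0 <= k. Proof. exact: le_trans k_ge1. Qed.
Let sm0 : 0 <= sm. Proof. exact: le_trans sm_ge1. Qed.
Let v0 : 0 <= v. Proof. exact: le_trans v_ge1. Qed.
Let m0 : 0 <= m. Proof. exact: le_trans m_ge1. Qed.
Let N_ge1 : 1 <= N. Proof. exact: le_trans k_le_N. Qed.
Let N0 : 0 <= N. Proof. exact: le_trans N_ge1. Qed.
Let T_ge1 : 1 <= T. Proof. by rewrite -v2 exprn_ege1. Qed.
Let T_gt0 : 0 < T. Proof. exact: lt_le_trans T_ge1. Qed.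

Let ge1M (x y : R) : 1 <= x -> 1 <= y -> 1 <= x * y.
Proof. by move=> x1 y1; rewrite -[1]mul1r ler_pM. Qed.

Let mono_ge (x y : R) : 1 <= x -> 0 <= y -> y <= x * y.
Proof. by move=> x1 y0; rewrite ler_peMl. Qed.

Let k2_ge1 : 1 <= k ^+ 2. Proof. exact: exprn_ege1. Qed.

Let mk2v_le : N * (v * (m * k ^+ 2)) <= base.
Proof.
have -> : base = sm * (N * (v * (m * k ^+ 2))) by rewrite /base; ring.
by apply: mono_ge => //; rewrite !mulr_ge0 ?sqr_ge0.
Qed.

Let x_le : v * (m * k ^+ 2) <= base.
Proof. by apply: le_trans mk2v_le; apply: mono_ge => //; rewrite !mulr_ge0 ?sqr_ge0. Qed.

Let x_ge1 : 1 <= v * (m * k ^+ 2).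
Proof. exact: ge1M v_ge1 (ge1M m_ge1 k2_ge1). Qed.

Let vk_le : v * k <= v * (m * k ^+ 2).
Proof.
have -> : v * (m * k ^+ 2) = (m * k) * (v * k) by ring.
by apply: mono_ge; rewrite ?mulr_ge0 // ge1M.
Qed.

Let k_le : k <= v * k.
Proof. exact: mono_ge. Qed.

Let mk2_le : m * k ^+ 2 <= v * (m * k ^+ 2).
Proof. by apply: mono_ge; rewrite ?mulr_ge0 ?sqr_ge0. Qed.

Lemma drift_le : 2 * v * k * Psi + 2^-1 * (m * (k * Psi) ^+ 2) <=
  drift_constant * (v * (m * k ^+ 2)).
Proof.
have h1 : Psi * (v * k) <= Psi * (v * (m * k ^+ 2)) by rewrite ler_pM2l.
have h2 : Psi ^+ 2 * (m * k ^+ 2) <= Psi ^+ 2 * (v * (m * k ^+ 2)).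
  by rewrite ler_pM2l ?exprn_gt0.
have h3 : 0 <= Psi ^+ 2 * (m * k ^+ 2) by rewrite !mulr_ge0 ?sqr_ge0.
have -> : m * (k * Psi) ^+ 2 = Psi ^+ 2 * (m * k ^+ 2) by ring.
rewrite /drift_constant; lra.
Qed.

Lemma average_queue_le SQ :
  eta * SQ <= T * (2 * v * k * Psi + 2^-1 * (m * (k * Psi) ^+ 2)) + 2 * T * k ->
  SQ <= T * (average_queue_constant * (v * (m * k ^+ 2))).
Proof.
move=> h; rewrite -(ler_pM2l eta_gt0); apply: le_trans h _.
have -> : eta * (T * (average_queue_constant * (v * (m * k ^+ 2)))) =
    T * ((drift_constant + 2) * (v * (m * k ^+ 2))).
  by rewrite /average_queue_constant; field; rewrite gt_eqF.
have -> : 2 * T * k = T * (2 * k) by ring.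
rewrite -mulrDr ler_pM2l // [leRHS]mulrDl; apply: lerD; first exact: drift_le.
by rewrite ler_pM2l // (le_trans k_le).
Qed.

Lemma final_queue_le :
  2 * ((2 * v * k * Psi + 2^-1 * (m * (k * Psi) ^+ 2)) / eta + Num.sqrt (4 * T * k)) + 1 +
  (eta / 2 + sm * (k * Psi)) + 96 * (eta / 2 + sm * (k * Psi)) ^+ 3 / eta ^+ 2 <=
  base * final_queue_constant.
Proof.
have base0 : 0 <= base by apply: le_trans x_le; exact: le_trans x_ge1.
have smk_ge1 : 1 <= sm * k by exact: ge1M.
have smk_le : sm * k <= base.
  have -> : base = (m * k * N * v) * (sm * k) by rewrite /base; ring.
  by apply: mono_ge; [exact: ge1M (ge1M (ge1M m_ge1 k_ge1) N_ge1) v_ge1|exact: le_trans smk_ge1].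
(* This term fixes the exponent 3/2 of m; its third factor k is absorbed by N. *)
have smk3_le : (sm * k) ^+ 3 <= base.
  have -> : (sm * k) ^+ 3 = (m * sm * k ^+ 2) * k by rewrite -sm2; ring.
  have -> : base = (m * sm * k ^+ 2) * (v * N) by rewrite /base; ring.
  rewrite ler_wpM2l ?mulr_ge0 ?sqr_ge0 //; apply: le_trans k_le_N _; exact: mono_ge.
have h1 : (2 * v * k * Psi + 2^-1 * (m * (k * Psi) ^+ 2)) / eta <= drift_constant / eta * base.
  have -> : drift_constant / eta * base = drift_constant * base / eta by ring.
  rewrite ler_pM2r ?invr_gt0 //; apply: le_trans drift_le _.
  by rewrite ler_wpM2l.
have h2 : Num.sqrt (4 * T * k) <= 2 * base.
  apply: (@le_trans _ _ (2 * (v * k))); last by rewrite ler_pM2l // (le_trans vk_le).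
  rewrite -[leRHS]ger0_norm ?mulr_ge0 // -sqrtr_sqr ler_wsqrtr //.
  have -> : (2 * (v * k)) ^+ 2 = (4 * T) * k ^+ 2 by rewrite -v2; ring.
  rewrite ler_pM2l ?mulr_gt0 // expr2; exact: mono_ge.
have one_le : 1 <= base by apply: le_trans x_le.
have B_le : eta / 2 + sm * (k * Psi) <= (eta + Psi) * (sm * k).
  have : eta * 1 <= eta * (sm * k) by rewrite ler_pM2l.
  by have := eta_gt0; lra.
have B_le' : eta / 2 + sm * (k * Psi) <= (eta + Psi) * base.
  by apply: le_trans B_le _; rewrite ler_pM2l ?addr_gt0.
have B3_le : (eta / 2 + sm * (k * Psi)) ^+ 3 <= (eta + Psi) ^+ 3 * base.
  apply: (@le_trans _ _ (((eta + Psi) * (sm * k)) ^+ 3)).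
    rewrite ler_pXn2r ?nnegrE // ?mulr_ge0 ?addr_ge0 ?mulr_ge0 ?invr_ge0 // ?ltW //.
  by rewrite exprMn ler_pM2l ?exprn_gt0 ?addr_gt0.
have h3 : 96 * (eta / 2 + sm * (k * Psi)) ^+ 3 / eta ^+ 2 <=
    96 * (eta + Psi) ^+ 3 / eta ^+ 2 * base.
  have -> : 96 * (eta + Psi) ^+ 3 / eta ^+ 2 * base = 96 * ((eta + Psi) ^+ 3 * base) / eta ^+ 2.
    by ring.
  by rewrite ler_pM2r ?invr_gt0 ?exprn_gt0 // ler_pM2l.
have -> : base * final_queue_constant = 2 * (drift_constant / eta * base) + 5 * base +
    (eta + Psi) * base + 96 * (eta + Psi) ^+ 3 / eta ^+ 2 * base.
  by rewrite /final_queue_constant; ring.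
lra.
Qed.

Lemma play_le SQ : SQ <= T * (average_queue_constant * (v * (m * k ^+ 2))) ->
  Psi * ((1 + rho) * (N * (Psi * (T * v + SQ) / (2 * T))) + rho * (2 * k)) <=
  base * play_constant.
Proof.
move=> hSQ.
have h1 : N * (Psi * (T * v + SQ) / (2 * T)) <= base * movement_constant.
  have e1 : T * v + SQ <= T * ((1 + average_queue_constant) * (v * (m * k ^+ 2))).
    rewrite mulrDl mul1r [leRHS]mulrDr lerD // ler_pM2l //.
    have -> : v * (m * k ^+ 2) = (m * k ^+ 2) * v by ring.
    by apply: mono_ge => //; exact: ge1M.
  apply: (@le_trans _ _
    (N * (Psi * (T * ((1 + average_queue_constant) * (v * (m * k ^+ 2)))) / (2 * T)))).
    by rewrite ler_wpM2l // ler_wpM2r ?invr_ge0 ?mulr_ge0 ?(ltW T_gt0) // ler_pM2l.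
  have -> : N * (Psi * (T * ((1 + average_queue_constant) * (v * (m * k ^+ 2)))) / (2 * T)) =
      2^-1 * (movement_constant * (N * (v * (m * k ^+ 2)))).
    by rewrite /movement_constant; field; rewrite gt_eqF.
  have c4 : 0 <= movement_constant by rewrite mulr_ge0 ?addr_ge0 // ltW.
  have : movement_constant * (N * (v * (m * k ^+ 2))) <= movement_constant * base.
    by rewrite ler_wpM2l.
  have : 0 <= movement_constant * (N * (v * (m * k ^+ 2))).
    by apply: mulr_ge0 => //; rewrite !mulr_ge0 ?sqr_ge0.
  lra.
have h2 : (1 + rho) * (N * (Psi * (T * v + SQ) / (2 * T))) <=
    (1 + rho) * (base * movement_constant) by rewrite ler_wpM2l // addr_ge0.
have h3 : rho * k <= rho * base.
  by rewrite ler_wpM2l //; apply: le_trans k_le (le_trans vk_le x_le).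
rewrite /play_constant [leRHS]mulrCA ler_pM2l //; lra.
Qed.

Lemma regret_le SQ reg : SQ <= T * (average_queue_constant * (v * (m * k ^+ 2))) ->
  v * reg <= 2 * T * k + (Psi * (k * (2 * rho)) / T) * SQ +
             T * (2^-1 * (m * (k * Psi) ^+ 2)) ->
  reg + Psi * (k * (2 * rho)) <= base * regret_constant.
Proof.
move=> hSQ hreg; have v_gt0 : 0 < v by exact: lt_le_trans v_ge1.
(* The tolerance is O(1/T) and [SQ] is O(T v); the single [v] left is removed when the regret is
   divided by V = v. *)
have h1 : (Psi * (k * (2 * rho)) / T) * SQ <=
    v * (2 * Psi * rho * average_queue_constant * (m * k ^+ 3)).
  apply: (@le_trans _ _ ((Psi * (k * (2 * rho)) / T) *
      (T * (average_queue_constant * (v * (m * k ^+ 2)))))).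
    by rewrite ler_wpM2l // divr_ge0 ?(ltW T_gt0) // !mulr_ge0 ?(ltW Psi_gt0).
  rewrite le_eqVlt; apply/orP; left; apply/eqP.
  by field; rewrite gt_eqF.
have h2 : reg <= 2 * (v * k) + 2 * Psi * rho * average_queue_constant * (m * k ^+ 3) +
    Psi ^+ 2 * (v * (m * k ^+ 2)).
  rewrite -(ler_pM2l v_gt0); apply: le_trans hreg _.
  have e1 : 2 * T * k = v * (2 * (v * k)) by rewrite -v2; ring.
  have e2 : T * (2^-1 * (m * (k * Psi) ^+ 2)) = 2^-1 * (v * (Psi ^+ 2 * (v * (m * k ^+ 2)))).
    by rewrite -v2; ring.
  have e3 : 0 <= v * (Psi ^+ 2 * (v * (m * k ^+ 2))) by rewrite !mulr_ge0 ?sqr_ge0.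
  rewrite e1 e2 mulrDr [v * (2 * (v * k) + _)]mulrDr; lra.
have mk3_le : m * k ^+ 3 <= base.
  have -> : m * k ^+ 3 = (m * k ^+ 2) * k by ring.
  have -> : base = (m * k ^+ 2) * ((sm * v) * N) by rewrite /base; ring.
  rewrite ler_wpM2l ?mulr_ge0 ?sqr_ge0 //; apply: le_trans k_le_N _; apply: mono_ge => //.
  exact: ge1M.
have h4 : 2 * Psi * rho * average_queue_constant * (m * k ^+ 3) <=
    2 * Psi * rho * average_queue_constant * base.
  by rewrite ler_wpM2l //; apply: mulr_ge0 => //; rewrite !mulr_ge0.
have h5 : Psi ^+ 2 * (v * (m * k ^+ 2)) <= Psi ^+ 2 * base by rewrite ler_wpM2l ?sqr_ge0.
have h6 : v * k <= base by exact: le_trans x_le.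
have h7 : 2 * Psi * rho * k <= 2 * Psi * rho * base.
  by rewrite ler_wpM2l ?mulr_ge0 ?(ltW Psi_gt0) // (le_trans k_le).
rewrite /regret_constant; lra.
Qed.

End Constants.

Theorem theorem6p5p1 (R : realType) :
  exists C : R -> R -> nat -> R -> R,
  forall (K m : nat) (S A : 'I_K -> finType)
    (P : forall k, A k -> S k -> S k -> R)
    (dO dW dM : measure_display)
    (Omega : measurableType dO) (W : measurableType dW) (M : measurableType dM)
    (Pr : probability Omega R)
    (omega : nat -> Omega -> W) (mu : nat -> Omega -> M)
    (ghat : 'I_m -> forall k, A k -> S k -> W -> R)
    (fhat : forall k, A k -> S k -> M -> R)
    (Psi eta : R) (rhat : nat),
  let g : 'I_m -> value_process :=
    fun i t w k a s => ghat i k a s (omega t w) in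
  let f : value_process := fun t w k a s => fhat k a s (mu t w) in
  (0 < m)%N ->
  (forall k, is_transition (P k)) ->
  measurable_process omega -> measurable_process mu ->
  iid Pr omega -> independent_processes Pr omega mu ->
  (forall i k a s, measurable_fun setT (ghat i k a s)) ->
  (forall k a s, measurable_fun setT (fhat k a s)) ->
  (forall i k a s v, `|ghat i k a s v| <= Psi) ->
  (forall k a s v, `|fhat k a s v| <= Psi) ->
  (1 <= rhat)%N -> positive_products P rhat ->
  0 < eta -> slater P Pr g eta ->
  forall (T : nat) (d0 : joint S -> R) (pi0 : forall k, S k -> A k -> R)
    (theta : value_process) (Q : 'I_m -> nat -> Omega -> R),
  (0 < T)%N -> is_dist d0 ->
  algorithm_iterates P f g (Num.sqrt T%:R) T%:R pi0 theta Q ->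
  let bound := C Psi eta rhat (mixing_coef (joint_transition P) rhat) *
    (m%:R `^ (3 / 2) * K%:R ^+ 2 * (\sum_k (#|A k| * #|S k|)%N%:R) *
     Num.sqrt T%:R) in
  (forall Pi : joint S -> joint A -> R, is_policy Pi ->
     feasible_pairs P Pr g T (d0, stationary_rule Pi) ->
     expected_total P Pr f T d0 (algorithm_rule pi0 theta) -
     expected_total P Pr f T d0 (stationary_rule Pi) <= bound) /\
  (forall i : 'I_m,
     expected_total P Pr (g i) T d0 (algorithm_rule pi0 theta) <= bound).
Proof.
(* One constant serves both claims: the constraints use the final-queue and play parts, the regret
   uses the regret and play parts. *)
exists (fun Psi eta r gam => let rho := r%:R / (1 - gam) in
  final_queue_constant Psi eta + regret_constant Psi eta rho + play_constant Psi eta rho).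
move=> K m S A P dO dW dM Omega W M Pr omega mu ghat fhat Psi eta rhat g f m_gt0 hP
  momega mmu omega_iid omega_mu mghat mfhat ghat_le fhat_le rhat_gt0 hpos eta_gt0 hslater
  T d0 pi0 theta Q T_gt0 hd0 alg bound.
have hpos' k (sgs : seq {ffun S k -> A k}) : size sgs = rhat ->
    forall s s', 0 < pure_product (P k) sgs s s'.
  by move=> hs; apply: hpos; rewrite hs.
have [x0 _] : exists x0 : joint S, true.
  case: (pickP (fun _ : joint S => true)) => [x _|no]; first by exists x.
  by have := hd0.2; rewrite big_pred0 // => /esym/eqP; rewrite oner_eq0.
have hA k : exists a : A k, true.
  case: (pickP (fun _ : A k => true)) => [a _|no]; first by exists a.
  by have := ((alg.1 k).1 (x0 k)).2; rewrite big_pred0 // => /esym/eqP; rewrite oner_eq0.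
pose y0 : joint A := [ffun k => projT1 (cid (hA k))].
pose gam := mixing_coef (joint_transition P) rhat.
have gam1 : gam < 1 by exact: (mixing_coef_joint_lt1 hP y0 hpos').
pose rho : R := rhat%:R / (1 - gam).
have rho0 : 0 <= rho by rewrite divr_ge0 // subr_ge0 ltW.
have bg i n k a s : bounded_measurable (fun w => g i n w k a s).
  split; last by exists Psi => w; exact: ghat_le.
  exact: measurableT_comp (mghat i k a s) (momega n).
have bf n k a s : bounded_measurable (fun w => f n w k a s).
  split; last by exists Psi => w; exact: fhat_le.
  exact: measurableT_comp (mfhat k a s) (mmu n).
have hJ := joint_transition_transition hP.
have [tpi [dt [htpi hdt hsl]]] := hslater.
have hsep := separable_policy_policy htpi.
pose t k := @coord_occupation R K S A (fun x y => dt x * separable_policy tpi x y) k.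
have t_poly k : in_polyhedron (P k) (t k) by exact: (coord_occupation_polyhedron hP k hsep hdt).
(* At slot 0 the law of the state is [dt] itself, so the Slater condition there reads directly as a
   bound on the occupation [t]. *)
have slack i : comparator_constraint Pr omega ghat t i <= - eta.
  by have := hsl i 0%N; rewrite slot_expectationE.
(* The slack cannot exceed the largest possible constraint value. This gives K > 0 and Psi > 0. *)
have KPsi : eta <= K%:R * Psi.
  pose i0 : 'I_m := Ordinal m_gt0.
  have := slack i0; rewrite lerNr => /le_trans; apply.
  rewrite lerNl -[leLHS](Ex_cst Pr); apply: Ex_le => [||w].
  - exact: bounded_measurable_cst.
  - apply: bounded_measurable_sum => k; apply: bounded_measurable_sum => a.
    apply: bounded_measurable_sum => s; apply: bounded_measurableM.
      exact: (bg i0 0%N k a s).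
    exact: bounded_measurable_cst.
  rewrite lerNl; apply: le_trans (ler_norm _) _; rewrite normrN.
  by apply: (@sum_inner_norm_le R K S A P Psi) => // *; exact: ghat_le.
have K_gt0 : (0 < K)%N.
  by rewrite lt0n; apply/eqP => K0; move: KPsi; rewrite K0 mul0r leNgt eta_gt0.
have KR_gt0 : 0 < K%:R :> R by rewrite ltr0n.
have Psi_gt0 : 0 < Psi by rewrite -(pmulr_rgt0 _ KR_gt0) (lt_le_trans eta_gt0).
have TR_gt0 : 0 < T%:R :> R by rewrite ltr0n.
pose v : R := Num.sqrt T%:R; have v_gt0 : 0 < v by rewrite sqrtr_gt0.
have v2 : v ^+ 2 = T%:R by rewrite sqr_sqrtr // ltW.
have v_ge1 : 1 <= v by rewrite -[1]sqrtr1 ler_wsqrtr // ler1n.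
pose sm : R := Num.sqrt m%:R.
have sm2 : sm ^+ 2 = m%:R by rewrite sqr_sqrtr.
have sm_ge1 : 1 <= sm by rewrite -[1]sqrtr1 ler_wsqrtr // ler1n.
have k_ge1 : 1 <= K%:R :> R by rewrite ler1n.
pose N : R := \sum_k (#|A k| * #|S k|)%N%:R.
have k_le_N : K%:R <= N.
  have -> : K%:R = \sum_(k < K) 1 :> R by rewrite sumr_const card_ord.
  apply: ler_sum => k _; rewrite ler1n muln_gt0.
  by apply/andP; split; apply/card_gt0P; [exists (y0 k)|exists (x0 k)].
have base0 : 0 <= m%:R * sm * K%:R ^+ 2 * N * v.
  have sm0 : 0 <= sm by exact: sqrtr_ge0.
  have N0 : 0 <= N by exact: le_trans k_le_N.
  have v0 : 0 <= v by exact: sqrtr_ge0.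
  by rewrite !mulr_ge0 ?sqr_ge0.
have boundE : bound = (m%:R * sm * K%:R ^+ 2 * N * v) *
    (final_queue_constant Psi eta + regret_constant Psi eta rho + play_constant Psi eta rho).
  have powm : m%:R `^ (3 / 2) = m%:R * sm :> R.
    have -> : 3 / 2 = 1 + 2^-1 :> R by field.
    by rewrite powRD ?powRr1 ?powR12_sqrt //; apply/implyP; rewrite pnatr_eq0 -lt0n m_gt0.
  by rewrite /bound -/gam -/rho powm mulrC.
pose SQ : R := \sum_(n < T) \sum_i Ex Pr (Q i n.+1).
have hSQ : SQ <= T%:R * (average_queue_constant Psi eta * (v * (m%:R * K%:R ^+ 2))).
  apply: (average_queue_le Psi_gt0 eta_gt0 k_ge1 sm_ge1 sm2 v_ge1 v2).
  exact: (average_queue momega mmu omega_iid omega_mu mghat mfhat ghat_le fhat_le Psi_gt0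
    v_gt0 TR_gt0 alg t_poly slack T).
have final_ge0 := final_queue_constant_ge0 Psi_gt0 eta_gt0.
have regret_ge0 := regret_constant_ge0 Psi_gt0 eta_gt0 rho0.
have play (h : value_process) : (forall n w k a s, `|h n w k a s| <= Psi) ->
    (forall n k a s, bounded_measurable (fun w => h n w k a s)) ->
    expected_total P Pr h T d0 (algorithm_rule pi0 theta) <=
    \sum_(n < T) Ex Pr (fun w => \sum_k inner (h n w k) (theta n.+1 w k)) +
    (m%:R * sm * K%:R ^+ 2 * N * v) * play_constant Psi eta rho.
  move=> hh bh. apply: le_trans (algorithm_total_le Pr momega mmu mghat mfhat
    ghat_le fhat_le Psi_gt0 v_gt0 TR_gt0 alg hP x0 y0 hd0 hpos' T hh bh) _.
  rewrite lerD2l; have hsum : \sum_(n < T) Psi * (v + \sum_i Ex Pr (Q i n.+1)) / (2 * T%:R) =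
      Psi * (T%:R * v + SQ) / (2 * T%:R).
    rewrite -mulr_suml -mulr_sumr big_split /= sumr_const card_ord.
    by rewrite [X in _ = _ * (X + _) / _]mulr_natl.
  rewrite hsum; exact: (play_le Psi_gt0 eta_gt0 rho0 k_ge1 k_le_N sm_ge1 sm2 v_ge1 v2 hSQ).
split; last first.
  move=> i; rewrite boundE; apply: le_trans (play (g i) _ (bg i)) _.
    by move=> *; exact: ghat_le.
  rewrite mulrDr lerD2r mulrDr.
  apply: le_trans (constraint_sum_le Pr momega mmu mghat mfhat ghat_le fhat_le TR_gt0 alg i T) _.
  apply: le_trans (Ex_queue_le momega mmu omega_iid omega_mu mghat mfhat ghat_le fhat_le
    Psi_gt0 v_gt0 TR_gt0 alg t_poly eta_gt0 slack i T) _.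
  apply: le_trans (final_queue_le Psi_gt0 eta_gt0 k_ge1 k_le_N sm_ge1 sm2 v_ge1 v2) _.
  by rewrite lerDl mulr_ge0.
move=> Pi hPi hfeas.
have [d hd] := stationary_exists x0 hJ hPi.
pose c k := @coord_occupation R K S A (fun x y => d x * Pi x y) k.
have c_poly k : in_polyhedron (P k) (c k) by exact: (coord_occupation_polyhedron hP k hPi hd).
have gap (h : value_process) : (forall n w k a s, `|h n w k a s| <= Psi) ->
    (forall n k a s, bounded_measurable (fun w => h n w k a s)) ->
    \sum_(n < T) Ex Pr (fun w => comparator_value c (h n w)) <=
    expected_total P Pr h T d0 (stationary_rule Pi) + Psi * (K%:R * (2 * rho)).
  by move=> hh bh; exact: (stationary_total_ge Pr T hP hd0 (ltW Psi_gt0) gam1 hPi hd hh bh).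
have eps_ge0 : 0 <= Psi * (K%:R * (2 * rho)) / T%:R.
  apply: divr_ge0; last exact: ltW.
  by apply: mulr_ge0; [exact: ltW|apply: mulr_ge0 => //; exact: mulr_ge0].
(* Feasibility of Pi bounds the stationary total by O(1); the slots contribute equally in
   expectation, so each one violates by O(1/T). *)
have hcc i : comparator_constraint Pr omega ghat c i <= Psi * (K%:R * (2 * rho)) / T%:R.
  rewrite ler_pdivlMr // mulrC.
  have <- : \sum_(n < T) Ex Pr (fun w => comparator_value c (g i n w)) =
      T%:R * comparator_constraint Pr omega ghat c i.
    rewrite mulr_natl -[X in _ *+ X](card_ord T) -sumr_const; apply: eq_bigr => n _.
    exact: (Ex_comparator_constraint momega mmu omega_iid omega_mu mghat ghat_le c i n).
  apply: le_trans (gap (g i) _ (bg i)) _; first by move=> *; exact: ghat_le.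
  by rewrite gerDr; exact: hfeas.
have hreg := comparator_regret momega mmu omega_iid omega_mu mghat mfhat ghat_le fhat_le
  Psi_gt0 TR_gt0 alg c_poly T eps_ge0 hcc.
have := regret_le Psi_gt0 eta_gt0 rho0 k_ge1 k_le_N sm_ge1 sm2 v_ge1 v2 hSQ hreg.
have := play f (fun n w k a s => fhat_le k a s _) bf.
have := gap f (fun n w k a s => fhat_le k a s _) bf.
have := mulr_ge0 base0 final_ge0.
rewrite boundE sumrB !mulrDr; lra.
Qed.
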